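(* Let $\mathcal{N}$ be a near octagon of order $(2,4)$ containing a subgeometry isomorphic to the dual split Cayley hexagon $\mathrm{H}(2)^D$ that is isometrically embedded in $\mathcal{N}$. Then $\mathcal{N}$ is isomorphic to the Hall-Janko near octagon $\mathsf{HJ}$.
   Context: A partial linear space has order $(s,t)$ if every line has exactly $s+1$ points and every point is on exactly $t+1$ lines. Distances are measured in the collinearity graph. A near $2d$-gon is a partial linear space whose collinearity graph is connected of diameter $d$ and such that for every point $x$ and every line $L$ there is a unique point on $L$ nearest to $x$; a near octagon is a near $8$-gon. A subgeometry is isometrically embedded if distances between its points measured in it and in the ambient geometry coincide. $\mathrm{H}(2)^D$ is the point-line dual of the split Cayley hexagon $\mathrm{H}(2)$ of order $(2,2)$. The Hall-Janko near octagon $\mathsf{HJ}$ is the geometry whose points are the $315$ central involutions of the Hall-Janko group $J_2$ and whose lines are the triples $\{x,y,xy\}$ with $x,y$ distinct commuting central involutions; equivalently, it is the unique regular near octagon with parameters $(2,4;0,3)$. *)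

(* Defs.v *)
From HB Require Import structures.
From mathcomp Require Import all_boot all_order all_algebra.
From mathcomp Require Import all_fingroup all_solvable.

Set Implicit Arguments.
Unset Strict Implicit.
Unset Printing Implicit Defensive.

Import GRing.Theory.

(* Point-line geometries are not assumed to be finite. *)
Record geometry := Geometry {
  point : Type;
  line : Type;
  inc : point -> line -> Prop
}.

Definition dual (S : geometry) : geometry :=
  @Geometry (line S) (point S) (fun L x => inc x L).

Definition isomorphic (S T : geometry) : Prop :=
  exists (f : point S -> point T) (g : line S -> line T),
    [/\ bijective f, bijective g
      & forall x L, inc x L <-> inc (f x) (g L)].

Definition has_card (T : Type) (A : T -> Prop) (n : nat) : Prop :=
  exists f : 'I_n -> T, injective f /\ (forall x, A x <-> exists i, f i = x).

Definition partial_linear_space (S : geometry) : Prop :=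
  (forall (x y : point S) (L M : line S),
     x <> y -> inc x L -> inc y L -> inc x M -> inc y M -> L = M) /\
  (forall L : line S, exists x y : point S, [/\ x <> y, inc x L & inc y L]).

Definition has_order (s t : nat) (S : geometry) : Prop :=
  (forall L : line S, has_card (fun x : point S => inc x L) s.+1) /\
  (forall x : point S, has_card (fun L : line S => inc x L) t.+1).

Definition collinear (S : geometry) (x y : point S) : Prop :=
  x <> y /\ exists L, inc x L /\ inc y L.

Inductive walk (S : geometry) : nat -> point S -> point S -> Prop :=
| walk0 x : walk 0 x x
| walkS n x y z : collinear x y -> walk n y z -> walk n.+1 x z.

(* The distance is a relation because it is undefined (infinite) between
   points in different connected components. *)
Definition is_dist (S : geometry) (x y : point S) (n : nat) : Prop :=
  walk n x y /\ (forall m, walk m x y -> n <= m).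

Definition connected (S : geometry) : Prop :=
  forall x y : point S, exists n, walk n x y.

Definition has_diameter (d : nat) (S : geometry) : Prop :=
  (forall (x y : point S) n, is_dist x y n -> n <= d) /\
  (exists x y : point S, is_dist x y d).

Definition nearest (S : geometry) (x : point S) (L : line S) (y : point S) :=
  inc y L /\
  (forall z m n, inc z L -> is_dist x y m -> is_dist x z n -> m <= n).

(* [near_polygon d S] : S is a near 2d-gon. *)
Definition near_polygon (d : nat) (S : geometry) : Prop :=
  [/\ partial_linear_space S, connected S, has_diameter d S
    & forall (x : point S) (L : line S), exists! y, nearest x L y].

Definition near_octagon : geometry -> Prop := near_polygon 4.

Definition subgeometry (S : geometry) (A : point S -> Prop)
    (B : line S -> Prop) : geometry :=
  @Geometry {x : point S | A x} {L : line S | B L}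
    (fun x L => inc (sval x) (sval L)).

Definition isometrically_embedded (S : geometry) (A : point S -> Prop)
    (B : line S -> Prop) : Prop :=
  forall (x y : point (subgeometry A B)) (n : nat),
    is_dist x y n <-> is_dist (sval x) (sval y) n.

Section SplitCayleyHexagon.

Local Open Scope ring_scope.

Local Notation vec := 'rV['F_2]_7.

Definition coord (x : vec) (i : nat) : 'F_2 := x 0 (inord i).

Definition quadric (x : vec) : 'F_2 :=
  coord x 0 * coord x 4 + coord x 1 * coord x 5 + coord x 2 * coord x 6
  - coord x 3 ^+ 2.

Definition grassmann (x y : vec) (i j : nat) : 'F_2 :=
  coord x i * coord y j - coord x j * coord y i.

(* Over the field with two elements the points of PG(6,2) are the nonzero
   vectors, and the line through x and y is {x, y, x + y}. *)
Definition H2_point (x : vec) : bool := (x != 0) && (quadric x == 0).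

(* Tits' description of the split Cayley hexagon on the quadric Q(6,q). *)
Definition H2_line (B : {set vec}) : bool :=
  [exists x, exists y,
    [&& x != y, H2_point x, H2_point y, H2_point (x + y),
        B == [set x; y; x + y],
        grassmann x y 1 2 == grassmann x y 3 4,
        grassmann x y 5 4 == grassmann x y 3 2,
        grassmann x y 2 0 == grassmann x y 3 5,
        grassmann x y 6 5 == grassmann x y 3 0,
        grassmann x y 0 1 == grassmann x y 3 6
      & grassmann x y 4 6 == grassmann x y 3 1]].

Definition H2 : geometry :=
  @Geometry {x : vec | H2_point x} {B : {set vec} | H2_line B}
    (fun x B => sval x \in sval B).

End SplitCayleyHexagon.

Definition H2D : geometry := dual H2.

Section HallJankoGroup.

Definition table_fun (s : seq nat) (i : 'I_100) : 'I_100 := inord (nth 0 s i).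

Lemma table_fun_inj (s : seq nat) :
  perm_eq s (iota 0 100) -> injective (table_fun s).
Proof.
move=> ps i j /(congr1 val).
have sz : size s = 100 by rewrite (perm_size ps) size_iota.
have lt (k : 'I_100) : nth 0 s k < 100.
  have /(mem_nth 0) : k < size s by rewrite sz ltn_ord.
  by rewrite (perm_mem ps) mem_iota.
rewrite /= !inordK ?lt // => /eqP.
rewrite nth_uniq ?sz ?ltn_ord ?(perm_uniq ps) ?iota_uniq // => /eqP.
exact: val_inj.
Qed.

Definition table_perm (s : seq nat) (ps : perm_eq s (iota 0 100)) :
  {perm 'I_100} := perm (table_fun_inj ps).

(* Standard generators (in the sense of the ATLAS of Group Representations)
   of the Hall-Janko group in its rank 3 action on the 100 vertices of the
   Hall-Janko graph, the action with point stabilizer U_3(3) and subdegrees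
   1, 36, 63:  a is in class 2B, b is in class 3B, ab has order 7 and
   abab^2 has order 12.  The i-th entry of a table is the image of i. *)
Definition J2_table_a : seq nat :=
  [::  1;  0;  3;  2;  5;  4;  7;  6;  9;  8;
      11; 10; 13; 12; 15; 14; 17; 16; 19; 18;
      21; 20; 23; 22; 25; 24; 27; 26; 29; 28;
      31; 30; 33; 32; 35; 34; 37; 36; 39; 38;
      41; 40; 43; 42; 45; 44; 47; 46; 49; 48;
      51; 50; 53; 52; 55; 54; 57; 56; 59; 58;
      61; 60; 63; 62; 65; 64; 67; 66; 69; 68;
      71; 70; 73; 72; 75; 74; 77; 76; 79; 78;
      81; 80; 83; 82; 85; 84; 87; 86; 89; 88;
      91; 90; 93; 92; 95; 94; 97; 96; 99; 98].

Definition J2_table_b : seq nat :=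
  [::  0;  2;  4;  6;  1;  8; 10;  7; 11; 12;
       3;  5; 14; 15;  9; 16; 13; 18; 20; 22;
      17; 24; 26; 21; 23; 28; 19; 30; 32; 34;
      36; 38; 25; 40; 42; 37; 27; 44; 46; 48;
      49; 50; 29; 52; 35; 54; 31; 41; 56; 33;
      47; 58; 60; 62; 64; 66; 39; 68; 67; 61;
      43; 70; 65; 63; 45; 53; 72; 51; 69; 57;
      59; 74; 55; 76; 78; 73; 75; 80; 71; 82;
      84; 79; 81; 86; 77; 88; 90; 92; 93; 94;
      83; 89; 96; 85; 91; 95; 87; 98; 99; 97].

Lemma J2_table_a_perm : perm_eq J2_table_a (iota 0 100).
Proof. by vm_compute. Qed.

Lemma J2_table_b_perm : perm_eq J2_table_b (iota 0 100).
Proof. by vm_compute. Qed.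

Definition J2 : {group {perm 'I_100}} :=
  <<[set table_perm J2_table_a_perm; table_perm J2_table_b_perm]>>%G.

End HallJankoGroup.

Section InvolutionGeometry.

Local Open Scope group_scope.

Variables (gT : finGroupType) (G : {group gT}).

(* An involution is central if it lies in the centre of a Sylow 2-subgroup. *)
Definition central_involution (x : gT) : bool :=
  (#[x] == 2) && [exists P in 'Syl_2(G), x \in 'Z(P)].

Definition involution_line (B : {set gT}) : bool :=
  [exists x, exists y,
    [&& central_involution x, central_involution y, x != y,
        x * y == y * x & B == [set x; y; x * y]]].

Definition involution_geometry : geometry :=
  @Geometry {x : gT | central_involution x} {B : {set gT} | involution_line B}
    (fun x B => sval x \in sval B).

End InvolutionGeometry.

Definition HJ : geometry := involution_geometry J2.

(* Main.v *)
From HB Require Import structures.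
From Stdlib Require Import PArith Classical ClassicalEpsilon.
From mathcomp Require Import all_boot all_order all_algebra.
From mathcomp Require Import all_fingroup all_solvable.
From mathcomp Require Import zify.
Require Import Defs.

(**
Let H be the isometric copy of H(2)^D.  A point x of N is recorded by its
state, the list of the distances from x to the 63 points of H.  The three
states of a line of N are such that at each point of H one of the distances is
smaller by one than the two others, so that two of them determine the third;
on the lines of H every state has the same property.  A search shows that a
state with minimum 1, taken at p, is of one of four kinds:
(A) q |-> d(p,q) + 1;  (B) one of the four states that are taken in the
Hall-Janko near octagon by the neighbours of p outside H ("outer states");
(b) values 1, 2, 3 taken 1, 22, 40 times;  (C) values 1, 2, 3 taken 5, 26, 32
times.  Kind (C) is impossible because a neighbour in H would be too far in
some other coordinate, and kind (b) because the points of H at distance 2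
would provide 16 different neighbours of x, which has only 10.

If some x has an outer state j, then the midpoints between x and the eight
points of H at distance 2 from x that are not adjacent to p realise all the
states adjacent to j in the Hall-Janko near octagon, and these exhaust the ten
neighbours of x.  By connectedness all 315 states occur, each once, and the
state map is an isomorphism.

If there is no outer state, then all points outside H that are met are of kind
(A), so that they project onto H.  Every point p of H lies on two extra lines;
call extra lines at adjacent points p, q parallel when they contain collinear
points outside H.  Each of the four other lines through a point over p joins
it to an extra line at a neighbour of p, so for some neighbour m an extra line at p is
parallel to both extra lines at m.  Then the extra lines of two adjacent
points are either all parallel, or parallel in pairs, and every point of H is
on a line of the first type; two such lines at distance 1 give a point with
two nearest points on a line.

Finally, a stabilizer chain bounds the order of J_2 by 604800 = 315 * 1920,
which identifies a subgroup of order 128 as a Sylow subgroup.  Its centre has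
one involution, so the central involutions form the conjugacy class of that
involution; its 315 elements are listed, and their products give the lines.
*)

Set Implicit Arguments.
Unset Strict Implicit.
Unset Printing Implicit Defensive.

(** * The table of the Hall-Janko near octagon and its states *)

(* A permutation of the 100 vertices is stored as a binary tree of depth 7 whose
   leaf at i + 128, read as a sequence of seven bits, is the image of i. *)
Inductive tree := Tip of positive | Br of tree & tree.

Fixpoint get (t : tree) (p : positive) : positive :=
  match t, p with
  | Tip v, _ => v
  | Br l _, xO q => get l q
  | Br _ r, xI q => get r q
  | Br _ _, xH => xH
  end.

Fixpoint tmap (f : positive -> positive) (t : tree) : tree :=
  match t with
  | Tip v => Tip (f v)
  | Br l r => Br (tmap f l) (tmap f r)
  end.

Fixpoint build (d : nat) (f : positive -> positive) : tree :=
  if d is d'.+1 then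
    Br (build d' (fun p => f (xO p))) (build d' (fun p => f (xI p)))
  else Tip (f xH).

Fixpoint eqt (s t : tree) : bool :=
  match s, t with
  | Tip x, Tip y => Pos.eqb x y
  | Br l r, Br l' r' => if eqt l l' then eqt r r' else false
  | _, _ => false
  end.

Definition tree_comp (s t : tree) : tree := tmap (get t) s.

Definition enc (i : nat) : positive := Pos.of_nat (128 + i).
Definition dec (p : positive) : nat := Pos.to_nat p - 128.
Definition vertex_code (p : positive) : bool := 128 <= Pos.to_nat p < 228.

Definition tree_of (f : nat -> nat) : tree :=
  build 7 (fun p => if vertex_code p then enc (f (dec p)) else p).

Definition tree_a : tree := Eval vm_compute in tree_of (nth 0 J2_table_a).
Definition tree_b : tree := Eval vm_compute in tree_of (nth 0 J2_table_b).
Definition tree_b2 : tree := Eval vm_compute in tree_comp tree_b tree_b.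
Definition tree_1 : tree := Eval vm_compute in tree_of id.

(* [e1; e2; ...] stands for a b^e1 a b^e2 ..., paired with its inverse. *)
Definition word_pair (w : seq nat) : tree * tree :=
  foldl (fun (s : tree * tree) e =>
      let (c, d) := if e == 1 then (tree_b, tree_b2) else (tree_b2, tree_b) in
      (tree_comp (tree_comp s.1 tree_a) c, tree_comp d (tree_comp tree_a s.2)))
    (tree_1, tree_1) w.

Section Explore.
Variables (T : Type) (same : T -> T -> bool) (succ : T -> seq T).

Fixpoint memt (y : T) (l : seq T) : bool :=
  if l is x :: l' then if same y x then true else memt y l' else false.

(* breadth-first closure of [todo]; [same] decides which elements are identified *)
Fixpoint explore (n : nat) (todo seen : seq T) : seq T :=
  if n is n'.+1 then
    if todo is x :: todo' then
      let new := foldl (fun l y => if memt y seen then l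
                          else if memt y l then l else rcons l y) [::] (succ x) in
      explore n' (todo' ++ new) (seen ++ new)
    else seen
  else seen.
End Explore.

(** This is [(abab^2)^6]; since [abab^2] has order 12, it is an involution. *)
Definition zt : tree := Eval vm_compute in (word_pair [:: 1; 2; 1; 2; 1; 2; 1; 2; 1; 2; 1; 2]).1.

Definition zclass_list : seq tree :=
  explore eqt
    (fun s => [:: tree_comp (tree_comp tree_a s) tree_a; tree_comp (tree_comp tree_b2 s) tree_b])
    316 [:: zt] [:: zt].

(* Tables are locked because unification would otherwise try to evaluate them. *)
Definition zclass : seq tree := locked zclass_list.

Lemma zclassE : zclass = zclass_list.
Proof. by rewrite /zclass -lock. Qed.

(* Lists first the 63 central involutions that fix vertex 0, which span an isometric
   H(2)^D, in the order of [line_pairs] below; the others follow, each but the first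
   commuting with an earlier one of them. *)
Definition zorder : seq nat :=
  [:: 13; 132; 201; 72; 259; 185; 207; 231; 130; 224; 303; 310; 210; 101; 180; 42; 38; 34;
      291; 29; 148; 177; 35; 242; 93; 159; 171; 188; 241; 65; 208; 222; 83; 289; 302; 243;
      311; 301; 247; 196; 184; 133; 127; 110; 44; 187; 19; 228; 113; 102; 33; 216; 15; 212;
      261; 299; 164; 223; 39; 37; 87; 278; 190; 0; 181; 202; 213; 232; 258; 274; 304; 305;
      306; 36; 62; 98; 197; 221; 239; 249; 26; 56; 115; 178; 203; 234; 256; 24; 51; 123;
      142; 215; 254; 298; 20; 32; 59; 106; 161; 238; 286; 58; 96; 125; 172; 204; 230; 273;
      57; 63; 144; 182; 191; 279; 287; 86; 104; 151; 219; 225; 246; 250; 263; 90; 105; 154;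
      175; 227; 237; 253; 99; 120; 134; 209; 235; 264; 277; 45; 49; 88; 103; 118; 166; 288;
      75; 81; 82; 122; 147; 163; 268; 12; 73; 121; 136; 150; 168; 282; 21; 50; 64; 138;
      139; 218; 251; 1; 25; 67; 79; 220; 255; 257; 2; 23; 48; 135; 157; 214; 240; 284;
      4; 61; 76; 162; 186; 267; 280; 43; 165; 170; 179; 68; 71; 129; 183; 10; 66; 114;
      152; 294; 17; 155; 198; 229; 28; 70; 74; 217; 233; 5; 54; 143; 244; 292; 3; 55;
      116; 193; 296; 46; 111; 131; 195; 276; 77; 95; 149; 248; 6; 108; 124; 192; 312; 40;
      91; 97; 174; 252; 11; 94; 156; 206; 7; 52; 119; 236; 313; 8; 160; 200; 309; 128;
      158; 145; 275; 69; 84; 92; 107; 80; 85; 9; 173; 41; 141; 60; 189; 126; 260; 137;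
      308; 194; 226; 271; 47; 140; 205; 211; 78; 14; 53; 30; 146; 314; 109; 272; 285; 270;
      169; 16; 293; 89; 290; 300; 153; 176; 283; 297; 27; 167; 245; 18; 281; 117; 100; 266;
      199; 295; 262; 307; 112; 269; 22; 31; 265].

Definition invol : seq tree := [seq nth tree_1 zclass i | i <- zorder].

(** Compares [t(s(i))] with [s(t(i))] leaf by leaf, so that the first discrepancy ends the test and
    neither product is built. *)
Fixpoint commute_at (s t u v : tree) : bool :=
  match u, v with
  | Tip x, Tip y => Pos.eqb (get t x) (get s y)
  | Br l r, Br l' r' => if commute_at s t l l' then commute_at s t r r' else false
  | _, _ => false
  end.

Definition tree_commute (s t : tree) : bool := commute_at s t s t.

Fixpoint find_pos (T : Type) (a : T -> bool) (s : seq T) : nat :=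
  if s is x :: s' then if a x then 0 else (find_pos a s').+1 else 0.

Fixpoint lines_from (inv : seq tree) (j : nat) (l : seq tree) : seq (nat * nat * nat) :=
  if l is s :: l' then
    (fix scan (k : nat) (m : seq tree) : seq (nat * nat * nat) :=
       if m is t :: m' then
         if tree_commute s t then
           let k' := find_pos (eqt (tree_comp s t)) inv in
           if k < k' then (j, k, k') :: scan k.+1 m' else scan k.+1 m'
         else scan k.+1 m'
       else [::]) j.+1 l' ++ lines_from inv j.+1 l'
  else [::].

Definition hj_lines : seq (nat * nat * nat) :=
  let I := [seq nth tree_1 zclass_list i | i <- zorder] in lines_from I 0 I.

Definition hj_pairs_table : seq (seq (nat * nat)) := Eval vm_compute in
  let L := hj_lines in
  [seq flatten [seq let: (a, b, c) := l in
                if eqn j a then [:: (b, c); (c, b)] else if eqn j b then [:: (a, c); (c, a)]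
                else if eqn j c then [:: (a, b); (b, a)] else [::] | l <- L]
    | j <- iota 0 315].

Definition hj_pairs : seq (seq (nat * nat)) := locked hj_pairs_table.

Lemma hj_pairsE : hj_pairs = hj_pairs_table.
Proof. by rewrite /hj_pairs -lock. Qed.

(* the pairs (k, l) such that {j, k, l} is a line *)
Definition pairs (j : nat) : seq (nat * nat) := nth [::] hj_pairs j.
Definition nb (j : nat) : seq nat := [seq p.1 | p <- pairs j].

(* One round of relaxation: 4 rounds compute the distances to the first 63 points. *)
Definition dist_round (st : seq (seq nat)) : seq (seq nat) :=
  let relax p r := [seq minn q.1 q.2.+1 | q <- zip r p] in
  [seq foldr (fun k r => relax (nth [::] st k) r) (nth [::] st j)
      [seq p.1 | p <- nth [::] hj_pairs_table j] | j <- iota 0 315].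

Definition states_table : seq (seq nat) := Eval vm_compute in
  iter 4 dist_round [seq [seq if eqn i j then 0 else 9 | i <- iota 0 63] | j <- iota 0 315].

Definition states : seq (seq nat) := locked states_table.

Lemma statesE : states = states_table.
Proof. by rewrite /states -lock. Qed.

(* found by experiment, to keep the search below small *)
Definition search_order : seq nat :=
  [:: 0; 10; 12; 39; 40; 41; 42; 1; 2; 25; 52; 47; 49; 34; 45; 60; 43; 22;
      54; 35; 59; 33; 27; 26; 53; 18; 15; 3; 21; 51; 6; 9; 11; 50; 55; 30;
      56; 36; 46; 44; 23; 24; 48; 29; 28; 13; 14; 17; 16; 20; 32; 8; 38; 62;
      61; 31; 37; 5; 19; 4; 7; 57; 58].

(* automorphisms of the hexagon, transitive on its points *)
Definition hexagon_generators : seq (seq nat) :=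
  [:: [:: 42; 57; 38; 60; 58; 19; 47; 24; 48; 25; 41; 52; 12; 13; 14; 45; 36; 46;
      34; 5; 37; 59; 27; 26; 15; 1; 43; 31; 32; 30; 51; 39; 21; 62; 20; 56;
      6; 18; 11; 22; 54; 0; 10; 55; 50; 7; 8; 16; 17; 29; 44; 49; 2; 35;
      33; 23; 61; 9; 3; 28; 4; 53; 40];
      [:: 52; 34; 47; 17; 35; 32; 55; 33; 56; 8; 6; 7; 51; 39; 21; 14; 48; 46;
      57; 58; 24; 15; 16; 61; 59; 13; 12; 18; 54; 53; 1; 43; 45; 11; 30; 36;
      4; 31; 28; 25; 41; 44; 29; 37; 40; 5; 3; 49; 22; 2; 0; 26; 50; 42;
      38; 10; 9; 27; 60; 20; 19; 62; 23]].

Definition st (j i : nat) : nat := nth 0 (nth [::] states j) i.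

(** * Exhaustive search for the states with minimum 1 *)

Definition unique_min (a b c : nat) : bool :=
  [|| (b == a.+1) && (c == a.+1), (a == b.+1) && (c == b.+1)
    | (a == c.+1) && (b == c.+1)].

Definition near (a b : nat) : bool := (a <= b.+1) && (b <= a.+1).

Definition far (f g : seq nat) : bool := has (fun p => ~~ near p.1 p.2) (zip f g).

Definition hpairs (i : nat) : seq (nat * nat) :=
  [seq p <- pairs i | (p.1 < p.2) && (p.2 < 63)].

(** If only one other value on the line is known, two values 1 are still excluded: equal values
    force the third to be one less, here 0. *)
Definition admissible (v : nat) (x y : option nat) : bool :=
  match x, y with
  | Some b, Some c => unique_min v b c
  | Some b, None | None, Some b => near v b && ((v != 1) || (b != 1))
  | None, None => true
  end.

Definition extensions (i : nat) (pre g : seq nat) : seq (seq nat) :=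
  let pos j := if j \in pre then Some (index j pre) else None in
  [seq v :: g | v <- [:: 1; 2; 3; 4] &
    all (fun t => admissible v (omap (nth 0 g) t.1) (omap (nth 0 g) t.2))
      [seq (pos p.1, pos p.2) | p <- hpairs i]].

(** Breadth-first: [fr] holds the admissible partial states on the points [pre], latest point first;
    at the end each is re-indexed by 0, ..., 62. *)
Fixpoint search (pre order : seq nat) (fr : seq (seq nat)) : seq (seq nat) :=
  if order is i :: order' then
    search (i :: pre) order' (flatten [seq extensions i pre g | g <- fr])
  else [seq [seq nth 0 g (index i pre) | i <- iota 0 63] | g <- fr].

Lemma search_cons pre i order fr : search pre (i :: order) fr =
  search (i :: pre) order (flatten [seq extensions i pre g | g <- fr]).
Proof. by []. Qed.

Definition solution_list : seq (seq nat) := search [:: 0] (behead search_order) [:: [:: 1]].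

Definition solutions : seq (seq nat) := locked solution_list.

Lemma solutionsE : solutions = solution_list.
Proof. by rewrite /solutions -lock. Qed.

Definition state (p : nat) : seq nat := nth [::] states p.
Definition shifted_state (p : nat) : seq nat := [seq n.+1 | n <- state p].

(* Kinds (C) and (b) of the introduction, by the property that excludes them. *)
Definition type_C (f : seq nat) : bool :=
  has (fun q => (nth 0 f q == 1) && far f (state q)) (iota 0 63).
Definition far_minima (f : seq nat) : seq nat :=
  [seq q <- iota 0 63 | (nth 0 f q == 2) && (st 0 q != 1)].
Definition type_b (f : seq nat) : bool := 15 < size (far_minima f).

(** * Properties of the tables verified by evaluation *)

Definition solution_check : bool :=
  (search_order == 0 :: behead search_order) && all (fun f =>
  type_C f || (count_mem 1 f == 1) &&
  [|| type_b f, f == shifted_state 0 | has (fun k =>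
    (62 < k) && (f == state k)) (nb 0)]) solutions.

Fixpoint unique_min_rows (f g h : seq nat) : bool :=
  match f, g, h with
  | a :: f', b :: g', c :: h' =>
      if unique_min a b c then unique_min_rows f' g' h' else false
  | [::], [::], [::] => true
  | _, _, _ => false
  end.

Definition line_check : bool :=
  (size states == 315) && all (fun r => size r == 63) states &&
  all (fun j => let f := state j in all (fun p : nat * nat =>
     [&& [&& p.1 < 315, p.2 < 315, p.1 != j, p.2 != j & p.1 != p.2],
       (p.2 \in nb p.1) && (j \in nb p.1),
     (62 < j) || (62 < p.1) || (p.2 < 63) &
     (if p.1 < p.2 then unique_min_rows f (state p.1) (state p.2) else (p.2, p.1) \in pairs j)])
     (pairs j)) (iota 0 315).

(** The last two conditions characterise a graph distance: it drops by at most one along an edge,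
    and a nonzero value drops by one along some hexagon edge. *)
Definition hexagon_check : bool :=
  all (fun p => [&& st p p == 0, uniq (nb p), size (nb p) == 10,
    all (fun k => (k < 63) || (st k p == 1)) (nb p) & all (fun q => [&& st p q == st q p,
      (st p q == 0) == (p == q),
     (q \in nb p) == (st p q == 1),
     all (fun r => st p q <= (st r q).+1) (nb p) & (st p q == 0) || has (fun r =>
       (r <63) && ((st r q).+1 == st p q)) (nb p)]) (iota 0 63)])
     (iota 0 63).

(* Determines the neighbours of a point with outer state [j]: they are the projection
   [p] of [j], the third point of that line, and eight midpoints on the way to the
   points [q] with [st j q = 2], whose states can only be the expected ones. *)
Definition covering_check : bool :=
  all (fun j =>
    let f := state j in let p := index 1 f in let g := state p in
    let N := nb j in let M := [seq (k, state k) | k <- N] in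
    [&& p < 63, count_mem 1 f == 1, j \in nb p, uniq N, size N == 10,
      all (fun q => if nth 0 f q == 2 then if nth 0 g q == 1 then true else
            far f (shifted_state q) &&
            all (fun k => if k < 63 then true else if far f (state k) then true else k \in N)
              (nb q)
            else true) (iota 0 63) &
      all (fun k => if k == p then true else if (p, k) \in pairs j then true else
            let q := index 1 (state k) in
            [&& q < 63, nth 0 f q == 2, nth 0 g q != 1 &
                     [seq m.1 | m <- M & nth 0 m.2 q == 1] == [:: k]]) N])
    (iota 63 252).

Definition connection_check : bool :=
  all (fun j => has (fun k => 62 < k < j) (nb j)) (iota 64 251).

(** Compositions of the generators are identified when they agree at 0, which leaves one
    automorphism for each image of 0. *)
Definition automorphism_list : seq (seq nat) :=
  explore (fun s t => eqn (nth 0 s 0) (nth 0 t 0))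
    (fun s => [seq [seq nth 0 g i | i <- s] | g <- hexagon_generators])
    64 [:: iota 0 63] [:: iota 0 63].

Definition automorphisms : seq (seq nat) := locked automorphism_list.

Lemma automorphismsE : automorphisms = automorphism_list.
Proof. by rewrite /automorphisms -lock. Qed.

Definition automorphism_check : bool :=
  [&& all (fun s => perm_eq s (iota 0 63) && all (fun p => all (fun q =>
    st (nth 0 s p) (nth 0 s q) == st p q) (iota 0 63)) (iota 0 63))
     hexagon_generators,
   all (fun p => has (fun s => nth 0 s 0 == p) automorphisms) (iota 0 63) &
   all (fun s => all (fun k => (k < 63) || has (fun k' =>
     (62 < k') && ([seq st k' i | i <- s] == state k)) (nb (nth 0 s 0)) ) (nb 0)) automorphisms].

Definition spokes (m : nat) : seq nat := [seq p <- nb m | p < 63].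

(** Neighbours of [m] at mutual distance 2 select one point on each of the three hexagon lines
    through [m], so every neighbour is equal or adjacent to one of them. *)
Definition star_check : bool :=
  all (fun m => let H := spokes m in
    [&& has (fun p => true) H,
    all (fun p => has (fun q => has (fun r =>
        [&& st p q == 2, st p r == 2 & st q r == 2]) H) H) H &
    all (fun p => all (fun q => if st p q == 2 then all (fun r =>
        if (st p r == 2) && (st q r == 2) then
          all (fun k => [|| st k p < 2, st k q < 2 | st k r < 2]) H else true) H else true) H) H])
   (iota 0 63).

(** For a point at distance 2 from the hexagon, kind (A) would add 2 to the value 3 and kind (B)
    would add 1 to the value 4; both give 5, beyond the diameter. *)
Definition shift_check : bool :=
  has (fun i => st 0 i == 3) (iota 0 63) &&
  all (fun k => (k < 63) || has (fun i => st k i == 4) (iota 0 63)) (nb 0).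

Definition path_check : bool :=
  all (fun m => let H := spokes m in
    all (fun p => all (fun q => if st p q == 2 then
         all (fun k => (k == p) || (st k q == 2)) [seq k <- H | st k p < 2] &&
         all (fun r => if st m r == 2 then
            (st p r == 3) && all (fun k => (k == p) || (st k r == 3)) [seq k <- H | st k p < 2]
              else true)
           (spokes q)
       else true) H) H) (iota 0 63).

Arguments st : simpl never.
Arguments state : simpl never.
Arguments pairs : simpl never.
Arguments nb : simpl never.
Arguments far : simpl never.

Ltac by_tables :=
  cbv delta [solution_check line_check hexagon_check covering_check connection_check
    automorphism_check star_check path_check shift_check search
    extensions hpairs spokes nb pairs st state shifted_state type_C type_b far_minima];
  rewrite ?solutionsE ?automorphismsE;
  cbv delta [solution_list automorphism_list search extensions hpairs nb pairs st state];
  rewrite ?statesE ?hj_pairsE; vm_cast_no_check (erefl true).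

Lemma solution_checked : solution_check. Proof. by_tables. Qed.
Lemma line_checked : line_check. Proof. by_tables. Qed.
Lemma hexagon_checked : hexagon_check. Proof. by_tables. Qed.
Lemma covering_checked : covering_check. Proof. by_tables. Qed.
Lemma connection_checked : connection_check. Proof. by_tables. Qed.
Lemma states_uniq : uniq states. Proof. by_tables. Qed.
Lemma automorphism_checked : automorphism_check. Proof. by_tables. Qed.
Lemma star_checked : star_check. Proof. by_tables. Qed.
Lemma path_checked : path_check. Proof. by_tables. Qed.
Lemma shift_checked : shift_check. Proof. by_tables. Qed.

(** * Near polygons with three points per line *)

Lemma collinear_sym (S : geometry) (x y : point S) : collinear x y -> collinear y x.
Proof. by case=> xy [L [xL yL]]; split; [exact: nesym | exists L]. Qed.

Lemma walk_trans (S : geometry) n m (x y z : point S) :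
  walk n x y -> walk m y z -> walk (n + m) x z.
Proof.
by elim=> [//|k u v w uv _ IH] /IH; rewrite addSn; exact: walkS.
Qed.

Lemma walk_sym (S : geometry) n (x y : point S) : walk n x y -> walk n y x.
Proof.
elim=> [u|k u v w uv _ IH]; first exact: walk0.
by rewrite -addn1; apply: walk_trans IH (walkS (collinear_sym uv) (walk0 _)).
Qed.

(** Choice makes the distance a total function; connectedness gives it its meaning in [distP]. *)
Definition dist (S : geometry) (x y : point S) : nat :=
  epsilon (inhabits 0) (is_dist x y).

Lemma is_dist_uniq (S : geometry) (x y : point S) m n :
  is_dist x y m -> is_dist x y n -> m = n.
Proof.
by move=> [wm minm] [wn minn]; apply/eqP; rewrite eqn_leq minm // minn.
Qed.

Section NearPolygon.

Variables (S : geometry) (d : nat).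
Hypothesis S_near : near_polygon d S.
Implicit Types (x y z : point S) (L M : line S).

Lemma distP x y : is_dist x y (dist x y).
Proof.
apply: epsilon_spec; have [_ conn _ _] := S_near; have [n wn] := conn x y.
(* Excluded middle turns [walk] into a boolean predicate, so that [ex_minn] provides the least
   length. *)
pose P m : bool := if excluded_middle_informative (walk m x y) then true else false.
have PP m : reflect (walk m x y) (P m).
  by rewrite /P; case: excluded_middle_informative => w; constructor.
have exP : exists m, P m by exists n; apply/PP.
exists (ex_minn exP); case: ex_minnP => m /PP wm min.
by split=> // k /PP; exact: min.
Qed.

Lemma dist_walk x y : walk (dist x y) x y.
Proof. by case: (distP x y). Qed.

Lemma dist_le x y n : walk n x y -> dist x y <= n.
Proof. by case: (distP x y) => _; apply. Qed.

Lemma dist_eq x y n : is_dist x y n -> dist x y = n.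
Proof. exact: is_dist_uniq (distP x y). Qed.

Lemma dist_le_diam x y : dist x y <= d.
Proof. by have [_ _ [le_d _] _] := S_near; exact: le_d (distP x y). Qed.

Lemma distxx x : dist x x = 0.
Proof. by apply/eqP; rewrite -leqn0; exact: dist_le (walk0 x). Qed.

Lemma dist0_eq x y : dist x y = 0 -> x = y.
Proof. by move=> xy; have := dist_walk x y; rewrite xy => w; inversion w. Qed.

Lemma distC x y : dist x y = dist y x.
Proof. by apply/eqP; rewrite eqn_leq !dist_le //; apply/walk_sym/dist_walk. Qed.

Lemma dist_triangle y x z : dist x z <= dist x y + dist y z.
Proof. exact/dist_le/walk_trans/dist_walk/dist_walk. Qed.

Lemma dist_collinear x y : collinear x y -> dist x y = 1.
Proof.
move=> xy; apply/eqP; rewrite eqn_leq lt0n dist_le ?andTb; last first.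
  exact: walkS xy (walk0 y).
by apply/eqP => /dist0_eq; case: xy.
Qed.

Lemma dist1_collinear x y : dist x y = 1 -> collinear x y.
Proof.
move=> xy; have := dist_walk x y; rewrite xy => w; inversion w; subst.
by match goal with H : walk 0 _ _ |- _ => inversion H; subst end.
Qed.

Lemma dist_step x y z : collinear x y -> dist x z <= (dist y z).+1.
Proof. by move=> /dist_collinear xy; have := dist_triangle y x z; rewrite xy. Qed.

Lemma dist_stepr x y z : collinear y z -> dist x y <= (dist x z).+1.
Proof. by rewrite !(distC x); exact: dist_step. Qed.

Lemma midpoint x z n : dist x z = n.+1 -> exists2 y, collinear x y & dist y z = n.
Proof.
move=> xz; have := dist_walk x z; rewrite xz => w; inversion w as [|k u y v xy yz]; subst.
exists y => //; apply/eqP; rewrite eqn_leq dist_le //= -ltnS -xz.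
exact: dist_step.
Qed.

Lemma nearest_exists x L : exists y, [/\ inc y L, forall z, inc z L -> dist x y <= dist x z
  & forall z, inc z L -> (forall u, inc u L -> dist x z <= dist x u) -> z = y].
Proof.
have [_ _ _ /(_ x L) [y [[yL ymin] yuniq]]] := S_near.
exists y; split=> // [z zL|z zL zmin]; first exact: ymin zL (distP _ _) (distP _ _).
apply/esym/yuniq; split=> // u m n uL.
by move=> /dist_eq <- /dist_eq <-; exact: zmin.
Qed.

Definition line3 L x y z : Prop :=
  [/\ inc x L, inc y L, inc z L & [/\ x <> y, x <> z, y <> z
    & forall u, inc u L -> [\/ u = x, u = y | u = z]]].

Lemma line3_perm L x y z : line3 L x y z -> line3 L y x z.
Proof.
case=> xL yL zL [xy xz yz all]; split=> //; split=> //; first exact: nesym.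
by move=> u /all [] ->; [constructor 2|constructor 1|constructor 3].
Qed.

Lemma line3_rot L x y z : line3 L x y z -> line3 L y z x.
Proof.
case=> xL yL zL [xy xz yz all]; split=> //; split=> //; try exact: nesym.
by move=> u /all [] ->; [constructor 3|constructor 1|constructor 2].
Qed.

Lemma line3_collinear L x y z : line3 L x y z -> collinear x y.
Proof. by case=> xL yL _ [xy _ _ _]; split=> //; exists L. Qed.

Lemma unique_minC a b c : unique_min a b c = unique_min b a c.
Proof. by rewrite /unique_min; lia. Qed.

Lemma unique_min_rot a b c : unique_min a b c = unique_min b c a.
Proof. by rewrite /unique_min; lia. Qed.

(** The two other points are strictly farther than the nearest one, and by at most one because they
    are collinear with it. *)
Lemma line3_dist L x y z u : line3 L x y z ->
  unique_min (dist u x) (dist u y) (dist u z).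
Proof.
have aux v v1 v2 : line3 L v v1 v2 ->
    (forall w, inc w L -> dist u v <= dist u w) ->
    (forall w, inc w L -> (forall w', inc w' L -> dist u w <= dist u w') -> w = v) ->
    unique_min (dist u v) (dist u v1) (dist u v2).
  move=> l3 vmin vuniq; have [vL v1L v2L [n1 n2 _ _]] := l3.
  have c1 := line3_collinear l3; have c2 := line3_collinear (line3_rot (line3_perm l3)).
  have far w : inc w L -> v <> w -> dist u v != dist u w.
    move=> wL vw; apply/eqP => E; apply: vw; apply/esym/vuniq => // w' w'L.
    by rewrite -E; exact: vmin.
  move: (far _ v1L n1) (far _ v2L n2) (vmin _ v1L) (vmin _ v2L).
  move: (dist_stepr u (collinear_sym c1)) (dist_stepr u (collinear_sym c2)).
  rewrite /unique_min; lia.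
move=> l3; have [v [vL vmin vuniq]] := nearest_exists u L.
have [_ _ _ [_ _ _ /(_ _ vL)]] := l3.
case=> ?; subst v; first exact: aux.
- by rewrite unique_minC; apply: aux => //; exact: line3_perm.
- by rewrite -unique_min_rot; apply: aux => //; exact: line3_rot (line3_rot _).
Qed.

Lemma pls_line L M x y : x <> y -> inc x L -> inc y L -> inc x M -> inc y M -> L = M.
Proof. by have [[pls _] _ _ _] := S_near; exact: pls. Qed.

Variable t : nat.
Hypothesis S_order : has_order 2 t S.

Lemma third_point L x y : inc x L -> inc y L -> x <> y -> exists z, line3 L x y z.
Proof.
have [/(_ L) [f [f_inj fP]] _] := S_order.
move=> xL yL xy; have [i fi] := (fP x).1 xL; have [j fj] := (fP y).1 yL.
have ij : i != j by apply: contra_not_neq xy => ij; rewrite -fi -fj ij.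
have [k /andP [ki kj] kall] : exists2 k : 'I_3, (k != i) && (k != j) &
    forall l, [\/ l = i, l = j | l = k].
  move: ij; clear; case: i => [[|[|[|//]]] i]; case: j => [[|[|[|//]]] j] // _.
  - by exists (Ordinal (isT : 2 < 3)) => // -[[|[|[|//]]] l];
    [constructor 1|constructor 2|constructor 3]; apply: val_inj.
  - by exists (Ordinal (isT : 1 < 3)) => // -[[|[|[|//]]] l];
    [constructor 1|constructor 3|constructor 2]; apply: val_inj.
  - by exists (Ordinal (isT : 2 < 3)) => // -[[|[|[|//]]] l];
    [constructor 2|constructor 1|constructor 3]; apply: val_inj.
  - by exists (Ordinal (isT : 0 < 3)) => // -[[|[|[|//]]] l];
    [constructor 3|constructor 1|constructor 2]; apply: val_inj.
  - by exists (Ordinal (isT : 1 < 3)) => // -[[|[|[|//]]] l];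
    [constructor 2|constructor 3|constructor 1]; apply: val_inj.
  - by exists (Ordinal (isT : 0 < 3)) => // -[[|[|[|//]]] l];
    [constructor 3|constructor 2|constructor 1]; apply: val_inj.
exists (f k); split=> //; first by apply/fP; exists k.
split=> //.
- by rewrite -fi => /f_inj /eqP; rewrite eq_sym (negbTE ki).
- by rewrite -fj => /f_inj /eqP; rewrite eq_sym (negbTE kj).
move=> u /fP [l <-]; rewrite -fi -fj.
by case: (kall l) => ->; [constructor 1|constructor 2|constructor 3].
Qed.

Lemma other_points L x : inc x L -> exists y z, line3 L x y z.
Proof.
move=> xL; have [[_ /(_ L) [a [b [ab aL bL]]]] _ _ _] := S_near.
have [y yL xy] : exists2 y, inc y L & x <> y.
  by case: (classic (x = a)) => [->|xa]; [exists b|exists a].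
by exists y; exact: third_point.
Qed.

Lemma third_collinear x y : collinear x y -> exists L z, line3 L x y z.
Proof.
by case=> xy [L [xL yL]]; have [z l3] := third_point xL yL xy; exists L, z.
Qed.

(** The point [z] has distance 1 to two points of the line [xy], hence distance 0 to the third. *)
Lemma no_triangle x y z : collinear x y -> collinear x z -> collinear y z ->
  exists L, line3 L x y z.
Proof.
move=> xy xz yz; have [L [w l3]] := third_collinear xy.
exists L; have := line3_dist z l3.
rewrite !(distC z) (dist_collinear xz) (dist_collinear yz) => m.
suff -> : z = w by [].
by apply/esym/dist0_eq; move: m; rewrite /unique_min; lia.
Qed.

(** The slots are the [t.+1] lines on [x] with the two further points of each. *)
Lemma neighbours_enum x :
  exists g : 'I_t.+1 * bool -> point S, forall y, collinear x y -> exists i, g i = y.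
Proof.
have [_ /(_ x) [f [_ fP]]] := S_order.
have fx i : inc x (f i) by apply/fP; exists i.
have pr i : exists q : point S * point S, line3 (f i) x q.1 q.2.
  by have [y [z l3]] := other_points (fx i); exists (y, z).
have [g gP] : exists g : 'I_t.+1 -> point S * point S, forall i, line3 (f i) x (g i).1 (g i).2.
  by exists (fun i => epsilon (inhabits (x, x)) (fun q => line3 (f i) x q.1 q.2)) => i;
     exact: (epsilon_spec _ _ (pr i)).
exists (fun ib => if ib.2 then (g ib.1).2 else (g ib.1).1) => y [xy [L [xL yL]]].
have [i Ei] := (fP L).1 xL; move: yL; rewrite -Ei => yL.
have [_ _ _ [_ _ _ /(_ _ yL)]] := gP i.
by case=> E; [case: xy | exists (i, false) | exists (i, true)].
Qed.

(** [P k y] is read as: the neighbour [y] carries the label [k]. Labels exclude one another, so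
    distinct labels occupy distinct slots; this is the pigeonhole behind the two counting lemmas
    below. *)
Lemma choose_neighbours (P : nat -> point S -> Prop) x (s : seq nat) :
  (forall k, k \in s -> exists2 y, collinear x y & P k y) ->
  (forall k k' y, k \in s -> k' \in s -> P k y -> P k' y -> k = k') -> uniq s ->
  exists (g : 'I_t.+1 * bool -> point S) (c : nat -> 'I_t.+1 * bool),
    [/\ forall y, collinear x y -> exists i, g i = y,
        forall k, k \in s -> P k (g (c k)) & uniq (map c s)].
Proof.
move=> ex Pinj us; have [g gP] := neighbours_enum x.
pose c k := epsilon (inhabits (ord0, false)) (fun i => P k (g i)).
have cP k : k \in s -> P k (g (c k)).
  move=> /ex [y /gP [i <-] Py].
  exact: (epsilon_spec _ (fun i => P k (g i)) (ex_intro _ i Py)).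
exists g, c; split=> //; rewrite map_inj_in_uniq // => k k' ks k's E.
by apply: (Pinj _ _ (g (c k))) => //; [exact: cP | rewrite E; exact: cP].
Qed.

Lemma card_slots : #|{: 'I_t.+1 * bool}| = (t.+1).*2.
Proof. by rewrite card_prod card_ord card_bool muln2. Qed.

Lemma few_neighbours (P : nat -> point S -> Prop) x (s : seq nat) :
  (forall k, k \in s -> exists2 y, collinear x y & P k y) ->
  (forall k k' y, k \in s -> k' \in s -> P k y -> P k' y -> k = k') -> uniq s ->
  size s <= (t.+1).*2.
Proof.
move=> ex Pinj us; have [g [c [_ _ cu]]] := choose_neighbours ex Pinj us.
by rewrite -card_slots -(size_map c) -(card_uniqP cu) max_card.
Qed.

(** With as many labels as slots the injection is onto, so every neighbour carries a label and a
    label determines its bearer. *)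
Lemma all_neighbours (P : nat -> point S -> Prop) x (s : seq nat) :
  (forall k, k \in s -> exists2 y, collinear x y & P k y) ->
  (forall k k' y, k \in s -> k' \in s -> P k y -> P k' y -> k = k') -> uniq s ->
  size s = (t.+1).*2 ->
  (forall y, collinear x y -> exists2 k, k \in s & P k y) /\
  (forall k y y', k \in s -> collinear x y -> collinear x y' -> P k y -> P k y' -> y = y').
Proof.
move=> ex Pinj us sz; have [g [c [gP cP cu]]] := choose_neighbours ex Pinj us.
have sel y : collinear x y -> exists2 k, k \in s & y = g (c k).
  move=> /gP [i <-].
  have : i \in map c s.
    have sub : {subset map c s <= enum {: 'I_t.+1 * bool}} by move=> k _; rewrite mem_enum.
    have le : size (enum {: 'I_t.+1 * bool}) <= size (map c s).
      by rewrite size_map sz -cardE card_slots.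
    by have [_ ->] := uniq_min_size cu sub le; rewrite mem_enum.
  by case/mapP => k ks ->; exists k.
have selP y : collinear x y -> exists k, [/\ k \in s, y = g (c k) & P k y].
  by move=> /sel [k ks ->]; exists k; split=> //; exact: cP.
split=> [y /selP [k [ks _ Pk]]|k y y' ks /selP [k1 [k1s -> P1]] /selP [k2 [k2s -> P2]] Py Py'].
  by exists k.
by rewrite (Pinj _ _ _ k1s ks P1 Py) (Pinj _ _ _ k2s ks P2 Py').
Qed.

End NearPolygon.

(** * States of the points of a near octagon containing the hexagon *)

Lemma size_row k : k < 315 -> size (state k) = 63.
Proof.
move=> k_lt; have /andP [/andP [/eqP sz /allP rs] _] := line_checked.
by apply/eqP/rs/mem_nth; rewrite sz.
Qed.

Lemma row_mkseq k : k < 315 -> state k = mkseq (st k) 63.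
Proof.
move=> k_lt; apply: (@eq_from_nth _ 0); rewrite size_row ?size_mkseq // => i i_lt.
by rewrite nth_mkseq.
Qed.

Lemma shifted_row_mkseq k : k < 315 -> shifted_state k = mkseq (fun i => (st k i).+1) 63.
Proof. by move=> k_lt; rewrite /shifted_state row_mkseq // -map_comp. Qed.

Lemma row_inj j k : j < 315 -> k < 315 -> state j = state k -> j = k.
Proof.
have /andP [/andP [/eqP sz _] _] := line_checked.
by move=> jlt klt /eqP; rewrite nth_uniq ?sz ?states_uniq // => /eqP.
Qed.

Lemma mkseq_inj (f g : nat -> nat) n i : mkseq f n = mkseq g n -> i < n -> f i = g i.
Proof. by move=> E i_lt; rewrite -(nth_mkseq 0 f i_lt) E nth_mkseq. Qed.

Lemma farP (f g : nat -> nat) : far (mkseq f 63) (mkseq g 63) ->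
  exists2 i, i < 63 & ~~ near (f i) (g i).
Proof.
case/hasP => -[a b]; rewrite zip_map => /mapP [j].
by rewrite mem_iota => /andP [_ j_lt] [-> ->] nj; exists j.
Qed.

Lemma unique_min_perm23 a b c : unique_min a b c = unique_min a c b.
Proof. by rewrite /unique_min; lia. Qed.

Lemma line_checkP j k l : j < 315 -> (k, l) \in pairs j ->
  [/\ [&& k < 315, l < 315, k != j, l != j & k != l], (l \in nb k) && (j \in nb k),
      (62 < j) || (62 < k) || (l < 63) &
      if k < l then unique_min_rows (state j) (state k) (state l) else (l, k) \in pairs j].
Proof.
move=> j_lt kl; have /andP [_ /allP /(_ j)] := line_checked.
by rewrite mem_iota j_lt => /(_ isT) /allP /(_ _ kl) /and4P.
Qed.

Lemma unique_min_row j k l i : j < 315 -> (k, l) \in pairs j -> i < 63 ->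
  unique_min (st j i) (st k i) (st l i).
Proof.
move=> j_lt kl i_lt.
(* The table compares rows only for [k < l]; for the other order it lists the swapped pair. *)
wlog lt : k l kl / k < l.
  move=> W; have [/and5P [_ _ _ _ ne] _ _ E] := line_checkP j_lt kl.
  case: ltngtP E => [lt _|lt lk|E _]; first exact: W.
    by rewrite unique_min_perm23; apply: W.
  by rewrite E eqxx in ne.
have [/and5P [k_lt l_lt _ _ _] _ _] := line_checkP j_lt kl; rewrite lt.
have := size_row l_lt; have := size_row k_lt; have := size_row j_lt.
rewrite /st -/(state j) -/(state k) -/(state l).
move: (state j) (state k) (state l) i i_lt => f g h.
elim: 63 f g h => [//|n IH] [//|a f] [//|b g] [//|c h] [|i] /=.
  by move=> _ _ _ _; case: ifP.
by move=> i_lt [sf] [sg] [sh]; case: ifP => // _; exact: IH.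
Qed.

Lemma pairs_spec j k l : j < 315 -> (k, l) \in pairs j ->
  [/\ k < 315, l < 315, k != j, l != j & [/\ k != l, l \in nb k, j \in nb k
    & j < 63 -> k < 63 -> l < 63]].
Proof.
move=> j_lt /(line_checkP j_lt) [/and5P [-> -> -> -> ->] /andP [-> ->] E _]; split=> //.
split=> // j63 k63; case/orP: E => // /orP [].
  by rewrite ltnNge -ltnS j63.
by rewrite ltnNge -ltnS k63.
Qed.

Lemma nb_pairs j k : k \in nb j -> exists l, (k, l) \in pairs j.
Proof. by case/mapP => -[k' l] kl ->; exists l. Qed.

Lemma pairs_nb j k l : (k, l) \in pairs j -> k \in nb j.
Proof. by move=> kl; apply/mapP; exists (k, l). Qed.

Lemma hexagon_spec p q : p < 63 -> q < 63 ->
  [/\ st p p = 0, st p q = st q p, (st p q == 0) = (p == q) & (q \in nb p) = (st p q == 1)].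
Proof.
move=> p_lt q_lt; have /allP /(_ p) := hexagon_checked.
rewrite mem_iota p_lt => /(_ isT) /and5P [/eqP -> _ _ _ /allP /(_ q)].
by rewrite mem_iota q_lt => /(_ isT) /and5P [/eqP ? /eqP ? /eqP ? _ _].
Qed.

(** The row of a hexagon point vanishes at that point, so the unique minimum forces the value 1 on
    the rest of the line. *)
Lemma hexagon_pairs i j k : i < 63 -> j < 63 -> (j, k) \in pairs i ->
  [/\ k < 63, st i j = 1, st i k = 1 & st j k = 1].
Proof.
move=> i_lt j_lt jk; have i315 : i < 315 by exact: leq_trans i_lt _.
have [_ _ _ _ [_ _ _ /(_ i_lt j_lt) k_lt]] := pairs_spec i315 jk.
have E1 : st i j = 1.
  by have [_ _ _ /esym] := hexagon_spec i_lt j_lt; rewrite (pairs_nb jk) => /eqP.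
move: (unique_min_row i315 jk j_lt) (unique_min_row i315 jk i_lt).
have [ii Ei1 _ _] := hexagon_spec i_lt j_lt; have [_ Ei2 _ _] := hexagon_spec i_lt k_lt.
have [pp E12 _ _] := hexagon_spec j_lt k_lt.
rewrite ii pp -Ei1 -Ei2 -E12 E1; move: (st i k) (st j k) => a b H1 H2.
by split=> //; [case: a H2 => [|[]] | case: b H1 => [|[]]].
Qed.

Lemma hpairs_spec i p : i < 63 -> p \in hpairs i ->
  [/\ p.1 < 63, p.2 < 63, st i p.1 = 1, st i p.2 = 1 & st p.1 p.2 = 1].
Proof.
move=> i_lt; rewrite mem_filter => /andP [/andP [lt p2_lt] pi].
have p1_lt := ltn_trans lt p2_lt.
have pi' : (p.1, p.2) \in pairs i by case: (p) pi.
by have [] := hexagon_pairs i_lt p1_lt pi'.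
Qed.

(** Invariant: the restriction of [f] to the points treated so far is in the frontier. [admissible]
    never rejects it, because it tests only consequences of [unique_min] for positive values. *)
Lemma search_sound (f : nat -> nat) (order pre : seq nat) (fr : seq (seq nat)) :
  (forall i, i < 63 -> 1 <= f i <= 4) ->
  (forall i p, i < 63 -> p \in hpairs i -> unique_min (f i) (f p.1) (f p.2)) ->
  all (fun i => i < 63) order -> (forall i, i < 63 -> i \in pre ++ order) ->
  map f pre \in fr -> mkseq f 63 \in search pre order fr.
Proof.
move=> f14 fmin; elim: order pre fr => [|i order IH] pre fr.
  rewrite cats0 => _ all_pre f_fr; apply/mapP; exists (map f pre) => //.
  rewrite /mkseq; apply/eq_in_map => i; rewrite mem_iota => /andP [_ i_lt].
  have all_pre' : i \in pre by exact: all_pre.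
  by rewrite (nth_map 0) ?index_mem ?nth_index.
case/andP=> i_lt order_lt all_pre f_fr; rewrite search_cons; apply: IH => //.
  by move=> j /all_pre; rewrite !mem_cat !inE orbCA orbA.
apply/flattenP; exists (extensions i pre (map f pre)); first exact: map_f.
apply: (map_f (fun v => v :: map f pre)); rewrite mem_filter; apply/andP; split; last first.
  by have := f14 i i_lt; rewrite !inE; lia.
rewrite all_map; apply/allP => p pi /=.
have E j : omap (nth 0 (map f pre)) (if j \in pre then Some (index j pre) else None)
    = if j \in pre then Some (f j) else None.
  by case: ifP => //= jp; rewrite (nth_map 0) ?index_mem ?nth_index.
have [p1 p2 _ _ _] := hpairs_spec i_lt pi.
rewrite !E; have := fmin _ _ i_lt pi.
move: (f14 _ i_lt) (f14 _ p1) (f14 _ p2); case: ifP => _; case: ifP => _ //=;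
  rewrite /unique_min /near; lia.
Qed.

(** * Closure lists and the automorphisms of the hexagon *)

Section ExploreInd.

Variables (T : Type) (same : T -> T -> bool) (succ : T -> seq T) (P : T -> Prop).
Hypothesis P_succ : forall x, P x -> List.Forall P (succ x).

(** This gives soundness for any amount of fuel; completeness of the lists, where it matters, is
    checked separately by evaluation. *)
Lemma explore_ind n todo seen : List.Forall P todo -> List.Forall P seen ->
  List.Forall P (explore same succ n todo seen).
Proof.
elim: n todo seen => [|n IH] [|x todo] seen //= Ptodo Pseen.
inversion Ptodo as [|? ? Px Pt]; subst.
set new := foldl _ _ _; suff Pnew : List.Forall P new.
  by apply: IH; apply/List.Forall_app.
rewrite /new; have : List.Forall P ([::] : seq T) by constructor.
elim: (succ x) [::] (P_succ Px) => //= y l IHl acc Pl Pacc.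
inversion Pl as [|? ? Py Pl']; subst; apply: IHl => //.
case: ifP => // _; case: ifP => // _.
by rewrite -cats1; apply/List.Forall_app; split=> //; constructor.
Qed.

End ExploreInd.

Lemma Forall_mem (T : eqType) (P : T -> Prop) (s : seq T) x :
  List.Forall P s -> x \in s -> P x.
Proof.
elim=> //= y l Py _ IH; rewrite inE => /orP [/eqP -> //|]; exact: IH.
Qed.

Lemma automorphism_spec s : s \in automorphisms ->
  perm_eq s (iota 0 63) /\
  forall p q, p < 63 -> q < 63 -> st (nth 0 s p) (nth 0 s q) = st p q.
Proof.
have /and3P [/allP gens _ _] := automorphism_checked.
pose P s := perm_eq s (iota 0 63) /\
  forall p q, p < 63 -> q < 63 -> st (nth 0 s p) (nth 0 s q) = st p q.
suff all_P : List.Forall P automorphisms by exact: (Forall_mem all_P).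
rewrite automorphismsE /automorphism_list; apply: explore_ind.
- move=> g [gp gst].
  have gen a : a \in hexagon_generators -> perm_eq [seq nth 0 a i | i <- g] (iota 0 63) /\
      forall p q, p < 63 -> q < 63 ->
      st (nth 0 [seq nth 0 a i | i <- g] p) (nth 0 [seq nth 0 a i | i <- g] q) = st p q.
    move=> /gens /andP [ap /allP ast].
    have sg : size g = 63 by rewrite (perm_size gp) size_iota.
    have sa : size a = 63 by rewrite (perm_size ap) size_iota.
    have g_lt i : i < 63 -> nth 0 g i < 63.
      move=> i_lt; have : nth 0 g i \in g by rewrite mem_nth ?sg.
      by rewrite (perm_mem gp) mem_iota.
    split.
      apply: perm_trans ap; have {2}-> : a = [seq nth 0 a i | i <- iota 0 63].
        by rewrite -/(mkseq _ _) -sa mkseq_nth.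
      exact: perm_map.
    move=> p q p_lt q_lt; rewrite !(nth_map 0) ?sg //.
    have := ast (nth 0 g p); rewrite mem_iota g_lt // => /(_ isT) /allP /(_ (nth 0 g q)).
    by rewrite mem_iota g_lt // => /(_ isT) /eqP ->; exact: gst.
  elim: hexagon_generators gen {gens} => //= a l IH gen; constructor.
    by apply: gen; rewrite inE eqxx.
  by apply: IH => b bl; apply: gen; rewrite inE bl orbT.
all: by constructor => //; split=> // p q p_lt q_lt; rewrite !nth_iota.
Qed.

Lemma automorphism_lt s i : s \in automorphisms -> i < 63 -> nth 0 s i < 63.
Proof.
move=> /automorphism_spec [sp _] i_lt.
have : nth 0 s i \in s by rewrite mem_nth // (perm_size sp) size_iota.
by rewrite (perm_mem sp) mem_iota.
Qed.

Lemma automorphism_surj s q : s \in automorphisms -> q < 63 ->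
  exists2 q', q' < 63 & nth 0 s q' = q.
Proof.
move=> /automorphism_spec [sp _] q_lt.
have qs : q \in s by rewrite (perm_mem sp) mem_iota.
exists (index q s); last exact: nth_index.
by have := qs; rewrite -index_mem (perm_size sp) size_iota.
Qed.

Lemma automorphism_at p : p < 63 -> exists2 s, s \in automorphisms & nth 0 s 0 = p.
Proof.
move=> p_lt; have /and3P [_ /allP /(_ p) E _] := automorphism_checked.
by move: E; rewrite mem_iota p_lt => /(_ isT) /hasP [s sa /eqP <-]; exists s.
Qed.

Lemma automorphism_row s k : s \in automorphisms -> k \in nb 0 -> 62 < k ->
  exists k', [/\ 62 < k', k' \in nb (nth 0 s 0) &
    forall i, i < 63 -> st k' (nth 0 s i) = st k i].
Proof.
move=> sa k0 k_gt; have /and3P [_ _ /allP /(_ s sa) /allP /(_ k k0)] := automorphism_checked.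
case/orP => [|/hasP [k' k'p /andP [k'_gt /eqP E]]]; first by rewrite ltnNge k_gt.
exists k'; split=> // i i_lt.
have sz : size s = 63 by have [sp _] := automorphism_spec sa; rewrite (perm_size sp) size_iota.
by rewrite /st -/(state k) -E (nth_map 0) ?sz.
Qed.

Lemma count1_uniq (s : seq nat) a i j : count_mem a s = 1 -> i < size s -> j < size s ->
  nth 0 s i = a -> nth 0 s j = a -> i = j.
Proof.
have no_more u k : count_mem a u = 0 -> k < size u -> nth 0 u k <> a.
  move=> /eqP; rewrite -leqn0 leqNgt -has_count has_pred1 => au k_lt E.
  by case/negP: au; rewrite -E mem_nth.
elim: s i j => // b s IH [|i] [|j] //=.
- move=> c _ j_lt ba ja; move: c; rewrite ba eqxx add1n => -[] /no_more /(_ j_lt) [].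
  exact: ja.
- move=> c i_lt _ ia ba; move: c; rewrite ba eqxx add1n => -[] /no_more /(_ i_lt) [].
  exact: ia.
case: eqP => [_|_] c i_lt j_lt ia ja.
  by move: c; rewrite add1n => -[] /no_more /(_ i_lt) [].
by rewrite (IH i j).
Qed.

Lemma solution_cases f : f \in solutions ->
  type_C f \/ count_mem 1 f = 1 /\
   [\/ type_b f, f = shifted_state 0 | exists k, [/\ 62 < k, k \in nb 0 & f = state k]].
Proof.
have /andP [_ /allP ok] := solution_checked.
move=> /ok /orP [|/andP [/eqP c1 /or3P E]]; [by left | right; split=> //].
case: E => [?|/eqP ->|/hasP [k k0 /andP [k_gt /eqP ->]]].
- by constructor 1.
- by constructor 2.
- by constructor 3; exists k.
Qed.

(** * States of the points adjacent to the hexagon *)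

Section Embedding.

Variable N : geometry.
Hypothesis N_near : near_polygon 4 N.
Hypothesis N_order : has_order 2 4 N.
Implicit Types (x y z w : point N) (h : nat -> point N).

Local Notation distxx := (distxx N_near).
Local Notation distC := (distC N_near).

Definition embedding h : Prop :=
  forall i j, i < 63 -> j < 63 -> dist (h i) (h j) = st i j.

Definition outside h x : Prop := forall i, i < 63 -> 0 < dist x (h i).

Lemma embedding_automorphism h s : embedding h -> s \in automorphisms ->
  embedding (fun i => h (nth 0 s i)).
Proof.
move=> hE sa i j i_lt j_lt; rewrite hE ?automorphism_lt //.
by have [_ ->] := automorphism_spec sa.
Qed.

Lemma line3_dist_to L x y z u : line3 L x y z ->
  unique_min (dist x u) (dist y u) (dist z u).
Proof. by move=> /(line3_dist N_near u); rewrite !(distC u). Qed.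

Lemma near_dist x y u : collinear x y -> near (dist x u) (dist y u).
Proof.
by move=> xy; rewrite /near (dist_step N_near _ xy) (dist_step N_near _ (collinear_sym xy)).
Qed.

(** [embedding] speaks of distances only; [no_triangle] turns three points at mutual distance 1 into
    a line of [N]. *)
Lemma hexagon_line h i j k : embedding h -> i < 63 -> j < 63 -> (j, k) \in pairs i ->
  exists L, line3 L (h i) (h j) (h k).
Proof.
move=> hE i_lt j_lt jk; have [k_lt ij ik jk1] := hexagon_pairs i_lt j_lt jk.
by apply: (no_triangle N_near N_order); apply: (dist1_collinear N_near); rewrite hE.
Qed.

Lemma hexagon_third i j : i < 63 -> j < 63 -> st i j = 1 -> exists k, (j, k) \in pairs i.
Proof.
move=> i_lt j_lt ij; have [_ _ _ E] := hexagon_spec i_lt j_lt.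
by apply: nb_pairs; rewrite E ij.
Qed.

(** Subtracting [m] brings the minimum to 1, where the search applies: [m = 0] serves points at
    distance 1 from the hexagon, [m = 1] points at distance 2. *)
Lemma solution_of h x m : embedding h -> (forall i, i < 63 -> m < dist x (h i)) ->
  dist x (h 0) = m.+1 -> mkseq (fun i => dist x (h i) - m) 63 \in solutions.
Proof.
move=> hE gt_m x0; have /andP [/eqP so _] := solution_checked.
rewrite solutionsE /solution_list; apply: search_sound.
- by move=> i i_lt; have := gt_m i i_lt; have := dist_le_diam N_near x (h i); lia.
- move=> i p i_lt ip; have [p1 p2 _ _ _] := hpairs_spec i_lt ip.
  have ip' : (p.1, p.2) \in pairs i by move: ip; rewrite mem_filter; case: (p) => a b /andP [].
  have [L l3] := hexagon_line hE i_lt p1 ip'.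
  have := line3_dist N_near x l3; move: (gt_m _ i_lt) (gt_m _ p1) (gt_m _ p2).
  by rewrite /unique_min; move: (dist _ _) (dist _ _) (dist _ _) => a b c; lia.
- by vm_compute.
- move=> i i_lt; have sub : all (mem ([:: 0] ++ behead search_order)) (iota 0 63) by vm_compute.
  by move/allP: sub => /(_ i); rewrite mem_iota i_lt => /(_ isT).
by rewrite /= x0 subSnn.
Qed.

Lemma outside_automorphism h x s : outside h x -> s \in automorphisms ->
  outside (fun i => h (nth 0 s i)) x.
Proof. by move=> xo sa i i_lt; apply: xo; exact: automorphism_lt. Qed.

Lemma type_C_far h x m : embedding h ->
  type_C (mkseq (fun i => dist x (h i) - m) 63) ->
  exists2 q, q < 63 /\ dist x (h q) = m.+1 &
    exists2 i, i < 63 & ~~ near (dist x (h i) - m) (st q i).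
Proof.
move=> hE /hasP [q]; rewrite mem_iota => /andP [_ q_lt] /andP [/eqP].
rewrite nth_mkseq // => xq.
rewrite row_mkseq ?(leq_trans q_lt) // => /farP far_q.
by exists q => //; split=> //; lia.
Qed.

(* excludes kind (C) *)
Lemma unique_projection h x p q : embedding h -> outside h x -> p < 63 -> q < 63 ->
  dist x (h p) = 1 -> dist x (h q) = 1 -> p = q.
Proof.
move=> hE xo p_lt q_lt xp; have [s sa s0] := automorphism_at p_lt.
have [q' q'_lt <-] := automorphism_surj sa q_lt; rewrite -s0 => xq.
congr nth; set h' := fun i => h (nth 0 s i).
have h'E : embedding h' by exact: embedding_automorphism.
have x0 : dist x (h' 0) = 1 by rewrite /h' s0.
have sol : mkseq (fun i => dist x (h' i) - 0) 63 \in solutions.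
  by apply: solution_of => // i i_lt; apply: xo; exact: automorphism_lt.
case: (solution_cases sol) => [/(type_C_far h'E) [r [r_lt xr] [i i_lt]]|[c1 _]].
  rewrite subn0 -h'E // => /negP []; apply: near_dist; apply: (dist1_collinear N_near).
  by rewrite xr.
apply: (count1_uniq c1); rewrite ?size_mkseq ?nth_mkseq ?subn0 //.
Qed.

(** An automorphism brings [p] to 0, where the search result is read; kinds (C) and (b) are refuted
    there and the other kinds are carried back to [p]. *)
Lemma outside_cases h x p : embedding h -> outside h x -> p < 63 -> dist x (h p) = 1 ->
  (forall q, q < 63 -> dist x (h q) = (st p q).+1) \/
  exists k, [/\ 62 < k, k < 315, k \in nb p & forall q, q < 63 -> dist x (h q) = st k q].
Proof.
move=> hE xo p_lt xp; have [s sa s0] := automorphism_at p_lt.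
set h' := fun i => h (nth 0 s i).
have h'E : embedding h' by exact: embedding_automorphism.
have xo' : outside h' x by exact: outside_automorphism.
have x0 : dist x (h' 0) = 1 by rewrite /h' s0.
have sol : mkseq (fun i => dist x (h' i) - 0) 63 \in solutions by exact: solution_of.
have uniq1 q : q < 63 -> dist x (h' q) = 1 -> q = 0.
  by move=> q_lt xq; apply: (unique_projection h'E xo').
case: (solution_cases sol) => [/(type_C_far h'E) [r [r_lt xr] [i i_lt]]|[_ cases]].
  rewrite subn0 -h'E // => /negP []; apply: near_dist; apply: (dist1_collinear N_near).
  by rewrite xr.
have [hs hst] := automorphism_spec sa.
case: cases => [tb|E|[k [k_gt k0 E]]].
- have fm q : q \in far_minima (mkseq (fun i => dist x (h' i) - 0) 63) ->
      [/\ q < 63, dist x (h' q) = 2 & st 0 q != 1].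
    rewrite mem_filter mem_iota => /andP [/andP [+ ->] /andP [_ q_lt]].
    by rewrite nth_mkseq // subn0 => /eqP ->.
  suff : size (far_minima (mkseq (fun i => dist x (h' i) - 0) 63)) <= 10.
    by move=> le; move: tb; rewrite /type_b ltnNge (leq_trans le).
  (* The label [q] goes to the neighbours outside the hexagon that are adjacent to [h' q];
     [unique_projection] makes labels exclusive. *)
  apply: (few_neighbours N_near N_order (x := x)
           (P := fun q y => outside h' y /\ dist y (h' q) = 1)).
  + move=> q /fm [q_lt /(midpoint N_near) [y xy yq] q0]; exists y => //; split=> // i i_lt.
    (* A midpoint in the hexagon would be [h' 0], the only hexagon point adjacent to [x], but [q] is
       not adjacent to 0. *)
    rewrite lt0n; apply/eqP => /(dist0_eq N_near) yi; subst y.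
    have i0 : i = 0 by apply: uniq1 => //; exact: (dist_collinear N_near).
    by move: yq; rewrite i0 h'E // => yq; rewrite yq in q0.
  + move=> k k' y /fm [k_lt _ _] /fm [k'_lt _ _] [yo yk] [_ yk'].
    exact: (unique_projection h'E yo).
  + by rewrite filter_uniq // iota_uniq.
- left=> q q_lt; have [q' q'_lt <-] := automorphism_surj sa q_lt.
  rewrite -s0 hst //; move: E; rewrite shifted_row_mkseq // => /mkseq_inj /(_ q'_lt).
  by rewrite subn0.
right; have [k' [k'_gt k'p k'E]] := automorphism_row sa k0 k_gt; rewrite s0 in k'p.
have p315 : p < 315 by exact: leq_trans p_lt _.
have k'_lt : k' < 315.
  by have [l kl] := nb_pairs k'p; have [] := pairs_spec p315 kl.
have k_lt : k < 315 by have [l kl] := nb_pairs k0; have [] := pairs_spec (isT : 0 < 315) kl.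
exists k'; split=> // q q_lt; have [q' q'_lt <-] := automorphism_surj sa q_lt.
by rewrite k'E //; move: E; rewrite row_mkseq // => /mkseq_inj /(_ q'_lt); rewrite subn0.
Qed.

End Embedding.

(** * Propagation from an outer state *)

Lemma nb_lt j k : j < 315 -> k \in nb j -> k < 315 /\ j \in nb k.
Proof.
by move=> j_lt /nb_pairs [l kl]; have [k_lt _ _ _ [_ _ jk _]] := pairs_spec j_lt kl.
Qed.

Lemma hexagon_nb p : p < 63 ->
  [/\ uniq (nb p), size (nb p) = 10 & forall k, k \in nb p -> 62 < k -> st k p = 1].
Proof.
move=> p_lt; have /allP /(_ p) := hexagon_checked.
rewrite mem_iota p_lt => /(_ isT) /and5P [_ -> /eqP -> /allP E _]; split=> // k /E.
by case/orP => [k_lt|/eqP -> //]; rewrite ltnNge -ltnS k_lt.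
Qed.

Lemma covering_spec j : 62 < j -> j < 315 -> exists p,
  [/\ p < 63 /\ st j p = 1, forall q, q < 63 -> st j q = 1 -> q = p,
      [/\ j \in nb p, uniq (nb j) & size (nb j) = 10],
      forall q, q < 63 -> st j q = 2 -> st p q != 1 ->
        far (state j) (shifted_state q) /\
        forall k, k \in nb q -> 62 < k -> far (state j) (state k) \/ k \in nb j
    & forall k, k \in nb j -> [\/ k = p, (p, k) \in pairs j |
        exists q, [/\ q < 63, st j q = 2, st p q != 1, st k q = 1
           & forall k', k' \in nb j -> st k' q = 1 -> k' = k]]].
Proof.
move=> j_gt j_lt; have /allP /(_ j) := covering_checked.
rewrite mem_iota j_gt j_lt => /(_ isT); cbv zeta => C; exists (index 1 (state j)).
case/and5P: C => p_lt /eqP c1 jp uj /and3P [/eqP sj /allP farC /allP sel].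
have p1 : st j (index 1 (state j)) = 1 by apply: nth_index; rewrite -index_mem size_row.
split=> //.
- by move=> q q_lt jq; apply: (count1_uniq c1); rewrite ?size_row.
- move=> q q_lt jq pq; have := farC q; rewrite mem_iota q_lt => /(_ isT).
  rewrite -/(st j q) jq eqxx -/(st _ q) (negbTE pq) => /andP [-> /allP fk];
    split=> // k /fk + k_gt.
  have -> : (k < 63) = false by rewrite ltnNge k_gt.
  by case: (far _ _) => [_|]; [left | right].
move=> k kj; have := sel _ kj; case: eqP => [->|_]; first by constructor 1.
case: ifP => [pk _|_]; first by constructor 2.
case/and4P => q_lt jq pq /eqP E; constructor 3; exists (index 1 (state k)).
have {}E : [seq k' <- nb j | st k' (index 1 (state k)) == 1] = [:: k].
  rewrite -{}E; elim: (nb j) => //= k' l -> /=; rewrite -/(st _ _).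
  by rewrite -/(st k' _); case: ifP.
split=> //; first exact/eqP.
- have : k \in [seq k' <- nb j | st k' (index 1 (state k)) == 1] by rewrite E inE.
  by rewrite mem_filter => /andP [/eqP].
move=> k' k'j k'q; apply/eqP; rewrite -mem_seq1 -E mem_filter k'j andbT; exact/eqP.
Qed.

Lemma unique_min_det a b c c' : unique_min a b c -> unique_min a b c' -> c = c'.
Proof. by rewrite /unique_min; lia. Qed.

Section Covering.

Variable N : geometry.
Hypothesis N_near : near_polygon 4 N.
Hypothesis N_order : has_order 2 4 N.
Implicit Types (x y z w : point N).
Variable h : nat -> point N.
Hypothesis hE : embedding h.

Definition has_state x j : Prop := forall q, q < 63 -> dist x (h q) = st j q.

Lemma has_state_h j : j < 63 -> has_state (h j) j.
Proof. by move=> j_lt q; exact: hE. Qed.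

Lemma has_state_hexagon x j : j < 63 -> has_state x j -> x = h j.
Proof.
move=> j_lt xj; apply: (dist0_eq N_near); rewrite xj //.
by have [] := hexagon_spec j_lt j_lt.
Qed.

Lemma has_state_inj x j k : j < 315 -> k < 315 -> has_state x j -> has_state x k -> j = k.
Proof.
move=> j_lt k_lt xj xk; apply: row_inj => //; rewrite !row_mkseq //.
by apply/eq_in_map => i; rewrite mem_iota => /andP [_ i_lt]; rewrite -xj // xk.
Qed.

Lemma has_state_third L x y z j k l : line3 L x y z -> j < 315 -> (k, l) \in pairs j ->
  has_state x j -> has_state y k -> has_state z l.
Proof.
move=> l3 j_lt kl xj yk q q_lt; have := line3_dist_to N_near (h q) l3.
rewrite xj // yk // => m; exact: unique_min_det m (unique_min_row j_lt kl q_lt).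
Qed.

Lemma far_states x y j k : j < 315 -> k < 315 -> collinear x y ->
  has_state x j -> has_state y k -> ~~ far (state j) (state k).
Proof.
move=> j_lt k_lt xy xj yk; apply/negP; rewrite !row_mkseq // => /farP [i i_lt /negP []].
by rewrite -xj // -yk //; exact: near_dist.
Qed.

Definition realized x j : Prop :=
  forall k, k \in nb j -> exists2 y, collinear x y & has_state y k.

(** The state [p] and the third state of the line on [p] are immediate. Each other state belongs to
    the midpoint between [x] and a suitable [h q], for which the table leaves a single
    possibility. *)
Lemma realized_outer x j : 62 < j -> j < 315 -> has_state x j -> realized x j.
Proof.
move=> j_gt j_lt xj k kj.
have [p [[p_lt jp] p_uniq [pj uj sj] farC sel]] := covering_spec j_gt j_lt.
have xp : collinear x (h p) by apply: (dist1_collinear N_near); rewrite xj.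
case: (sel k kj) => [->|pk|[q [q_lt jq pq kq k_uniq]]].
- by exists (h p) => //; exact: has_state_h.
- have [L [y l3]] := third_collinear N_order xp.
  exists y; first exact: line3_collinear (line3_perm (line3_rot (line3_rot l3))).
  exact: has_state_third l3 j_lt pk xj (has_state_h p_lt).
have [farq fark] := farC q q_lt jq pq.
have xq : dist x (h q) = 2 by rewrite xj.
have [y xy yq] := midpoint N_near xq.
have yo : outside h y.
  move=> i i_lt; rewrite lt0n; apply/eqP => /(dist0_eq N_near) yi; subst y.
  have ip : i = p by apply: p_uniq => //; rewrite -xj //; exact: (dist_collinear N_near).
  by subst i; move: pq; rewrite -hE // yq.
(* Kind (A) at [q], and every outer state at [q] not in [nb j], is too far from the state [j];
   within [nb j] only [k] has value 1 at [q]. *)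
case: (outside_cases N_near N_order hE yo q_lt yq) => [yA|[k' [k'_gt k'_lt k'q yk']]].
  move: farq; rewrite row_mkseq // shifted_row_mkseq ?(leq_trans q_lt) //.
  by move/farP => [i i_lt /negP []]; rewrite -xj // -yA //; exact: near_dist.
case: (fark k' k'q k'_gt) => [|k'j].
  by rewrite (negbTE (far_states j_lt k'_lt xy xj yk')).
by exists y => //; rewrite -(k_uniq k' k'j) // -yk'.
Qed.

Hypothesis outer_exists : exists x j, [/\ 62 < j, j < 315 & has_state x j].

(** Earlier neighbours lead from the given outer state down to 63, and the same links followed
    upwards lead from 63 to every [j]. *)
Lemma outer_states j : 62 < j -> j < 315 -> exists x, has_state x j.
Proof.
have step i k : 62 < i -> i < 315 -> k \in nb i ->
    (exists x, has_state x i) -> exists x, has_state x k.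
  by move=> i_gt i_lt ki [x xi]; have [y _ yk] := realized_outer i_gt i_lt xi ki; exists y.
have conn i : 63 < i -> i < 315 -> exists2 k, 62 < k < i & k \in nb i.
  move=> i_gt i_lt; have /allP /(_ i) := connection_checked.
  by rewrite mem_iota i_gt i_lt => /(_ isT) /hasP [k ki k_lt]; exists k.
have base : exists x, has_state x 63.
  have [x [i [i_gt i_lt xi]]] := outer_exists.
  have {x xi} : exists x, has_state x i by exists x.
  elim/ltn_ind: i i_gt i_lt => i IH; rewrite leq_eqVlt => /orP [/eqP <- //|i_gt] i_lt ex.
  have [k /andP [k_gt k_lt] ki] := conn i i_gt i_lt.
  by apply: (IH k) => //; [exact: ltn_trans k_lt i_lt | apply: step ex; rewrite // ltnW].
elim/ltn_ind: j => j IH; rewrite leq_eqVlt => /orP [/eqP <- //|j_gt] j_lt.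
have [k /andP [k_gt k_lt] kj] := conn j j_gt j_lt.
have k_lt' := ltn_trans k_lt j_lt.
by apply: (step k) (IH k _ _ _) => //; have [] := nb_lt j_lt kj.
Qed.

(** For a hexagon point [h j]: an outer state in [nb j] has value 1 at [j], so any point having it,
    and one exists by [outer_states], is a neighbour of [h j]. *)
Lemma realized_all x j : j < 315 -> has_state x j -> realized x j.
Proof.
move=> j_lt xj; case: (ltnP 62 j) => [j_gt|]; first exact: realized_outer.
rewrite -ltnS => j63 k kj; have [_ _ outer1] := hexagon_nb j63.
rewrite (has_state_hexagon j63 xj).
have [k_lt _] := nb_lt j_lt kj.
case: (ltnP 62 k) => [k_gt|]; last rewrite -ltnS => k63.
  have [y yk] := outer_states k_gt k_lt; exists y => //; apply: collinear_sym.
  by apply: (dist1_collinear N_near); rewrite yk // outer1.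
exists (h k); last exact: has_state_h.
apply: (dist1_collinear N_near); rewrite hE //.
by have [_ _ _ /esym] := hexagon_spec j63 k63; rewrite kj => /eqP.
Qed.

(** The ten states in [nb j] are realised among the ten neighbours of [x], so the count of
    [all_neighbours] is tight. *)
Lemma neighbour_states x j : j < 315 -> has_state x j ->
  (forall y, collinear x y -> exists2 k, k \in nb j & has_state y k) /\
  (forall k y z, k \in nb j -> collinear x y -> collinear x z ->
     has_state y k -> has_state z k -> y = z).
Proof.
move=> j_lt xj.
have [uj sj] : uniq (nb j) /\ size (nb j) = 10.
  case: (ltnP 62 j) => [j_gt|]; last by rewrite -ltnS => /hexagon_nb [].
  by have [p [_ _ []]] := covering_spec j_gt j_lt.
apply: (all_neighbours N_near N_order (P := fun k y => has_state y k)) => //.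
  exact: realized_all.
move=> k k' y kj k'j; apply: has_state_inj.
  by have [] := nb_lt j_lt kj.
by have [] := nb_lt j_lt k'j.
Qed.

Lemma has_some_state x : exists2 j, j < 315 & has_state x j.
Proof.
have [_ /(_ (h 0) x) [n w] _ _] := N_near.
have : exists2 j, j < 315 & has_state (h 0) j by exists 0 => //; exact: has_state_h.
elim: w => // {n} {}x' n y z x'y _ IH [j j_lt x'j]; apply: IH.
have [/(_ y x'y) [k kj yk] _] := neighbour_states j_lt x'j.
by exists k => //; have [] := nb_lt j_lt kj.
Qed.

(** Two points with the same outer state are neighbours of the same hexagon point, around which each
    state occurs only once. *)
Lemma state_determines x y j : j < 315 -> has_state x j -> has_state y j -> x = y.
Proof.
move=> j_lt xj yj; case: (ltnP 62 j) => [j_gt|]; last first.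
  by rewrite -ltnS => j63; rewrite (has_state_hexagon j63 xj) (has_state_hexagon j63 yj).
have [p [[p_lt jp] _ [pj _ _] _ _]] := covering_spec j_gt j_lt.
have p315 : p < 315 by exact: leq_trans p_lt _.
have [_ uniq_nb] := neighbour_states p315 (has_state_h p_lt).
by apply: (uniq_nb j) => //; apply/collinear_sym/(dist1_collinear N_near); rewrite ?xj ?yj.
Qed.

Lemma near_octagon_labelling : exists phi : point N -> nat,
  [/\ forall x, phi x < 315, injective phi, forall j, j < 315 -> exists x, phi x = j,
      forall L x y z, line3 L x y z -> (phi y, phi z) \in pairs (phi x)
    & forall x y, phi y \in nb (phi x) -> collinear x y].
Proof.
pose phi x := epsilon (inhabits 0) (fun j => j < 315 /\ has_state x j).
have phiP x : phi x < 315 /\ has_state x (phi x).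
  apply: (epsilon_spec _ (fun j => j < 315 /\ has_state x j)).
  by have [j j_lt xj] := has_some_state x; exists j.
have phi_lt x : phi x < 315 by case: (phiP x).
have phi_st x : has_state x (phi x) by case: (phiP x).
have phiE x j : j < 315 -> has_state x j -> phi x = j.
  by move=> j_lt xj; exact: has_state_inj (phi_st x) xj.
exists phi; split=> //.
- by move=> x y E; apply: (state_determines (phi_lt x)) => //; rewrite E.
- move=> j j_lt; case: (ltnP 62 j) => [j_gt|]; last rewrite -ltnS => j63.
    by have [x xj] := outer_states j_gt j_lt; exists x; exact: phiE.
  by exists (h j); apply: phiE => //; exact: has_state_h.
- move=> L x y z l3; have xy := line3_collinear l3.
  have [/(_ y xy) [k kj yk] _] := neighbour_states (phi_lt x) (phi_st x).
  have [l kl] := nb_pairs kj; have [k_lt l_lt _ _ _] := pairs_spec (phi_lt x) kl.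
  rewrite (phiE y k) // (phiE z l) //.
  exact: has_state_third l3 (phi_lt x) kl (phi_st x) yk.
move=> x y /(realized_all (phi_lt x) (phi_st x)) [z xz zy].
by rewrite -(state_determines (phi_lt y) zy (phi_st y)).
Qed.

End Covering.

(** * Existence of an outer state *)

Lemma spokesP m p : m < 63 -> (p \in spokes m) = (p < 63) && (st m p == 1).
Proof.
move=> m_lt; rewrite mem_filter; case: ltnP => //= p_lt.
by have [_ _ _ ->] := hexagon_spec m_lt p_lt.
Qed.

Definition star m p q r : Prop :=
  [/\ p \in spokes m, q \in spokes m, r \in spokes m & [/\ st p q = 2, st p r = 2 & st q r = 2]].

Lemma star_exists m p : m < 63 -> p \in spokes m -> exists q r, star m p q r.
Proof.
move=> m_lt pm; have /allP /(_ m) := star_checked;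
  rewrite mem_iota m_lt => /(_ isT) /and3P [_ /allP E _].
by have /hasP [q qm /hasP [r rm /and3P [/eqP ? /eqP ? /eqP ?]]] := E p pm; exists q, r.
Qed.

Lemma spoke_exists m : m < 63 -> exists p, p \in spokes m.
Proof.
move=> m_lt; have /allP /(_ m) := star_checked;
  rewrite mem_iota m_lt => /(_ isT) /and3P [/hasP [p pm _] _ _].
by exists p.
Qed.

Lemma star_cover m p q r k : m < 63 -> star m p q r -> k \in spokes m ->
  [\/ st k p < 2, st k q < 2 | st k r < 2].
Proof.
move=> m_lt [pm qm rm [pq pr qr]] km.
have /allP /(_ m) := star_checked;
  rewrite mem_iota m_lt => /(_ isT) /and3P [_ _ /allP /(_ p pm) /allP /(_ q qm)].
by rewrite pq eqxx => /allP /(_ r rm); rewrite pr qr eqxx => /allP /(_ k km) /or3P.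
Qed.

(** The path [p], [m], [q], [r] changes line at each step, so it is a geodesic of the generalized
    hexagon; likewise from [k], the third point of the line [pm]. *)
Lemma path_spec m p k q : m < 63 -> p \in spokes m -> q \in spokes m -> st p q = 2 ->
  (p, k) \in pairs m -> st k q = 2 /\
  forall r, r \in spokes q -> st m r = 2 -> st p r = 3 /\ st k r = 3.
Proof.
move=> m_lt pm qm pq pk.
have p_lt : p < 63 by move: pm; rewrite spokesP // => /andP [].
have [k_lt mp mk pk1] := hexagon_pairs m_lt p_lt pk.
have km : k \in [seq k <- spokes m | st k p < 2].
  by rewrite mem_filter spokesP // k_lt mk; have [_ <- _ _] := hexagon_spec p_lt k_lt;
    rewrite pk1.
have kp : (k == p) = false by have [_ _ <- _] := hexagon_spec k_lt p_lt;
  have [_ <- _ _] := hexagon_spec p_lt k_lt; rewrite pk1.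
have /allP /(_ m) := path_checked;
  rewrite mem_iota m_lt => /(_ isT) /allP /(_ p pm) /allP /(_ q qm).
rewrite pq eqxx => /andP [/allP /(_ k km)]; rewrite kp orFb => /eqP -> /allP E;
  split=> // r rq mr.
have := E r rq; rewrite mr eqxx => /andP [/eqP -> /allP /(_ k km)].
by rewrite kp orFb => /eqP.
Qed.

(** * Points over the hexagon when no outer state occurs *)

Section NoOuterState.

Variable N : geometry.
Hypothesis N_near : near_polygon 4 N.
Hypothesis N_order : has_order 2 4 N.
Implicit Types (x y z w : point N).
Variable h : nat -> point N.
Hypothesis hE : embedding h.
Hypothesis no_outer : forall x j, 62 < j -> j < 315 -> ~ has_state h x j.

Local Notation distC := (distC N_near).

Definition over p x : Prop := forall q, q < 63 -> dist x (h q) = (st p q).+1.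

Lemma overP p x : p < 63 -> outside h x -> dist x (h p) = 1 -> over p x.
Proof.
move=> p_lt xo xp; case: (outside_cases N_near N_order hE xo p_lt xp) => // -[k [k_gt k_lt _ xk]].
by case: (no_outer k_gt k_lt xk).
Qed.

Lemma over_automorphism s p x q : s \in automorphisms -> p < 63 -> over (nth 0 s p) x -> q < 63 ->
  dist x (h (nth 0 s q)) = (st p q).+1.
Proof.
move=> sa p_lt px q_lt; rewrite px ?automorphism_lt //.
by have [_ ->] := automorphism_spec sa.
Qed.

(** The midpoint towards a nearest hexagon point is over that point, so the distances from [x],
    lowered by 1, stay within 1 of the state of that point. *)
Lemma not_type_C s x : s \in automorphisms -> (forall i, i < 63 -> 1 < dist x (h i)) ->
  ~ type_C (mkseq (fun i => dist x (h (nth 0 s i)) - 1) 63).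
Proof.
move=> sa xo; have h'E := embedding_automorphism hE sa.
case/(type_C_far h'E) => q [q_lt xq] [i i_lt /negP []].
have sq := automorphism_lt sa q_lt; have si := automorphism_lt sa i_lt.
have [y xy yq] := midpoint N_near xq.
have yo : outside h y.
  move=> j j_lt; rewrite lt0n; apply/eqP => /(dist0_eq N_near) yj; subst y.
  by have := xo j j_lt; rewrite (dist_collinear N_near xy).
have := near_dist N_near (h (nth 0 s i)) xy.
rewrite (over_automorphism sa q_lt (overP sq yo yq) i_lt) /near.
have := xo _ si; lia.
Qed.

Lemma unique_projection2 x p q : (forall i, i < 63 -> 1 < dist x (h i)) -> p < 63 -> q < 63 ->
  dist x (h p) = 2 -> dist x (h q) = 2 -> p = q.
Proof.
move=> xo p_lt q_lt xp; have [s sa s0] := automorphism_at p_lt.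
have [q' q'_lt <-] := automorphism_surj sa q_lt; rewrite -s0 => xq; congr nth.
have h'E := embedding_automorphism hE sa.
have sol : mkseq (fun i => dist x (h (nth 0 s i)) - 1) 63 \in solutions.
  apply: (solution_of N_near N_order h'E); last by rewrite s0.
  by move=> i i_lt; apply: xo; exact: automorphism_lt.
case: (solution_cases sol) => [/(not_type_C sa xo) //|[c1 _]].
by apply: (count1_uniq c1); rewrite ?size_mkseq ?nth_mkseq // ?s0 ?xp ?xq.
Qed.

(** A neighbour [w] of neither form would be at distance 2 from the hexagon, with a solution as its
    lowered state. Kinds (A) and (B) then give a distance 5, kind (C) is excluded by [not_type_C],
    and kind (b) gives too many neighbours. *)
Lemma over_neighbour p x w : p < 63 -> over p x -> collinear x w ->
  (exists2 r, r < 63 & w = h r) \/ (exists2 r, r < 63 & over r w).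
Proof.
move=> p_lt px xw.
case: (classic (exists2 r, r < 63 & w = h r)) => [|not_h]; [by left | right].
have wo : outside h w.
  by move=> i i_lt; rewrite lt0n; apply/eqP => /(dist0_eq N_near) wi; apply: not_h; exists i.
case: (classic (exists2 r, r < 63 & dist w (h r) = 1)) => [[r r_lt wr]|not_1].
  by exists r => //; exact: overP.
exfalso; have w2 i : i < 63 -> 1 < dist w (h i).
  move=> i_lt; have := wo i i_lt; rewrite leq_eqVlt => /orP [/eqP E|//].
  by case: not_1; exists i.
have wp : dist w (h p) = 2.
  have := near_dist N_near (h p) xw; rewrite px // /near.
  by have [-> _ _ _] := hexagon_spec p_lt p_lt; have := w2 p p_lt; lia.
have [s sa s0] := automorphism_at p_lt.
have h'E := embedding_automorphism hE sa.
have s_lt i : i < 63 -> nth 0 s i < 63 by exact: automorphism_lt.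
have sol : mkseq (fun i => dist w (h (nth 0 s i)) - 1) 63 \in solutions.
  by apply: (solution_of N_near N_order h'E); [move=> i i_lt; apply: w2;
    exact: s_lt | rewrite s0].
have /andP [/hasP [i3 + /eqP i3E] /allP outer4] := shift_checked.
rewrite mem_iota => /andP [_ i3_lt].
case: (solution_cases sol) => [/(not_type_C sa w2) //|[c1 [tb|E|[k [k_gt k0 E]]]]].
- have fm q : q \in far_minima (mkseq (fun i => dist w (h (nth 0 s i)) - 1) 63) ->
      [/\ q < 63, dist w (h (nth 0 s q)) = 3 & st 0 q != 1].
    rewrite mem_filter mem_iota => /andP [/andP [+ ->] /andP [_ q_lt]].
    by rewrite nth_mkseq // => /eqP E; split=> //; have := w2 _ (s_lt q q_lt); lia.
  suff : size (far_minima (mkseq (fun i => dist w (h (nth 0 s i)) - 1) 63)) <= 10.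
    by move=> le; move: tb; rewrite /type_b ltnNge (leq_trans le).
  (* The label [q] goes to the neighbours of [w] that are themselves at distance 2 from the hexagon,
     attained at the image of [q]; [unique_projection2] makes labels exclusive. *)
  apply: (few_neighbours N_near N_order (x := w) (P := fun q u =>
    (forall i, i < 63 -> 1 < dist u (h i)) /\ dist u (h (nth 0 s q)) = 2)).
  + move=> q /fm [q_lt wq q0]; have sq := s_lt q q_lt.
    have p_only r : r < 63 -> dist w (h r) <= 2 -> r = p.
      move=> r_lt le; apply: (unique_projection2 w2) => //.
      by have := w2 r r_lt; lia.
    have pq : st p (nth 0 s q) != 1.
      by have [_ sst] := automorphism_spec sa; rewrite -s0 sst.
    have [u wu uq] := midpoint N_near wq; have [v uv vq] := midpoint N_near uq.
    have vo : outside h v.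
      move=> i i_lt; rewrite lt0n; apply/eqP => /(dist0_eq N_near) vi; subst v.
      have ip : i = p.
        apply: p_only => //; have := dist_triangle N_near u w (h i).
        by rewrite (dist_collinear N_near wu) (dist_collinear N_near uv).
      by subst i; move: pq; rewrite -hE // vq.
    have vP := overP sq vo vq.
    exists u => //; split=> // i i_lt; rewrite ltn_neqAle; apply/andP; split; last first.
      rewrite lt0n; apply/eqP => /(dist0_eq N_near) ui; subst u.
      by have := w2 i i_lt; rewrite (dist_collinear N_near wu).
    (* If [u] were adjacent to the hexagon it would be over [p]; its distance 2 to the image of [q]
       would make that point adjacent to [p]. *)
    apply/eqP => ui.
    have uo : outside h u.
      move=> j j_lt; rewrite lt0n; apply/eqP => /(dist0_eq N_near) uj; subst u.
      by have := w2 j j_lt; rewrite (dist_collinear N_near wu).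
    have uP := overP i_lt uo (esym ui).
    have ip : i = p.
      apply: p_only => //; have := dist_triangle N_near u w (h i).
      by rewrite (dist_collinear N_near wu) -ui.
    by move: pq; subst i; move: uq; rewrite uP // => -[->].
  + move=> a b u /fm [a_lt _ _] /fm [b_lt _ _] [u2 ua] [_ ub].
    have E := unique_projection2 u2 (s_lt _ a_lt) (s_lt _ b_lt) ua ub.
    have [sp _] := automorphism_spec sa.
    apply/eqP; rewrite -(@nth_uniq _ 0 s) ?(perm_size sp) ?size_iota //; first exact/eqP.
    by rewrite (perm_uniq sp) iota_uniq.
  + by rewrite filter_uniq // iota_uniq.
- move: E; rewrite shifted_row_mkseq // => /mkseq_inj /(_ i3_lt); rewrite i3E => E3.
  by have := dist_le_diam N_near w (h (nth 0 s i3)); have := w2 _ (s_lt _ i3_lt); lia.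
have [k_lt _] := nb_lt (isT : 0 < 315) k0.
move: (outer4 k k0); rewrite ltnNge k_gt orFb => /hasP [i4 + /eqP i4E].
rewrite mem_iota => /andP [_ i4_lt].
move: E; rewrite row_mkseq // => /mkseq_inj /(_ i4_lt); rewrite i4E => E4.
by have := dist_le_diam N_near w (h (nth 0 s i4)); have := w2 _ (s_lt _ i4_lt); lia.
Qed.

End NoOuterState.

(** The letters stand for the three points of a star, the index for an extra line there, the prime
    for the second extra line at the centre. The lower bounds add up to 8 and so do the upper
    bounds, hence all are attained. *)
Lemma slot_count a0 a1 b0 b1 c0 c1 a0' a1' b0' b1' c0' c1' :
  b0 + b0' <= 1 -> b1 + b1' <= 1 -> c0 + c0' <= 1 -> c1 + c1' <= 1 ->
  4 <= a0 + a1 + (b0 + b1) + (c0 + c1) -> 4 <= a0' + a1' + (b0' + b1') + (c0' + c1') ->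
  a0 <= 1 -> a1 <= 1 -> a0' <= 1 -> a1' <= 1 ->
  [/\ a0 = 1, a1 = 1, a0' = 1 & a1' = 1] /\ b0 + b0' = 1 /\ b1 + b1' = 1.
Proof. by move=> *; repeat split; lia. Qed.

(** * Extra lines at hexagon points and their parallelism *)

Section ExtraLines.

Variable N : geometry.
Hypothesis N_near : near_polygon 4 N.
Hypothesis N_order : has_order 2 4 N.
Implicit Types (x y z w : point N).
Variable h : nat -> point N.
Hypothesis hE : embedding h.
Hypothesis no_outer : forall x j, 62 < j -> j < 315 -> ~ has_state h x j.

Local Notation distC := (distC N_near).
Local Notation over := (over h).

Definition extra_lines p (f : bool -> line N) : Prop :=
  [/\ f false <> f true, forall b, inc (h p) (f b),
      forall b x, inc x (f b) -> x <> h p -> over p x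
    & forall x, outside h x -> dist x (h p) = 1 -> exists b, inc x (f b)].

(** Of the five lines on [h p] three join it to the points of a star; the other two are the extra
    lines. *)
Lemma extra_lines_exist p : p < 63 -> exists f, extra_lines p f.
Proof.
move=> p_lt; have [_ /(_ (h p)) [g [g_inj gP]]] := N_order.
have [q1 q1p] := spoke_exists p_lt; have [q2 [q3 S]] := star_exists p_lt q1p.
have spoke_line q : q \in spokes p -> exists i k, k < 63 /\ line3 (g i) (h p) (h q) (h k).
  rewrite spokesP // => /andP [q_lt /eqP pq].
  have [k qk] := hexagon_third p_lt q_lt pq.
  have [k_lt _ _ _] := hexagon_pairs p_lt q_lt qk.
  have [L l3] := hexagon_line N_near N_order hE p_lt q_lt qk.
  have [hp _ _ _] := l3; have [i Ei] := (gP L).1 hp.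
  by exists i, k; split=> //; rewrite Ei.
have [q1s q2s q3s [q12 q13 q23]] := S.
have [i1 [k1 [k1_lt l1]]] := spoke_line _ q1s.
have [i2 [k2 [k2_lt l2]]] := spoke_line _ q2s.
have [i3 [k3 [k3_lt l3]]] := spoke_line _ q3s.
have spoke_lt q : q \in spokes p -> q < 63 by rewrite spokesP // => /andP [].
have diff q q' i i' k k' : q < 63 -> q' < 63 -> st q q' = 2 ->
    line3 (g i) (h p) (h q) (h k) -> line3 (g i') (h p) (h q') (h k') -> i != i'.
  move=> q_lt q'_lt qq' [_ qi _ _] [_ q'i _ _]; apply/eqP => ii'.
  have : dist (h q) (h q') = 2 by rewrite hE.
  case: (classic (h q = h q')) => [->|ne]; first by rewrite (distxx N_near).
  by rewrite (dist_collinear N_near) //; split=> //; exists (g i); split=> //; rewrite ii'.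
have d12 := diff _ _ _ _ _ _ (spoke_lt _ q1s) (spoke_lt _ q2s) q12 l1 l2.
have d13 := diff _ _ _ _ _ _ (spoke_lt _ q1s) (spoke_lt _ q3s) q13 l1 l3.
have d23 := diff _ _ _ _ _ _ (spoke_lt _ q2s) (spoke_lt _ q3s) q23 l2 l3.
have [j0 [j1 [j01 other]]] : exists j0 j1, j0 != j1 /\
    forall i, (i \notin [:: i1; i2; i3]) = (i \in [:: j0; j1]).
  have : size (rem i3 (rem i2 (rem i1 (enum 'I_5)))) = 2.
    have u := enum_uniq 'I_5.
    have m1 : i1 \in enum 'I_5 by rewrite mem_enum.
    have m2 : i2 \in rem i1 (enum 'I_5).
      by rewrite mem_rem_uniq // inE mem_enum andbT eq_sym.
    have m3 : i3 \in rem i2 (rem i1 (enum 'I_5)).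
      rewrite mem_rem_uniq ?rem_uniq // inE; apply/andP; split; first by rewrite eq_sym.
      by rewrite mem_rem_uniq // inE mem_enum andbT eq_sym.
    by rewrite !size_rem // size_enum_ord.
  case E: (rem i3 _) => [|j0 [|j1 [|//]]] // _; exists j0, j1.
  have u : uniq [:: j0; j1] by rewrite -E !rem_uniq ?enum_uniq.
  split; first by move: u; rewrite /= inE andbT.
  move=> i; rewrite -E.
  have -> : (i \in rem i3 (rem i2 (rem i1 (enum 'I_5)))) = [&& i != i3, i != i2 & i != i1].
    rewrite mem_rem_uniq ?rem_uniq ?enum_uniq // inE; congr (_ && _).
    rewrite mem_rem_uniq ?rem_uniq ?enum_uniq // inE; congr (_ && _).
    by rewrite mem_rem_uniq ?enum_uniq // inE mem_enum andbT.
  by rewrite !inE; case: (i == i1); case: (i == i2); case: (i == i3).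
(* A hexagon point on one of the two remaining lines would be a neighbour of [p] and so, by
   [star_cover], on one of the three hexagon lines. *)
have not_spoke i x : i \in [:: j0; j1] -> inc x (g i) -> x <> h p -> outside h x.
  move=> ij xi xp r r_lt; rewrite lt0n; apply/eqP => /(dist0_eq N_near) xr; subst x.
  have pi : inc (h p) (g i) by apply/gP; exists i.
  have pr : collinear (h p) (h r) by split; [exact: nesym | exists (g i)].
  have rs : r \in spokes p.
    by rewrite spokesP // r_lt -hE // (dist_collinear N_near pr).
  have on_line q i' k : q \in spokes p -> st r q < 2 -> line3 (g i') (h p) (h q) (h k) -> i = i'.
    move=> qs rq [pi' qi' _ _]; have q_lt := spoke_lt _ qs; apply: g_inj.
    have [E|ne] := eqVneq r q; first by apply: (pls_line N_near (nesym xp)) => //; rewrite E.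
    have rq1 : collinear (h r) (h q).
      apply: (dist1_collinear N_near); rewrite hE //; move: rq.
      by have [_ _ E _] := hexagon_spec r_lt q_lt; move: E; rewrite (negbTE ne);
        case: (st r q) => [|[]].
    have pq : collinear (h p) (h q).
      by apply: (dist1_collinear N_near); rewrite hE //; move: qs;
        rewrite spokesP // => /andP [_ /eqP].
    have [L [pL rL qL _]] := no_triangle N_near N_order pr pq rq1.
    rewrite (pls_line N_near (nesym xp) pi xi pL rL).
    by apply: (pls_line N_near (proj1 pq)).
  have := other i; rewrite ij => /negP; apply; rewrite !inE.
  have {ij} : [\/ i = i1, i = i2 | i = i3].
    case: (star_cover p_lt S rs) => rq; [constructor 1|constructor 2|constructor 3].
    - exact: on_line rq l1.
    - exact: on_line rq l2.
    - exact: on_line rq l3.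
  by case=> ->; rewrite eqxx ?orbT.
exists (fun b => if b then g j1 else g j0); split.
- by move=> /g_inj /eqP; rewrite (negbTE j01).
- by move=> [] /=; apply/gP; eexists.
- move=> b x xb xp; have xo : outside h x.
    by case: b xb => xb; apply: (not_spoke _ _ _ xb xp); rewrite !inE eqxx ?orbT.
  apply: (overP N_near N_order hE no_outer p_lt xo).
  apply: (dist_collinear N_near); split=> //.
  by case: b xb => xb; [exists (g j1) | exists (g j0)]; split=> //; apply/gP; eexists.
move=> x xo /(dist1_collinear N_near) [xp [L [xL pL]]].
have [i Ei] := (gP L).1 pL; rewrite -Ei in xL.
have : i \in [:: j0; j1].
  rewrite -other !inE; apply/negP => /or3P E.
  have not_in q k : q < 63 -> k < 63 -> ~ line3 (g i) (h p) (h q) (h k).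
    move=> q_lt k_lt [_ _ _ [_ _ _ /(_ x xL)]].
    by case=> E'; have := xo; rewrite /outside E';
      [move=> /(_ p p_lt)|move=> /(_ q q_lt)|move=> /(_ k k_lt)]; rewrite (distxx N_near).
  case: E => /eqP E; subst i.
  - exact: not_in (spoke_lt _ q1s) k1_lt l1.
  - exact: not_in (spoke_lt _ q2s) k2_lt l2.
  - exact: not_in (spoke_lt _ q3s) k3_lt l3.
by rewrite !inE => /orP [] /eqP E; [exists false | exists true]; rewrite -E.
Qed.

Variable e : nat -> bool -> line N.
Hypothesis eE : forall p, p < 63 -> extra_lines p (e p).

Definition ext p i x : Prop := inc x (e p i) /\ x <> h p.

Definition par p i q j : Prop := exists z w, [/\ ext p i z, ext q j w & collinear z w].

Lemma par_sym p i q j : par p i q j -> par q j p i.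
Proof. by case=> z [w [pz qw zw]]; exists w, z; split=> //; exact: collinear_sym. Qed.

Lemma ext_over p i x : p < 63 -> ext p i x -> over p x.
Proof. by move=> p_lt [xi xp]; have [_ _ + _] := eE p_lt; apply; eassumption. Qed.

Lemma st_diag p : p < 63 -> st p p = 0.
Proof. by move=> p_lt; have [] := hexagon_spec p_lt p_lt. Qed.

Lemma st_sym p q : p < 63 -> q < 63 -> st p q = st q p.
Proof. by move=> p_lt q_lt; have [] := hexagon_spec p_lt q_lt. Qed.

Lemma ext_exists p i : p < 63 -> exists x, ext p i x.
Proof.
move=> p_lt; have [_ /(_ i) pi _ _] := eE p_lt.
have [y [z [_ yi _ [py _ _ _]]]] := other_points N_near N_order pi.
by exists y; split=> //; exact: nesym.
Qed.

Lemma ext_line3 p i x y : p < 63 -> ext p i x -> ext p i y -> x <> y ->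
  line3 (e p i) (h p) x y.
Proof.
move=> p_lt [xi xp] [yi yp] xy; have [_ /(_ i) pi _ _] := eE p_lt.
have [z l3] := third_point N_order pi xi (nesym xp).
by have [_ _ _ [_ _ _ all]] := l3; case: (all y yi) => E; [case: yp|case: xy|rewrite E].
Qed.

Lemma ext_third p i x : p < 63 -> ext p i x -> exists2 y, line3 (e p i) (h p) x y & ext p i y.
Proof.
move=> p_lt [xi xp]; have [_ /(_ i) pi _ _] := eE p_lt.
have [z l3] := third_point N_order pi xi (nesym xp).
by exists z => //; have [_ _ zi [_ pz _ _]] := l3; split=> //; exact: nesym.
Qed.

(** One collinear pair suffices: the near polygon property, applied from [w0] to the line at [p] and
    then from [z] to the line at [q], gives every other point a partner. *)
Lemma par_ext p i q j z : p < 63 -> q < 63 -> st p q = 1 -> par p i q j -> ext p i z ->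
  exists2 w, ext q j w & collinear z w.
Proof.
move=> p_lt q_lt pq [z0 [w0 [pz0 qw0 zw0]]] pz.
case: (classic (z0 = z)) => [<-|ne]; first by exists w0.
have [w l3 qw] := ext_third q_lt qw0; exists w => //.
have lz := ext_line3 p_lt pz0 pz ne.
have qp := st_sym p_lt q_lt.
have := line3_dist N_near w0 lz; rewrite (ext_over q_lt qw0 p_lt) -qp pq.
rewrite (dist_collinear N_near (collinear_sym zw0)) => m1.
have zw02 : dist z w0 = 2 by rewrite distC; move: m1; rewrite /unique_min; lia.
have := line3_dist N_near z l3; rewrite (ext_over p_lt pz q_lt) pq zw02 => m2.
by apply: (dist1_collinear N_near); move: m2; rewrite /unique_min; lia.
Qed.

(* If z1 and z2, z2' are points of the two extra lines at m, and x, y over p, k satisfy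
   x ~ z1, z2 and y ~ z1, z2', then z1, z2 and z2' reach the same point of the extra line
   at q, which has therefore two nearest points z2, z2' on a line. *)
Lemma par_claim p k m i q j n : m < 63 -> p < 63 -> q < 63 -> (p, k) \in pairs m ->
  par p i m false -> par p i m true ->
  st m q = n -> st p q = n.+1 -> st k q = n.+1 ->
  (forall b z, ext m b z -> exists2 a, ext q j a & dist z a <= n) -> False.
Proof.
move=> m_lt p_lt q_lt pk P1 P2 mq pq kq reach.
have [k_lt mp mk pk1] := hexagon_pairs m_lt p_lt pk.
have pm : st p m = 1 by rewrite st_sym.
have [x px] := ext_exists i p_lt.
have [z1 mz1 xz1] := par_ext p_lt m_lt pm P1 px.
have [z2 mz2 xz2] := par_ext p_lt m_lt pm P2 px.
(* Here [y] is the line joining [x] and [z1], and [y'] is its third point, adjacent to [h k]. *)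
have [y l3y] := third_collinear N_order xz1; case: l3y => y' l3y.
have z1o := ext_over m_lt mz1; have z2o := ext_over m_lt mz2.
have xo := ext_over p_lt px.
have yk : dist y' (h k) = 1.
  have := line3_dist_to N_near (h k) l3y; rewrite xo // z1o // mk pk1 /unique_min; lia.
have ym : dist y' (h m) = 2.
  have := line3_dist_to N_near (h m) l3y; rewrite xo // z1o // pm st_diag // /unique_min; lia.
have yq : dist y' (h q) = n.+2.
  have := line3_dist_to N_near (h q) l3y; rewrite xo // z1o // pq mq /unique_min; lia.
have [z2' l3z mz2'] := ext_third m_lt mz2.
(* [z1] is on the other extra line at [m], so [h m] is its nearest point on the line of [z2]. *)
have z12 : dist z1 z2 = 2.
  have := line3_dist N_near z1 l3z; rewrite z1o // st_diag //.
  have ne u : ext m true u -> 0 < dist z1 u.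
    move=> [ui um]; rewrite lt0n; apply/eqP => /(dist0_eq N_near) E; subst u.
    have [ee pe _ _] := eE m_lt; case: mz1 => z1i _.
    by case: ee; apply: (pls_line N_near um).
  by move: (ne _ mz2) (ne _ mz2'); rewrite /unique_min; lia.
have yz2 : dist y' z2 = 2.
  have := line3_dist_to N_near z2 l3y; rewrite (dist_collinear N_near xz2) z12 /unique_min; lia.
have yz2' : dist y' z2' = 1.
  have := line3_dist N_near y' l3z; rewrite ym yz2 /unique_min; lia.
have yz1 : dist y' z1 = 1.
  by apply: (dist_collinear N_near); apply: line3_collinear (line3_perm (line3_rot l3y)).
have [a qa z1a] := reach _ _ mz1; have [b qb z2b] := reach _ _ mz2.
have [b' qb' z2b'] := reach _ _ mz2'.
(* On a line of three points the largest distance is attained twice; with [h q] at distance [n.+2],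
   only one other point can be within [n.+1]. *)
have same u c c' : dist u (h q) = n.+2 -> ext q j c -> ext q j c' ->
    dist u c <= n.+1 -> dist u c' <= n.+1 -> c = c'.
  move=> uq qc qc' uc uc'; case: (classic (c = c')) => // ne.
  have := line3_dist N_near u (ext_line3 q_lt qc qc' ne).
  by rewrite uq /unique_min; lia.
have ab : a = b.
  apply: (same x) => //; first by rewrite xo // pq.
    by have := dist_triangle N_near z1 x a; rewrite (dist_collinear N_near xz1); lia.
  by have := dist_triangle N_near z2 x b; rewrite (dist_collinear N_near xz2); lia.
have ab' : a = b'.
  apply: (same y') => //.
    by have := dist_triangle N_near z1 y' a; rewrite yz1; lia.
  by have := dist_triangle N_near z2' y' b'; rewrite yz2'; lia.
(* Now [a] is at distance [n.+1] from [h m] and within [n] of both [z2] and [z2'], so the minimum on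
   their line is not unique. *)
have := line3_dist N_near a l3z; rewrite (ext_over q_lt qa) // (st_sym q_lt m_lt) mq.
subst b b'; rewrite !(distC a) /unique_min; lia.
Qed.

Definition parb p i q j : bool :=
  if excluded_middle_informative (par p i q j) then true else false.

Lemma parP p i q j : reflect (par p i q j) (parb p i q j).
Proof. by rewrite /parb; case: excluded_middle_informative => P; constructor. Qed.

Lemma parb_sym p i q j : parb p i q j = parb q j p i.
Proof. by apply/parP/parP => /par_sym. Qed.

(** Fix [z] on the extra line [i]. Each of the four other lines on [z] meets an extra line at a
    point of the star, and different lines meet different extra lines. *)
Lemma par_slots m i q1 q2 q3 : m < 63 -> star m q1 q2 q3 ->
  4 <= parb m i q1 false + parb m i q1 true + (parb m i q2 false + parb m i q2 true)
     + (parb m i q3 false + parb m i q3 true).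
Proof.
move=> m_lt S; have [q1s q2s q3s _] := S.
have [z mz] := ext_exists i m_lt; have zo := ext_over m_lt mz; have [zi zm] := mz.
have [_ /(_ z) [g [g_inj gP]]] := N_order.
have gz l : inc z (g l) by apply/gP; exists l.
have [l0 El0] := (gP (e m i)).1 zi.
have spoke_lt q : q \in spokes m -> q < 63 by rewrite spokesP // => /andP [].
have spoke1 q : q \in spokes m -> st m q = 1 by rewrite spokesP // => /andP [_ /eqP].
pose hit l (s : nat * bool) := exists2 w, ext s.1 s.2 w & inc w (g l).
have slot l : l != l0 -> exists s, s \in [seq (q, j) | q <- [:: q1; q2; q3], j <- [:: false;
  true]]
    /\ hit l s.
  move=> l_ne.
  have no_m : ~ inc (h m) (g l).
    move=> ml; case/eqP: l_ne; apply: g_inj; rewrite El0.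
    by have [_ /(_ i) mi _ _] := eE m_lt; apply: (pls_line N_near zm).
  have [y [y' l3]] := other_points N_near N_order (gz l).
  have zy := line3_collinear l3.
  have zy' := line3_collinear (line3_perm (line3_rot (line3_rot l3))).
  have [_ yl y'l _] := l3.
  have not_h u r : collinear z u -> inc u (g l) -> r < 63 -> u <> h r.
    move=> zu ul r_lt E; subst u; apply: no_m.
    have := dist_collinear N_near zu; rewrite zo // => -[/eqP].
    by have [_ _ -> _] := hexagon_spec m_lt r_lt => /eqP ->.
  have outside_of u : collinear z u -> inc u (g l) -> outside h u.
    by move=> zu ul r r_lt; rewrite lt0n; apply/eqP => /(dist0_eq N_near); exact: not_h.
  have at_spoke u q : q \in spokes m -> collinear z u -> inc u (g l) -> dist u (h q) = 1 ->
      exists j, hit l (q, j).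
    move=> qs zu ul uq; have [_ _ _ /(_ u)] := eE (spoke_lt q qs).
    case=> // [|j uj]; first exact: outside_of.
    by exists j; exists u => //; split=> //; exact: not_h (spoke_lt q qs).
  have [r r_lt yr] : exists2 r, r < 63 & over r y.
    case: (over_neighbour N_near N_order hE no_outer m_lt zo zy) => // -[r r_lt E].
    by case: (not_h y r).
  (* If [r] were [m], both [z] and [y] would be at distance 1 from [h m], so [y'] would be [h m],
     which is not on this line. *)
  have mr : st m r = 1.
    have := near_dist N_near (h r) zy; rewrite zo // yr // st_diag // /near.
    suff : st m r != 0 by lia.
    have [_ _ -> _] := hexagon_spec m_lt r_lt; apply/eqP => E; subst r.
    case: (not_h y' m) => //; apply: (dist0_eq N_near).
    have := line3_dist_to N_near (h m) l3; rewrite zo // yr // st_diag // /unique_min; lia.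
  have rs : r \in spokes m by rewrite spokesP // r_lt mr.
  (* If [r = q], then [y] is adjacent to [h q]. Otherwise [z] and [y] are both at distance 2 from
     [h q], so that [y'] is adjacent to it. *)
  have near_spoke q : q \in spokes m -> st r q < 2 -> exists j, hit l (q, j).
    move=> qs rq; case E: (st r q) rq => [|[|//]] _.
      by apply: (at_spoke y) => //; rewrite yr ?E //; exact: spoke_lt.
    apply: (at_spoke y') => //; have := line3_dist_to N_near (h q) l3.
    by rewrite zo ?yr ?(spoke1 q qs) ?E ?spoke_lt // /unique_min; lia.
  case: (star_cover m_lt S rs) => rq.
  - have [j hj] := near_spoke _ q1s rq; exists (q1, j); split=> //.
    by apply/allpairsP; exists (q1, j); split; rewrite // !inE ?eqxx //; case: (j).
  - have [j hj] := near_spoke _ q2s rq; exists (q2, j); split=> //.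
    by apply/allpairsP; exists (q2, j); split; rewrite // !inE ?eqxx ?orbT //; case: (j).
  - have [j hj] := near_spoke _ q3s rq; exists (q3, j); split=> //.
    by apply/allpairsP; exists (q3, j); split; rewrite // !inE ?eqxx ?orbT //; case: (j).
have slots_spoke s : s \in [seq (q, j) | q <- [:: q1; q2; q3], j <- [:: false; true]] ->
    s.1 \in spokes m.
  by case/allpairsP => -[q j] /= [+ _ ->]; rewrite !inE => /or3P [] /eqP ->.
pose c l := epsilon (inhabits (0, false)) (fun s =>
  s \in [seq (q, j) | q <- [:: q1; q2; q3], j <- [:: false; true]] /\ hit l s).
have cP l : l != l0 -> c l \in [seq (q, j) | q <- [:: q1; q2; q3], j <- [:: false; true]]
    /\ hit l (c l).
  by move=> l_ne; exact: (epsilon_spec _ _ (slot l l_ne)).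
have hit_coll l s : s.1 \in spokes m -> hit l s -> exists w, [/\ ext s.1 s.2 w,
  inc w (g l) & collinear z w].
  move=> ss [w sw wl]; exists w; split=> //; split; last by exists (g l).
  move=> E; have := ext_over (spoke_lt _ ss) sw m_lt; rewrite -E zo // st_diag //.
  by rewrite (st_sym (spoke_lt _ ss) m_lt) (spoke1 _ ss).
(* Two lines with the same slot would give [z] two neighbours on an extra line whose hexagon point
   is at distance 2 from [z]. *)
have c_inj : {in rem l0 (enum 'I_5) &, injective c}.
  move=> l l'; rewrite !mem_rem_uniq ?enum_uniq // !inE => /andP [l_ne _] /andP [l'_ne _] E.
  have [cl hl] := cP l l_ne; have [_ hl'] := cP l' l'_ne; rewrite -E in hl'.
  have ss := slots_spoke _ cl.
  have [w [sw wl zw]] := hit_coll l _ ss hl; have [w' [sw' wl' zw']] := hit_coll l' _ ss hl'.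
  suff E' : w = w' by subst w'; apply: g_inj; apply: (pls_line N_near (proj1 zw)).
  case: (classic (w = w')) => // ne.
  have := line3_dist N_near z (ext_line3 (spoke_lt _ ss) sw sw' ne).
  rewrite zo ?(spoke1 _ ss) ?spoke_lt // (dist_collinear N_near zw) (dist_collinear N_near zw').
  by rewrite /unique_min; lia.
pose good := [seq s <- [seq (q, j) | q <- [:: q1; q2; q3], j <- [:: false;
  true]] | parb m i s.1 s.2].
have : size (map c (rem l0 (enum 'I_5))) <= size good.
  apply: uniq_leq_size; first by rewrite map_inj_in_uniq // rem_uniq // enum_uniq.
  move=> _ /mapP [l + ->]; rewrite mem_rem_uniq ?enum_uniq // !inE => /andP [l_ne _].
  have [cl hl] := cP l l_ne; rewrite mem_filter cl andbT; apply/parP.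
  have [w [sw wl zw]] := hit_coll l _ (slots_spoke _ cl) hl.
  by exists z, w.
by rewrite size_map size_rem ?mem_enum // size_enum_ord /good size_filter /= addn0 !addnA.
Qed.

(** By [par_claim] at distance 1, an extra line at [q2] or [q3] is parallel to at most one at [m].
    Since each extra line at [m] has four parallels, [slot_count] leaves no freedom. *)
Lemma par_full p m i q2 q3 : p < 63 -> m < 63 -> star m p q2 q3 ->
  parb p i m false -> parb p i m true ->
  (forall b j, parb m b p j) /\ (forall j, parb m false q2 j + parb m true q2 j = 1).
Proof.
move=> p_lt m_lt S /parP P1 /parP P2; have [ps q2s q3s [pq2 pq3 _]] := S.
have mp : st m p = 1 by move: ps; rewrite spokesP // => /andP [_ /eqP].
have [k pk] := hexagon_third m_lt p_lt mp.
have once q j : q \in spokes m -> st p q = 2 -> parb m false q j + parb m true q j <= 1.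
  move=> qs pq; have [q_lt mq] : q < 63 /\ st m q = 1.
    by move: qs; rewrite spokesP // => /andP [-> /eqP].
  have [kq _] := path_spec m_lt ps qs pq pk.
  case: parP => M1; case: parP => M2 //; exfalso.
  apply: (par_claim (j := j) m_lt p_lt q_lt pk P1 P2 mq pq kq) => b z mz.
  have [|w qw zw] := par_ext m_lt q_lt mq (i := b) (j := j) _ mz; first by case: (b).
  by exists w => //; rewrite (dist_collinear N_near zw).
have := par_slots false m_lt S; have := par_slots true m_lt S.
move=> s1 s0; have [] := slot_count (once q2 false q2s pq2) (once q2 true q2s pq2)
  (once q3 false q3s pq3) (once q3 true q3s pq3) s0 s1; rewrite ?leq_b1 //.
case=> /eqP A0 /eqP A1 /eqP A0' /eqP A1' [B0 B1]; split; last by case.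
by move: A0 A1 A0' A1'; rewrite !eqb1 => ? ? ? ? [] [].
Qed.

(** A path 0, [m], [n], [r] is built in which the extra lines at consecutive points are all
    parallel, then matched in pairs, then all parallel; [par_claim] refutes it with [q = r] at
    distance 2 from [m]. *)
Lemma no_extra_lines : False.
Proof.
have [p ps] := spoke_exists (isT : 0 < 63).
(* Four parallels are distributed over three points, so one point receives two. *)
have full m i : m < 63 -> exists q, [/\ q \in spokes m, parb m i q false & parb m i q true].
  move=> m_lt; have [q1 q1s] := spoke_exists m_lt; have [q2 [q3 S]] := star_exists m_lt q1s.
  have [_ q2s q3s _] := S; have := par_slots i m_lt S => sl.
  case: (boolP (parb m i q1 false && parb m i q1 true)) => [/andP [? ?]|n1]; first by exists q1.
  case: (boolP (parb m i q2 false && parb m i q2 true)) => [/andP [? ?]|n2]; first by exists q2.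
  case: (boolP (parb m i q3 false && parb m i q3 true)) => [/andP [? ?]|n3]; first by exists q3.
  by exfalso; move: sl n1 n2 n3; clear; do 6! case: (parb _ _ _ _).
have spoke_sym a b : a < 63 -> b \in spokes a -> b < 63 /\ a \in spokes b.
  move=> a_lt; rewrite spokesP // => /andP [b_lt /eqP ab]; split=> //.
  by rewrite spokesP // a_lt st_sym // ab.
have [m [m0s f1 f2]] := full 0 false (isT : 0 < 63).
have [m_lt om] := spoke_sym 0 m (isT : 0 < 63) m0s.
have [n [q3 S]] := star_exists m_lt om; have [_ ns _ [zn _ _]] := S.
have [_ cols] := par_full (isT : 0 < 63) m_lt S f1 f2.
have [n_lt mn] := spoke_sym m n m_lt ns.
have [r2 [r3 T]] := star_exists n_lt mn; have [_ r2s r3s [mr2 mr3 _]] := T.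
(* Otherwise [par_full] would make all extra lines at [m] and [n] parallel, against [cols]. *)
have rows b : ~~ (parb m b n false && parb m b n true).
  apply/negP => /andP [g1 g2]; have [fullM _] := par_full m_lt n_lt T g1 g2.
  by have := cols false; rewrite !(parb_sym m) !fullM.
have [j1 [j2 [J1 J2 J3]]] : exists j1 j2, [/\ parb m false n j1, parb m true n j2 &
     parb m false n (~~ j1) + parb m true n j1 = 0 ].
  move: (cols false) (cols true) (rows false) (rows true).
  case E: (parb m false n false); case E': (parb m false n true);
    case F: (parb m true n false); case F': (parb m true n true) => // _ _ _ _.
    by exists false, true; rewrite E E' F F'.
  by exists true, false; rewrite E E' F F'.
(* The extra line [j1] at [n] has one parallel at [m], so at least three at [r2] and [r3], and one
   of these points receives two. *)
have [r [rs mr g1 g2]] : exists r, [/\ r \in spokes n, st m r = 2,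
  parb n j1 r false & parb n j1 r true].
  have := par_slots j1 n_lt T; have := rows false; have := cols j1.
  rewrite !(parb_sym n j1 m) => c1 r1 sl.
  case: (boolP (parb n j1 r2 false && parb n j1 r2 true)) => [/andP [? ?]|n2]; first by exists r2.
  case: (boolP (parb n j1 r3 false && parb n j1 r3 true)) => [/andP [? ?]|n3]; first by exists r3.
  by exfalso; move: c1 sl n2 n3; clear; do 6! case: (parb _ _ _ _).
have [r_lt nr] := spoke_sym n r n_lt rs.
have [r' [r'' U]] := star_exists r_lt nr.
have [fullR _] := par_full n_lt r_lt U g1 g2.
have [k pk] := hexagon_third m_lt (isT : 0 < 63) (eqP (proj2 (andP (etrans (esym (spokesP 0
  m_lt)) om)))).
have [_ /(_ r rs mr) [zr kr]] := path_spec m_lt om ns zn pk.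
have mn1 : st m n = 1 by move: ns; rewrite spokesP // => /andP [_ /eqP].
have nr1 : st n r = 1 by move: rs; rewrite spokesP // => /andP [_ /eqP].
apply: (par_claim (j := false) m_lt (isT : 0 < 63) r_lt pk (parP _ _ _ _ f1) (parP _ _ _ _ f2)
  mr zr kr).
move=> b z mz.
(* The extra line [jb] at [n] is matched with [b] at [m], and every extra line at [n] is parallel to
   every one at [r]: the target is reached in two steps. *)
have [jb /parP Jb] : exists jb, parb m b n jb by case: (b); [exists j2 | exists j1].
have [w nw zw] := par_ext m_lt n_lt mn1 Jb mz.
have /parP Rb : parb n jb r false by rewrite parb_sym.
have [a ra wa] := par_ext n_lt r_lt nr1 Rb nw.
exists a => //; have := dist_triangle N_near w z a.
by rewrite (dist_collinear N_near zw) (dist_collinear N_near wa).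
Qed.

End ExtraLines.

Lemma outer_state_exists (N : geometry) (N_near : near_polygon 4 N) (N_order : has_order 2 4 N)
    (h : nat -> point N) : embedding h ->
  exists x j, [/\ 62 < j, j < 315 & has_state h x j].
Proof.
move=> hE; apply: NNPP => none.
have no_outer x j : 62 < j -> j < 315 -> ~ has_state h x j.
  by move=> j_gt j_lt xj; apply: none; exists x, j.
have [L0] : inhabited (line N).
  have [_ /(_ (h 0)) [g _]] := N_order; exact: (inhabits (g ord0)).
pose e p := epsilon (inhabits (fun _ : bool => L0)) (extra_lines h p).
apply: (no_extra_lines N_near N_order hE no_outer (e := e)) => p p_lt.
apply: (epsilon_spec _ _ (extra_lines_exist N_near N_order hE no_outer p_lt)).
Qed.

(** * The hexagon of the statement *)

Definition bits (k : nat) : seq bool := [seq odd (k %/ 2 ^ i) | i <- iota 0 7].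
Definition bits_code (v : seq bool) : nat := foldr (fun (b : bool) n => b + n.*2) 0 v.
Definition all_bits : seq (seq bool) := map bits (iota 0 128).
Definition bits_add (u v : seq bool) : seq bool := [seq p.1 (+) p.2 | p <- zip u v].
Definition bit (v : seq bool) (i : nat) : bool := nth false v i.

(** Over the field with two elements the square and the sign in [quadric] disappear. *)
Definition bits_point (v : seq bool) : bool :=
  has id v && ~~ ((bit v 0 && bit v 4) (+) (bit v 1 && bit v 5) (+) (bit v 2 &&
    bit v 6) (+) bit v 3).

Definition bits_grassmann (u v : seq bool) i j : bool :=
  (bit u i && bit v j) (+) (bit u j && bit v i).

Definition bits_line (u v : seq bool) : bool :=
  let eq i j k l := bits_grassmann u v i j == bits_grassmann u v k l in
  [&& u != v, bits_point u, bits_point v, bits_point (bits_add u v) &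
  [&& eq 1 2 3 4, eq 5 4 3 2, eq 2 0 3 5, eq 6 5 3 0, eq 0 1 3 6 & eq 4 6 3 1]].

Definition bits_points : seq (seq bool) := [seq v <- all_bits | bits_point v].

(** Each line is listed once, by its two points of smallest code; its position numbers the
    corresponding point of H(2)^D. *)
Definition line_pairs : seq (seq bool * seq bool) := Eval vm_compute in
  [seq p <- [seq (u, v) | u <- bits_points, v <- bits_points] |
    bits_line p.1 p.2 && (bits_code p.1 < bits_code p.2 < bits_code (bits_add p.1 p.2))].

Definition line_pair (i : nat) := nth (head (nil, nil) line_pairs) line_pairs i.

Definition triple (u v : seq bool) : seq (seq bool) := [:: u; v; bits_add u v].

Definition line_triple (i : nat) := triple (line_pair i).1 (line_pair i).2.

Definition H2_check : bool :=
  (size line_pairs == 63) &&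
  all (fun p => [&& size p.1 == 7, size p.2 == 7 & bits_line p.1 p.2]) line_pairs &&
  all (fun u => all (fun v => if bits_line u v then
     has (fun p => all (mem (triple u v)) (triple p.1 p.2) &&
       all (mem (triple p.1 p.2)) (triple u v))
       line_pairs else true) bits_points) bits_points.

(** This links the two models: the distances computed among involutions must match the intersections
    of lines in Tits' coordinates. *)
Definition H2D_check : bool :=
  all (fun i => all (fun j =>
     ((st i j == 1) == (i != j) && has (mem (line_triple j)) (line_triple i)) &&
     ((i == j) || ~~ all (mem (line_triple j)) (line_triple i))) (iota 0 63)) (iota 0 63).

Lemma H2_checked : H2_check.
Proof. vm_cast_no_check (erefl true). Qed.

Lemma H2D_checked : H2D_check.
Proof. cbv delta [H2D_check st]; rewrite statesE; vm_cast_no_check (erefl true). Qed.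

(** * Vectors over the field with two elements as bit lists *)

Section Vectors.

Local Open Scope ring_scope.
Import GRing.Theory.
Local Notation vec := 'rV['F_2]_7.
Implicit Types (x y : vec).

Definition of_bit (b : bool) : 'F_2 := b%:R.

Lemma of_bitK (a : 'F_2) : of_bit (a != 0) = a.
Proof. by apply: val_inj; case: a => [[|[|n]] i]. Qed.

Lemma of_bit_eq (b c : bool) : (of_bit b == of_bit c) = (b == c).
Proof. by case: b; case: c. Qed.

Lemma of_bit_eq0 (b : bool) : (of_bit b == 0) = ~~ b.
Proof. by case: b. Qed.

Lemma of_bitD (b c : bool) : of_bit b + of_bit c = of_bit (b (+) c).
Proof. by apply: val_inj; case: b; case: c. Qed.

Lemma of_bitB (b c : bool) : of_bit b - of_bit c = of_bit (b (+) c).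
Proof. by apply: val_inj; case: b; case: c. Qed.

Lemma of_bitM (b c : bool) : of_bit b * of_bit c = of_bit (b && c).
Proof. by apply: val_inj; case: b; case: c. Qed.

Definition bits_of x : seq bool := [seq coord x i != 0 | i <- iota 0 7].

Lemma size_bits_of x : size (bits_of x) = 7%N.
Proof. by rewrite size_map. Qed.

Lemma coord_bit x i : (i < 7)%N -> coord x i = of_bit (bit (bits_of x) i).
Proof. by move=> i_lt; rewrite /bit (nth_map 0%N) ?size_iota // nth_iota // of_bitK. Qed.

Lemma bits_of_inj : injective bits_of.
Proof.
move=> x y E; apply/rowP => j; rewrite -[j]inord_val.
by rewrite -/(coord x j) -/(coord y j) !coord_bit // E.
Qed.

Lemma bits_of_surj v : size v = 7%N -> exists x, bits_of x = v.
Proof.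
move=> sv; exists (\row_i of_bit (bit v i)); apply: (@eq_from_nth _ false).
  by rewrite size_bits_of.
move=> i; rewrite size_bits_of => i_lt; rewrite (nth_map 0%N) ?size_iota // nth_iota //.
by rewrite /coord mxE of_bit_eq0 negbK inordK.
Qed.

Lemma bits_ofD x y : bits_of (x + y) = bits_add (bits_of x) (bits_of y).
Proof.
rewrite /bits_add zip_map -map_comp; apply/eq_in_map => i; rewrite mem_iota => /andP [_ i_lt] /=.
rewrite /coord mxE -/(coord x i) -/(coord y i) !coord_bit // of_bitD !of_bit_eq0.
by rewrite !negbK.
Qed.

Lemma all_bits_complete v : size v = 7%N -> v \in all_bits.
Proof.
case: v => [//|b0 [//|b1 [//|b2 [//|b3 [//|b4 [//|b5 [//|b6 [|//]]]]]]]] _.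
by case: b0; case: b1; case: b2; case: b3; case: b4; case: b5; case: b6; vm_compute.
Qed.

Lemma H2_pointE x : H2_point x = bits_point (bits_of x).
Proof.
rewrite /H2_point /bits_point; congr (_ && _).
  rewrite -(inj_eq bits_of_inj).
  have -> : bits_of 0 = nseq 7 false.
    apply: (@eq_from_nth _ false) => [|i]; rewrite size_bits_of ?size_nseq // => i_lt.
    by rewrite nth_nseq i_lt (nth_map 0%N) ?size_iota // nth_iota // /coord mxE eqxx.
  have all_ok : all (fun v => (v != nseq 7 false) == has id v) all_bits by vm_compute.
  by have /eqP := allP all_ok _ (all_bits_complete (size_bits_of x)).
rewrite /quadric !coord_bit // expr2 !of_bitM !of_bitD andbb of_bitB of_bit_eq0.
by [].
Qed.

Lemma grassmannE x y i j : (i < 7)%N -> (j < 7)%N ->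
  grassmann x y i j = of_bit (bits_grassmann (bits_of x) (bits_of y) i j).
Proof. by move=> i_lt j_lt; rewrite /grassmann !coord_bit // !of_bitM of_bitB. Qed.

Lemma H2_lineP (B : {set vec}) :
  reflect (exists x y, bits_line (bits_of x) (bits_of y) /\ B = [set x; y; x + y]) (H2_line B).
Proof.
apply: (iffP existsP) => [[x /existsP [y]]|[x [y [l ->]]]].
  rewrite !H2_pointE bits_ofD !grassmannE // !of_bit_eq.
  case/and5P => xy px py pxy /andP [/eqP -> eqs]; exists x, y; split=> //.
  by rewrite /bits_line (inj_eq bits_of_inj) xy px py pxy.
exists x; apply/existsP; exists y; move: l.
rewrite !H2_pointE bits_ofD !grassmannE // !of_bit_eq eqxx /bits_line (inj_eq bits_of_inj).
by case/and5P => -> -> -> ->.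
Qed.

Definition line_set (i : nat) : {set vec} := [set x | bits_of x \in line_triple i].

Lemma line_set_triple u v x y : bits_of x = u -> bits_of y = v ->
  [set z | bits_of z \in triple u v] = [set x; y; x + y].
Proof.
move=> <- <-; apply/setP => z.
by rewrite !inE -bits_ofD !(inj_eq bits_of_inj) orbA.
Qed.

Lemma line_pair_in i : line_pair i \in line_pairs.
Proof.
case: (ltnP i (size line_pairs)) => [i_lt|i_ge]; first exact: mem_nth.
by rewrite /line_pair nth_default //; vm_compute.
Qed.

Lemma line_set_line i : H2_line (line_set i).
Proof.
have /andP [/andP [_ /allP /(_ _ (line_pair_in i)) /and3P [/eqP s1 /eqP s2 l]] _] := H2_checked.
have [x Ex] := bits_of_surj s1; have [y Ey] := bits_of_surj s2.
apply/H2_lineP; exists x, y; rewrite Ex Ey; split=> //.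
exact: line_set_triple.
Qed.

Lemma line_set_surj (B : {set vec}) : H2_line B -> exists2 i, (i < 63)%N & B = line_set i.
Proof.
case/H2_lineP => x [y [l ->]].
have /andP [/andP [/eqP sz _] /allP covered] := H2_checked.
have pt z : bits_point (bits_of z) -> bits_of z \in bits_points.
  by move=> pz; rewrite mem_filter pz; exact: all_bits_complete (size_bits_of z).
have /and5P [_ px py _ _] := l.
have /allP /(_ _ (pt y py)) := covered _ (pt x px).
rewrite l => /hasP [p pL /andP [/allP sub1 /allP sub2]].
exists (index p line_pairs); first by rewrite -sz index_mem.
rewrite -(line_set_triple (erefl (bits_of x)) (erefl (bits_of y))).
apply/setP => z; rewrite !in_set /line_triple /line_pair (nth_index _ pL).
by apply/idP/idP => [zt|zt]; [exact: sub2 | exact: sub1].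
Qed.

End Vectors.

Definition H2D_point (i : nat) : point H2D := exist _ (line_set i) (line_set_line i).

Lemma H2D_point_surj (b : point H2D) : exists2 i, i < 63 & b = H2D_point i.
Proof. by case: b => B lB; have [i i_lt E] := line_set_surj lB; exists i => //;
  apply: val_inj. Qed.

Lemma H2D_adjacent i j : i < 63 -> j < 63 ->
  (st i j == 1) = (i != j) && has (mem (line_triple j)) (line_triple i) /\
  (i != j -> ~~ all (mem (line_triple j)) (line_triple i)).
Proof.
move=> i_lt j_lt; have /allP /(_ i) := H2D_checked; rewrite mem_iota i_lt => /(_ isT).
move=> /allP /(_ j); rewrite mem_iota j_lt => /(_ isT) /andP [/eqP -> ne]; split=> //.
by case/orP: ne => [/eqP -> /eqP|].
Qed.

Lemma line_triple_size i v : v \in line_triple i -> size v = 7 /\ bits_point v.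
Proof.
have /andP [/andP [_ /allP /(_ _ (line_pair_in i)) /and3P [/eqP s1 /eqP s2 l]] _] := H2_checked.
have /and5P [_ p1 p2 p3 _] := l.
by rewrite !inE => /or3P [] /eqP -> //; split=> //; rewrite size_map size_zip s1 s2.
Qed.

Lemma H2D_point_inj i j : i < 63 -> j < 63 -> H2D_point i = H2D_point j -> i = j.
Proof.
move=> i_lt j_lt /(congr1 val) /= E; apply/eqP; apply: contraT => ij.
have [_ /(_ ij) /allPn [v vi]] := H2D_adjacent i_lt j_lt.
have [sv _] := line_triple_size vi; have [x Ex] := bits_of_surj sv.
have : x \in line_set i by rewrite inE Ex.
by rewrite E inE Ex /= => ->.
Qed.

Lemma H2D_collinear i j : i < 63 -> j < 63 ->
  collinear (H2D_point i) (H2D_point j) <-> st i j = 1.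
Proof.
move=> i_lt j_lt; have [adj _] := H2D_adjacent i_lt j_lt; split.
  case=> ne [[x px] [xi xj]]; apply/eqP; rewrite adj; apply/andP; split.
    by apply: contra_not_neq ne => ->.
  by apply/hasP; exists (bits_of x); move: xi xj; rewrite /= !inE.
move/eqP; rewrite adj => /andP [ij /hasP [v vi vj]].
split; first by move=> /(H2D_point_inj i_lt j_lt) /eqP; rewrite (negbTE ij).
have [sv pv] := line_triple_size vi; have [x Ex] := bits_of_surj sv.
have px : H2_point x by rewrite H2_pointE Ex.
by exists (exist _ x px); split; rewrite /= in_set Ex.
Qed.

Lemma isomorphic_collinear (S T : geometry) (f : point S -> point T) (g : line S -> line T) :
  bijective f -> bijective g -> (forall x L, inc x L <-> inc (f x) (g L)) ->
  forall x y, collinear x y <-> collinear (f x) (f y).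
Proof.
move=> /bij_inj f_inj [g' gK g'K] fg x y; split=> [[xy [L [xL yL]]]|[xy [M [xM yM]]]].
  by split=> [/f_inj //|]; exists (g L); split; apply/fg.
by split=> [E|]; [apply: xy; rewrite E | exists (g' M); split; apply/fg; rewrite g'K].
Qed.

(** Descending along hexagon edges gives a walk of length [st i j], and no walk is shorter because
    an edge lowers [st] by at most one. *)
Lemma is_dist_hexagon (S : geometry) (q : nat -> point S) :
  (forall x, exists2 i, i < 63 & x = q i) ->
  (forall i j, i < 63 -> j < 63 -> q i = q j -> i = j) ->
  (forall i j, i < 63 -> j < 63 -> collinear (q i) (q j) <-> st i j = 1) ->
  forall i j, i < 63 -> j < 63 -> is_dist (q i) (q j) (st i j).
Proof.
move=> q_surj q_inj q_col.
have hexagon i j : i < 63 -> j < 63 ->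
    (forall r, r \in nb i -> st i j <= (st r j).+1) /\
    (st i j = 0 \/ exists r, [/\ r \in nb i, r < 63 & (st r j).+1 = st i j]).
  move=> i_lt j_lt; have /allP /(_ i) := hexagon_checked.
  rewrite mem_iota i_lt => /(_ isT) /and5P [_ _ _ _ /allP /(_ j)].
  rewrite mem_iota j_lt => /(_ isT) /and5P [_ _ _ /allP le ex]; split=> //.
  by case/orP: ex => [/eqP|/hasP [r ri /andP [r_lt /eqP E]]]; [left | right; exists r].
have col_nb i j : i < 63 -> j < 63 -> (j \in nb i) = (st i j == 1).
  by move=> i_lt j_lt; have [_ _ _ ->] := hexagon_spec i_lt j_lt.
move=> i j i_lt j_lt; split.
  move: {2}(st i j) (erefl (st i j)) => n; elim: n i i_lt => [|n IH] i i_lt E; rewrite E.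
    have [_ _ + _] := hexagon_spec i_lt j_lt; rewrite E eqxx => /esym/eqP ->.
    exact: walk0.
  have [_ [E0|[r [ri r_lt Er]]]] := hexagon i j i_lt j_lt; first by rewrite E0 in E.
  have Ern : st r j = n by move: Er; rewrite E => -[].
  apply: (walkS (y := q r)); last by rewrite -[n]Ern; apply: IH.
  by apply/q_col => //; apply/eqP; rewrite -col_nb.
move=> n w; have [x Ex] : exists x, x = q i by exists (q i).
have [y Ey] : exists y, y = q j by exists (q j).
rewrite -Ex -Ey in w; elim: w i i_lt Ex Ey => [u|k u v z uv _ IH] i i_lt Ex Ey.
  rewrite Ex in Ey; rewrite (q_inj _ _ i_lt j_lt Ey).
  by have [-> _ _ _] := hexagon_spec j_lt j_lt.
have [r r_lt Er] := q_surj v; have [le _] := hexagon i j i_lt j_lt.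
apply: leq_trans (le r _) _; last by rewrite ltnS; apply: IH.
by rewrite col_nb //; apply/eqP/q_col => //; rewrite -Ex -Er.
Qed.

Lemma embedding_exists (N : geometry) (N_near : near_polygon 4 N)
    (A : point N -> Prop) (B : line N -> Prop) :
  isomorphic (subgeometry A B) H2D -> isometrically_embedded A B ->
  exists h : nat -> point N, embedding h.
Proof.
case=> f [g [f_bij g_bij fg]] iso; have [f' fK f'K] := f_bij.
exists (fun i => sval (f' (H2D_point i))) => i j i_lt j_lt.
apply: (dist_eq N_near); apply/iso.
apply: (is_dist_hexagon (q := fun i => f' (H2D_point i))) => //.
- by move=> x; have [k k_lt E] := H2D_point_surj (f x); exists k => //; rewrite -E fK.
- by move=> k l k_lt l_lt /(can_inj f'K); exact: H2D_point_inj.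
move=> k l k_lt l_lt; rewrite -(H2D_collinear k_lt l_lt).
by rewrite (isomorphic_collinear f_bij g_bij fg) !f'K.
Qed.

(** * Central involutions of the Hall-Janko group *)

(** Strong generators as words in [a] and [b]: all four, the first three and the first two serve the
    base points 3, 89 and 1. *)
Definition chain_generator_list : seq (tree * tree) := map word_pair
  [:: [:: 1; 2; 1; 2; 1; 1; 2; 1; 2; 1; 2; 2];
      [:: 2; 1; 2; 2; 1; 2; 1; 2; 2; 1; 1; 2; 1; 1; 1; 2; 2; 1; 2; 2; 1; 2; 2; 2];
      [:: 1; 1; 2; 2; 1; 2; 2; 1; 2; 2; 2];
      [:: 1; 2; 1; 1; 1]].

Definition chain_generators := locked chain_generator_list.

Lemma chain_generatorsE : chain_generators = chain_generator_list.
Proof. by rewrite /chain_generators -lock. Qed.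

Definition transversal (c : positive) (S : seq (tree * tree)) : seq (tree * tree) :=
  explore (fun u v => Pos.eqb (get u.1 c) (get v.1 c))
    (fun u => [seq (tree_comp u.1 s.1, tree_comp s.2 u.2) | s <- S]) 101 [:: (tree_1, tree_1)]
    [:: (tree_1, tree_1)].

(** At each level the transversal element with the same image of the base point is divided out;
    ending at the identity certifies membership. *)
Fixpoint sift (chain : seq (positive * seq (tree * tree))) (g : tree) : bool :=
  if chain is (c, U) :: chain' then
    (fix try (V : seq (tree * tree)) : bool :=
       if V is u :: V' then
         if Pos.eqb (get u.1 c) (get g c) then sift chain' (tree_comp g u.2) else try V'
       else false) U
  else eqt g tree_1.

(** The first division of the product of [u] and [s] leaves a Schreier generator, which has to sift
    through the lower chain. *)
Definition level_check (c : positive) (S : seq (tree * tree)) chain (n : nat) : bool :=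
  let U := transversal c S in
  [&& size U == n, has (fun u => eqt tree_1 u.1) U &
    all (fun u => all (fun s => sift ((c, U) :: chain) (tree_comp u.1 s.1)) S) U].

Definition ab_pairs := [:: (tree_a, tree_a); (tree_b, tree_b2)].

Definition chain4 := [:: (enc 1, transversal (enc 1) (take 2 chain_generators))].
Definition chain3 := (enc 89, transversal (enc 89) (take 3 chain_generators)) :: chain4.
Definition chain2 := (enc 3, transversal (enc 3) chain_generators) :: chain3.

Definition chain_check : bool :=
  [&& level_check (enc 1) (take 2 chain_generators) [::] 8,
      level_check (enc 89) (take 3 chain_generators) chain4 21,
      level_check (enc 3) chain_generators chain3 36 &
      level_check (enc 0) ab_pairs chain2 100].

Definition P_generators : seq (tree * tree) := map word_pair
  [:: [:: 1; 1; 1; 1; 2; 1; 2; 1; 1; 2; 1];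
      [:: 1; 1; 2; 2; 1; 2; 1; 2; 1; 2; 2; 1];
      [:: 1; 2; 1; 2; 1; 2]].

Definition P_list : seq tree :=
  explore eqt (fun s => [seq tree_comp s g.1 | g <- P_generators]) 129 [:: tree_1] [:: tree_1].

Definition P_elements : seq tree := locked P_list.

Lemma P_elementsE : P_elements = P_list.
Proof. by rewrite /P_elements -lock. Qed.

Fixpoint uniq_trees (l : seq tree) : bool :=
  if l is s :: l' then if memt eqt s l' then false else uniq_trees l' else true.

Definition sylow_check : bool :=
  [&& size P_elements == 128, uniq_trees P_elements,
      all (fun s => all (fun g => memt eqt (tree_comp s g.1) P_elements) P_generators) P_elements,
      memt eqt tree_1 P_elements &
      memt eqt zt P_elements] &&
      (all (fun g => eqt (tree_comp g.1 zt) (tree_comp zt g.1)) P_generators &&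
      all (fun s => if eqt s tree_1 then true else if eqt s zt then true
                    else ~~ all (fun g => tree_commute s g.1) P_generators) P_elements).

(** This is [(abab^2)^4], of order 3; it commutes with [zt], which is another power of [abab^2]. *)
Definition word3 := word_pair [:: 1; 2; 1; 2; 1; 2; 1; 2].
Definition word5 := word_pair [:: 1; 1; 2; 1; 1; 2; 1; 2; 1; 1; 2; 2].

Definition centralizer_check : bool :=
  [&& eqt (tree_comp word3.1 zt) (tree_comp zt word3.1),
    eqt (tree_comp word3.1 (tree_comp word3.1 word3.1)) tree_1,
      ~~ eqt word3.1 tree_1 & eqt (tree_comp zt zt) tree_1] &&
  [&& ~~ eqt zt tree_1, eqt (tree_comp word5.1 zt) (tree_comp zt word5.1),
      eqt (tree_comp word5.1 (tree_comp word5.1 (tree_comp word5.1 (tree_comp word5.1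
        word5.1)))) tree_1
      & ~~ eqt word5.1 tree_1].

Definition class_check : bool :=
  [&& size zclass == 315, uniq_trees invol, perm_eq zorder (iota 0 315) &
      all (fun s => if memt eqt (tree_comp (tree_comp tree_a s) tree_a) zclass then
                      memt eqt (tree_comp (tree_comp tree_b2 s) tree_b) zclass else false)
                        zclass].

Definition numbered_invol : seq (nat * tree) := zip (iota 0 315) invol.

Definition commutation_check : bool :=
  all (fun js => all (fun kt => if tree_commute js.2 kt.2 then kt.1 \in nb js.1 else true)
                   (drop js.1.+1 numbered_invol)) numbered_invol.

Definition product_check : bool :=
  all (fun js => all (fun p : nat * nat => if js.1 < p.1 < p.2 then
         eqt (tree_comp js.2 (nth tree_1 invol p.1)) (nth tree_1 invol p.2) else true) (pairs
           js.1))
    numbered_invol.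

(* Base points 0, 3, 89, 1, with basic orbits of lengths 100, 36, 21, 8. *)
Lemma chain_checked : chain_check.
Proof.
cbv delta [chain_check chain2 chain3 chain4]; rewrite chain_generatorsE.
vm_cast_no_check (erefl true).
Qed.

Lemma sylow_checked : sylow_check.
Proof. by rewrite /sylow_check P_elementsE; vm_cast_no_check (erefl true). Qed.

Lemma centralizer_checked : centralizer_check.
Proof. vm_cast_no_check (erefl true). Qed.

Lemma class_checked : class_check.
Proof.
by cbv delta [class_check invol]; rewrite zclassE; vm_cast_no_check (erefl true).
Qed.

Lemma commutation_checked : commutation_check.
Proof.
cbv delta [commutation_check numbered_invol nb pairs invol]; rewrite hj_pairsE zclassE.
vm_cast_no_check (erefl true).
Qed.

Lemma product_checked : product_check.
Proof.
cbv delta [product_check numbered_invol pairs invol]; rewrite hj_pairsE zclassE.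
vm_cast_no_check (erefl true).
Qed.

(** * Trees as permutations *)

Lemma eqtE s t : eqt s t = true -> s = t.
Proof.
elim: s t => [x|l IHl r IHr] [y|l' r'] //=; first by move/Pos.eqb_eq ->.
by case E: (eqt l l') => // /IHr ->; rewrite (IHl _ E).
Qed.

Lemma eqt_refl s : eqt s s.
Proof. by elim: s => [x|l IHl r IHr] /=; [exact: Pos.eqb_refl | rewrite IHl]. Qed.

Lemma memtP s l : reflect (List.In s l) (memt eqt s l).
Proof.
elim: l => [|t l IH] /=; first by constructor.
case E: (eqt s t); first by constructor; left; rewrite (eqtE E).
apply: (iffP IH) => [|[ts|//]]; first by right.
by rewrite ts eqt_refl in E.
Qed.

Fixpoint has_depth (d : nat) (p : positive) : bool :=
  match d, p with
  | 0, xH => true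
  | d'.+1, xO q | d'.+1, xI q => has_depth d' q
  | _, _ => false
  end.

Lemma get_build d f p : has_depth d p -> get (build d f) p = f p.
Proof. by elim: d f p => [|d IH] f [p|p|] //= dp; rewrite IH. Qed.

Lemma build_ext d f g : (forall p, has_depth d p -> f p = g p) -> build d f = build d g.
Proof.
elim: d f g => [|d IH] f g fg /=; first by rewrite fg.
by congr Br; apply: IH => p dp; apply: fg.
Qed.

Lemma tmap_build d f g : tmap f (build d g) = build d (fun p => f (g p)).
Proof. by elim: d g => [|d IH] g //=; rewrite !IH. Qed.

Lemma vertex_code_enc i : i < 100 ->
  [/\ has_depth 7 (enc i), vertex_code (enc i) & dec (enc i) = i].
Proof.
move=> i_lt; rewrite /vertex_code /dec /enc Nat2Pos.id //; split; last by lia.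
  have sub : all (fun i => has_depth 7 (enc i)) (iota 0 100) by vm_compute.
  by move/allP: sub => /(_ i); rewrite mem_iota i_lt => /(_ isT).
by lia.
Qed.

Lemma vertex_code_dec p : vertex_code p -> dec p < 100 /\ enc (dec p) = p.
Proof.
rewrite /vertex_code /dec /enc => /andP [ge lt]; split; first lia.
by rewrite subnKC // Pos2Nat.id.
Qed.

Section HallJankoGroup.

Local Open Scope group_scope.
Implicit Types g h x y : {perm 'I_100}.

Definition code_act g (p : positive) : positive :=
  if vertex_code p then enc (g (inord (dec p))) else p.

Definition perm_tree g : tree := locked (build 7 (code_act g)).

Lemma perm_treeE g : perm_tree g = build 7 (code_act g).
Proof. by rewrite /perm_tree -lock. Qed.

Lemma code_act_enc g (i : 'I_100) : code_act g (enc i) = enc (g i).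
Proof. by have [_ vi di] := vertex_code_enc (ltn_ord i); rewrite /code_act vi di inord_val. Qed.

Lemma code_actM g h p : code_act (g * h) p = code_act h (code_act g p).
Proof.
case vp: (vertex_code p); last by rewrite /code_act !vp.
by rewrite {3}/code_act vp code_act_enc /code_act vp permM.
Qed.

Lemma perm_treeM g h : perm_tree (g * h) = tree_comp (perm_tree g) (perm_tree h).
Proof.
rewrite /tree_comp [perm_tree g]perm_treeE tmap_build perm_treeE; apply: build_ext => p dp.
rewrite code_actM perm_treeE get_build // /code_act; case: ifP => // _.
by have [] := vertex_code_enc (ltn_ord (g (inord (dec p)))).
Qed.

Lemma perm_tree1 : perm_tree 1 = tree_1.
Proof.
have -> : tree_1 = tree_of id by vm_compute.
rewrite perm_treeE; apply: build_ext => p _; rewrite /code_act;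
  case: ifP => // /vertex_code_dec [p_lt _].
by rewrite perm1 inordK.
Qed.

Lemma perm_tree_table s (ps : perm_eq s (iota 0 100)) :
  perm_tree (table_perm ps) = tree_of (nth 0 s).
Proof.
rewrite perm_treeE; apply: build_ext => p _; rewrite /code_act;
  case: ifP => // /vertex_code_dec [p_lt _].
rewrite permE /table_fun inordK ?inordK //.
have : nth 0 s (dec p) \in s by rewrite mem_nth // (perm_size ps) size_iota.
by rewrite (perm_mem ps) mem_iota.
Qed.

Lemma perm_tree_inj : injective perm_tree.
Proof.
move=> g h E; apply/permP => i.
have [di vi _] := vertex_code_enc (ltn_ord i).
have : get (perm_tree g) (enc i) = get (perm_tree h) (enc i) by rewrite E.
rewrite !perm_treeE !get_build // !code_act_enc => /(congr1 dec).
have [_ _ ->] := vertex_code_enc (ltn_ord (g i)).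
have [_ _ ->] := vertex_code_enc (ltn_ord (h i)).
exact: val_inj.
Qed.

Lemma commute_at_build s t d (f f' : positive -> positive) :
  (forall p, has_depth d p -> get t (f p) = get s (f' p)) ->
  commute_at s t (build d f) (build d f').
Proof.
elim: d f f' => [|d IH] f f' E /=; first by rewrite E // Pos.eqb_refl.
by rewrite !IH // => p dp; apply: E.
Qed.

Lemma tree_commute_perm g h : commute g h -> tree_commute (perm_tree g) (perm_tree h).
Proof.
move=> gh; rewrite /tree_commute !perm_treeE; apply: commute_at_build => p dp.
have code_depth x : has_depth 7 (code_act x p).
  rewrite /code_act; case: ifP => // _.
  by have [] := vertex_code_enc (ltn_ord (x (inord (dec p)))).
by rewrite !get_build // -!code_actM gh.
Qed.

Definition represents (A : {set {perm 'I_100}}) (u : tree * tree) : Prop :=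
  exists2 g, g \in A & u = (perm_tree g, perm_tree g^-1).

Lemma representsM (G : {group {perm 'I_100}}) u v :
  represents G u -> represents G v -> represents G (tree_comp u.1 v.1, tree_comp v.2 u.2).
Proof.
case=> g gG -> [h hG ->]; exists (g * h); rewrite ?groupM //=.
by rewrite invMg !perm_treeM.
Qed.

Definition gen_a : {perm 'I_100} := table_perm J2_table_a_perm.
Definition gen_b : {perm 'I_100} := table_perm J2_table_b_perm.

Lemma perm_tree_a : perm_tree gen_a = tree_a.
Proof. by rewrite perm_tree_table; vm_compute. Qed.

Lemma perm_tree_b : perm_tree gen_b = tree_b.
Proof. by rewrite perm_tree_table; vm_compute. Qed.

Lemma gen_aV : gen_a^-1 = gen_a.
Proof.
apply/eqP; rewrite eq_invg_mul; apply/eqP/perm_tree_inj.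
by rewrite perm_treeM perm_tree1 perm_tree_a; vm_compute.
Qed.

Lemma gen_bV : gen_b^-1 = gen_b * gen_b.
Proof.
apply/eqP; rewrite eq_invg_mul; apply/eqP/perm_tree_inj.
by rewrite !perm_treeM perm_tree1 perm_tree_b; vm_compute.
Qed.

Lemma gen_a_J2 : gen_a \in J2.
Proof. by apply: mem_gen; rewrite !inE eqxx. Qed.

Lemma gen_b_J2 : gen_b \in J2.
Proof. by apply: mem_gen; rewrite !inE eqxx orbT. Qed.

Lemma represents_a : represents J2 (tree_a, tree_a).
Proof. by exists gen_a; rewrite ?gen_a_J2 // gen_aV perm_tree_a. Qed.

Lemma represents_b : represents J2 (tree_b, tree_b2).
Proof.
exists gen_b; rewrite ?gen_b_J2 // gen_bV perm_treeM perm_tree_b.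
by congr pair; vm_compute.
Qed.

Lemma represents1 (G : {group {perm 'I_100}}) : represents G (tree_1, tree_1).
Proof. by exists 1; rewrite ?group1 // invg1 perm_tree1. Qed.

Lemma represents_inv (G : {group {perm 'I_100}}) u : represents G u -> represents G (u.2, u.1).
Proof. by case=> g gG ->; exists g^-1; rewrite ?groupV // invgK. Qed.

Lemma represents_word w : represents J2 (word_pair w).
Proof.
rewrite /word_pair; elim: w (tree_1, tree_1) (represents1 J2) => // e w IH s Rs.
apply: IH; have Rb : represents J2 (if e == 1%N then (tree_b, tree_b2) else (tree_b2, tree_b)).
  by case: (e == 1%N); [exact: represents_b | exact: represents_inv represents_b].
have := representsM (representsM Rs represents_a) Rb.
by case: (if _ then _ else _) => c d /=.
Qed.

Lemma card_represented (A : {set {perm 'I_100}}) (l : seq tree) : uniq_trees l ->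
  List.Forall (fun t => exists2 g, g \in A & perm_tree g = t) l ->
  (forall g, g \in A -> memt eqt (perm_tree g) l) -> #|A| = size l.
Proof.
elim: l A => [|t l IH] A /= ul Al Ag.
  by apply/eqP; rewrite cards_eq0; apply/eqP/setP => g; rewrite inE; apply/negP => /Ag.
inversion Al as [|? ? [g gA gt] Al']; subst.
move: ul; case: memtP => // gl ul.
rewrite (cardsD1 g) gA (IH (A :\ g)) //.
- elim: l Al' gl {IH ul Al Ag} => // s l IHl Al' gl; inversion Al' as [|? ? [h hA hs] Al''];
  subst.
  constructor; last by apply: IHl => // gl'; apply: gl; right.
  exists h => //; rewrite !inE hA andbT; apply/eqP => hg.
  by apply: gl; left; rewrite hg.
move=> h; rewrite !inE => /andP [hg hA]; have /= := Ag h hA.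
case E: (eqt _ _) => //; move: (eqtE E) => /perm_tree_inj hg'.
by rewrite hg' eqxx in hg.
Qed.

Lemma right_closed (A X : {set {perm 'I_100}}) : 1 \in X ->
  (forall x s, x \in X -> s \in A -> x * s \in X) -> <<A>> \subset X.
Proof.
move=> X1 XA; apply/subsetP => x /gen_prodgP [n [c cA ->]].
elim: n c cA => [|n IH] c cA; first by rewrite big_ord0.
by rewrite big_ord_recr /=; apply: XA => //; apply: IH => i; exact: cA.
Qed.

(** * An upper bound for the order of the group from the stabilizer chain *)

Definition permutations_of (S : seq (tree * tree)) : {set {perm 'I_100}} :=
  [set g | has (fun s : tree * tree => eqt (perm_tree g) s.1) S].

Definition all_represented (A : {set {perm 'I_100}}) (S : seq (tree * tree)) : Prop :=
  List.Forall (represents A) S.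

Lemma represents_sub (A B : {set {perm 'I_100}}) u :
  A \subset B -> represents A u -> represents B u.
Proof. by move=> /subsetP AB [g gA ->]; exists g => //; exact: AB. Qed.

Lemma all_represented_sub (A B : {set {perm 'I_100}}) S :
  A \subset B -> all_represented A S -> all_represented B S.
Proof. by move=> AB; apply: List.Forall_impl => u; exact: represents_sub. Qed.

Lemma all_represented_gen (A : {set {perm 'I_100}}) S :
  all_represented A S -> all_represented <<permutations_of S>> S.
Proof.
move=> /List.Forall_forall AS; apply/List.Forall_forall => s sS.
have [g gA gs] := AS s sS; exists g => //; apply: mem_gen; rewrite inE.
elim: S sS {AS} => //= t S IH [->|/IH ->]; last by rewrite orbT.
by rewrite gs eqt_refl.
Qed.

Lemma permutations_ofP S g : g \in permutations_of S -> exists2 s,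
  List.In s S & perm_tree g = s.1.
Proof.
rewrite inE; elim: S => //= s S IH /orP [/eqtE E|/IH [t tS E]].
  by exists s => //; left.
by exists t => //; right.
Qed.

Lemma transversal_represented (G : {group {perm 'I_100}}) c S :
  all_represented G S -> all_represented G (transversal c S).
Proof.
move=> GS; apply: explore_ind; try by constructor; [exact: represents1 | constructor].
move=> u Gu; elim: S GS => [|s S IH] GS /=; first by constructor.
inversion GS; subst; constructor; last exact: IH.
exact: representsM.
Qed.

Definition chain_in (G : {set {perm 'I_100}}) (chain : seq (positive * seq (tree * tree))) :
  Prop :=
  List.Forall (fun cU => all_represented G cU.2) chain.

Lemma sift_sound (G : {group {perm 'I_100}}) chain g :
  chain_in G chain -> sift chain (perm_tree g) = true -> g \in G.
Proof.
elim: chain g => [|[c U] chain IH] g.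
  by move=> _ /eqtE; rewrite -perm_tree1 => /perm_tree_inj ->.
move=> ch; inversion ch as [|? ? GU ch']; subst; rewrite /sift -/sift.
simpl in GU; elim: U GU {ch} => // u U IHU GU; inversion GU as [|? ? [h hG Eu] GU']; subst.
case: (Pos.eqb _ _); last exact: IHU.
rewrite -perm_treeM => /(IH _ ch').
by rewrite groupMr // groupV.
Qed.

Lemma sift_first (G A : {group {perm 'I_100}}) c U chain g : all_represented A U -> chain_in G
  chain ->
  sift ((c, U) :: chain) (perm_tree g) = true ->
  exists2 h, h \in G & exists2 u, List.In u U & perm_tree (h^-1 * g) = u.1.
Proof.
move=> + ch; rewrite /sift -/sift.
elim: U => // u U IH AU; inversion AU as [|? ? [v vA Eu] AU']; subst.
case: (Pos.eqb _ _) => [|/(IH AU') [h hG [w wU E]]]; last first.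
  by exists h => //; exists w => //; right.
rewrite -perm_treeM => /(sift_sound ch) gv.
exists (g * v^-1) => //; exists (perm_tree v, perm_tree v^-1); first by left.
by rewrite invMg invgK mulgKV.
Qed.

Lemma all_In (T : Type) (a : pred T) (l : seq T) (x : T) : all a l -> List.In x l -> a x.
Proof. by elim: l => //= u l IH /andP [au al] [<- //|]; exact: IH. Qed.

Lemma has_In (T : Type) (a : pred T) (l : seq T) : has a l -> exists2 x : T, List.In x l & a x.
Proof.
elim: l => //= u l IH /orP [au|/IH [v vl av]]; first by exists u => //; left.
by exists v => //; right.
Qed.

Lemma In_permutations_of S g s : List.In s S -> perm_tree g = s.1 -> g \in permutations_of S.
Proof.
move=> + gs; rewrite inE; elim: S => //= t S IH [->|/IH ->]; last by rewrite orbT.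
by rewrite gs eqt_refl.
Qed.

Lemma card_permutations_of (A : {set {perm 'I_100}}) S :
  all_represented A S -> #|permutations_of S| <= size S.
Proof.
elim: S => [|s S IH] AS.
  by rewrite leqn0 cards_eq0; apply/eqP/setP => g; rewrite !inE.
inversion AS as [|? ? [v vA Ev] AS']; subst.
have -> : permutations_of ((perm_tree v, perm_tree v^-1) :: S) = v |: permutations_of S.
  apply/setP => g; rewrite !inE /=; congr (_ || _); apply/idP/eqP => [/eqtE /perm_tree_inj //|->].
  exact: eqt_refl.
by rewrite cardsU1; exact: leq_add (leq_b1 _) (IH AS').
Qed.

Lemma card_mulset (A B : {set {perm 'I_100}}) : #|A * B| <= #|A| * #|B|.
Proof.
have -> : A * B = mulg @2: (A, B) by [].
by rewrite -cardsX curry_imset2X leq_imset_card.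
Qed.

(** The product set of [G] and the transversal contains 1 and, since every [u * s] sifts, is closed
    under right multiplication by [S]; hence it contains the generated group. *)
Lemma chain_step (A G : {group {perm 'I_100}}) c S chain n :
  all_represented A S -> chain_in G chain -> level_check c S chain n ->
  #|<<permutations_of S>>| <= #|G| * n.
Proof.
move=> AS ch; rewrite /level_check; have AU := transversal_represented c AS.
move: (transversal c S) AU => U AU /and3P [/eqP <- /has_In [u0 u0U /eqtE E1] closed].
apply: leq_trans (leq_trans (card_mulset G (permutations_of U)) _); last first.
  by rewrite leq_mul2l (card_permutations_of AU) orbT.
apply/subset_leq_card/right_closed.
  apply/mulsgP; exists 1 1; rewrite ?group1 ?mulg1 //.
  by apply: In_permutations_of u0U _; rewrite perm_tree1.
move=> _ s /mulsgP [h u hG /permutations_ofP [u' u'U Eu] ->] /permutations_ofP [s' s'S Es].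
have := all_In (all_In closed u'U) s'S; rewrite -Eu -Es -perm_treeM.
case/(sift_first AU ch) => h2 h2G [w wU Ew].
apply/mulsgP; exists (h * h2) (h2^-1 * (u * s)); rewrite ?groupM //.
  exact: In_permutations_of wU Ew.
by rewrite !mulgA mulgK.
Qed.

Lemma chain_generators_represented : all_represented J2 chain_generators.
Proof.
rewrite chain_generatorsE /chain_generator_list; elim: (X in map _ X) => [|w l IH];
  constructor => //.
exact: represents_word.
Qed.

Lemma all_represented_take (A : {set {perm 'I_100}}) n S :
  all_represented A S -> all_represented A (take n S).
Proof.
elim: S n => [|s S IH] [|n] // AS; try by constructor.
by inversion AS; subst; constructor => //; exact: IH.
Qed.

Lemma permutations_of_take n S : permutations_of (take n S) \subset permutations_of S.
Proof.
apply/subsetP => g; rewrite !inE -{2}(cat_take_drop n S) has_cat => ->; exact: orTb.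
Qed.

Lemma card_J2_le : #|J2| <= 8 * 21 * 36 * 100.
Proof.
have /and4P [c4 c3 c2 c1] := chain_checked.
have R := chain_generators_represented.
have R3 : all_represented J2 (take 3 chain_generators) by exact: all_represented_take.
have R4 : all_represented J2 (take 2 chain_generators) by exact: all_represented_take.
have T4 : chain_in <<permutations_of (take 2 chain_generators)>> chain4.
  constructor; last by constructor.
  exact/transversal_represented/(all_represented_gen R4).
have sub34 : <<permutations_of (take 2 chain_generators)>> \subset <<permutations_of (take 3
  chain_generators)>>.
  apply: genS; rewrite -(take_takel chain_generators (isT : 2 <= 3)).
  exact: permutations_of_take.
have sub23 : <<permutations_of (take 3 chain_generators)>> \subset <<permutations_of
  chain_generators>>.
  by apply: genS; exact: permutations_of_take.
have chain_sub (B C : {set {perm 'I_100}}) ch : B \subset C -> chain_in B ch -> chain_in C ch.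
  by move=> BC; apply: List.Forall_impl => cU; exact: all_represented_sub.
have T3 : chain_in <<permutations_of (take 3 chain_generators)>> chain3.
  constructor; first exact/transversal_represented/(all_represented_gen R3).
  exact: chain_sub sub34 T4.
have T2 : chain_in <<permutations_of chain_generators>> chain2.
  constructor; first exact/transversal_represented/(all_represented_gen R).
  exact: chain_sub sub23 T3.
have ab : all_represented J2 ab_pairs.
  constructor; first exact: represents_a.
  by constructor; [exact: represents_b | constructor].
(* The lowest level lies over the trivial group. *)
have n4 := chain_step (G := [1 {perm 'I_100}]%G) R4 (List.Forall_nil _) c4.
have n3 := chain_step R3 T4 c3; have n2 := chain_step R T3 c2; have n1 := chain_step ab T2 c1.
have J2_sub : J2 \subset <<permutations_of ab_pairs>>.
  rewrite gen_subG; apply/subsetP => g; rewrite !inE => /orP [] /eqP ->; apply: mem_gen.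
    by apply: (In_permutations_of (s := (tree_a, tree_a))); [left | exact: perm_tree_a].
  by apply: (In_permutations_of (s := (tree_b, tree_b2))); [right; left | exact: perm_tree_b].
apply: leq_trans (subset_leq_card J2_sub) _; apply: leq_trans n1 _.
rewrite leq_mul2r /=; apply: leq_trans n2 _; rewrite leq_mul2r /=; apply: leq_trans n3 _.
by rewrite leq_mul2r /=; move: n4; rewrite cards1 mul1n.
Qed.

Lemma J2_word w : exists2 g, g \in J2 & perm_tree g = (word_pair w).1.
Proof. by have [g gJ ->] := represents_word w; exists g. Qed.

(** * The conjugacy class of the involution [z2A] *)

Lemma zt_word : exists g, (g \in J2) && eqt (perm_tree g) zt.
Proof.
have [g gJ E] := J2_word [:: 1; 2; 1; 2; 1; 2; 1; 2; 1; 2; 1; 2]%N.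
by exists g; rewrite gJ E; vm_compute.
Qed.

Definition z2A : {perm 'I_100} := xchoose zt_word.

Lemma z2A_tree : perm_tree z2A = zt.
Proof. by have /andP [_ /eqtE] := xchooseP zt_word. Qed.

Lemma zclass_represented :
  List.Forall (fun t => exists2 g, g \in z2A ^: J2 & perm_tree g = t) zclass.
Proof.
have base : List.Forall (fun t => exists2 g, g \in z2A ^: J2 & perm_tree g = t) [:: zt].
  by constructor; [exists z2A; rewrite ?class_refl ?z2A_tree | constructor].
rewrite zclassE /zclass_list; apply: explore_ind => // t [g /imsetP [k kJ Eg] gt].
constructor; [|constructor; [|by constructor]].
  exists (g ^ gen_a); first by rewrite Eg -conjgM memJ_class ?groupM ?gen_a_J2.
  by rewrite conjgE mulgA gen_aV !perm_treeM perm_tree_a gt.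
exists (g ^ gen_b); first by rewrite Eg -conjgM memJ_class ?groupM ?gen_b_J2.
by rewrite conjgE mulgA gen_bV !perm_treeM perm_tree_b gt; congr (tree_comp (tree_comp _ _) _);
  vm_compute.
Qed.

(** The listed elements are stable under conjugation by both generators, so [J2] normalises their
    set, which contains [z2A]. *)
Lemma zclass_complete x : x \in z2A ^: J2 -> memt eqt (perm_tree x) zclass.
Proof.
pose X := [set x | memt eqt (perm_tree x) zclass].
have /and4P [_ _ _ closed] := class_checked.
have XJ y g : y \in X -> g \in [set gen_a; gen_b] -> y ^ g \in X.
  rewrite !inE => /memtP yX; have := all_In closed yX.
  case: ifP => // aX bX /orP [] /eqP ->; rewrite conjgE mulgA.
    by rewrite gen_aV !perm_treeM perm_tree_a.
  rewrite gen_bV !perm_treeM perm_tree_b (_ : tree_comp tree_b tree_b = tree_b2);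
    last by vm_compute.
  exact: bX.
have /subsetP J2_norm : J2 \subset 'N(X).
  rewrite gen_subG; apply/subsetP => g gab; rewrite inE; apply/subsetP => _ /imsetP [y yX ->].
  exact: XJ.
case/imsetP => g gJ ->; have zX : z2A \in X.
  by rewrite inE z2A_tree zclassE; vm_compute.
by have := J2_norm g gJ; rewrite inE => /subsetP /(_ (z2A ^ g)); rewrite memJ_conjg zX inE; apply.
Qed.

Lemma nth_In (T : Type) (d : T) (l : seq T) i : i < size l -> List.In (nth d l i) l.
Proof. by elim: l i => //= u l IH [|i] i_lt; [left | right; exact: IH]. Qed.

Lemma In_nth (T : Type) (d : T) (l : seq T) (t : T) : List.In t l -> exists2 i,
  i < size l & nth d l i = t.
Proof.
elim: l => //= u l IH [->|/IH [i i_lt <-]]; first by exists 0%N.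
by exists i.+1.
Qed.

Lemma uniq_trees_nth l i j : uniq_trees l -> i < j < size l -> nth tree_1 l i <> nth tree_1 l j.
Proof.
elim: l i j => [i j _ /andP [_] //|t l IH] [|i] [|j] //=; case: (memtP t l) => // tl ul.
  by move=> j_lt E; apply: tl; rewrite E; apply: nth_In.
exact: IH.
Qed.

Lemma zorder_size : size zorder = 315.
Proof. by []. Qed.

Lemma perm_iota_nth (s : seq nat) n j : perm_eq s (iota 0 n) -> j < n -> nth 0%N s j < n.
Proof.
move=> sn j_lt; have : nth 0%N s j \in s by rewrite mem_nth // (perm_size sn) size_iota.
by rewrite (perm_mem sn) mem_iota.
Qed.

Lemma nth_invol j : j < 315 ->
  exists2 i, i < 315 & nth tree_1 invol j = nth tree_1 zclass i.
Proof.
move=> j_lt; have /and4P [_ _ zo _] := class_checked.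
exists (nth 0%N zorder j); first exact: perm_iota_nth zo j_lt.
have j_lt' : j < size zorder by rewrite (perm_size zo) size_iota.
by rewrite /invol (nth_map 0%N tree_1 _ j_lt').
Qed.

Lemma invol_size : size invol = 315.
Proof. by rewrite size_map zorder_size. Qed.

Lemma invol_represented j : j < 315 ->
  exists2 x, x \in z2A ^: J2 & perm_tree x = nth tree_1 invol j.
Proof.
move=> /nth_invol [i i_lt ->]; have /and4P [/eqP sz _ _ _] := class_checked.
have /List.Forall_forall := zclass_represented; apply.
by apply: nth_In; rewrite sz.
Qed.

Lemma invol_complete x : x \in z2A ^: J2 ->
  exists2 j, j < 315 & perm_tree x = nth tree_1 invol j.
Proof.
move=> /zclass_complete /memtP /(In_nth tree_1) [i i_lt <-].
have /and4P [/eqP sz _ zo _] := class_checked; rewrite sz in i_lt.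
have i_zo : i \in zorder by rewrite (perm_mem zo) mem_iota.
exists (index i zorder); first by rewrite -[X in _ < X]zorder_size index_mem.
have i_lt' : index i zorder < size zorder by rewrite index_mem.
by rewrite /invol (nth_map 0%N tree_1 _ i_lt') (nth_index 0%N i_zo).
Qed.

Lemma card_class_z2A : #|z2A ^: J2| = 315%N.
Proof.
have /and4P [_ ui _ _] := class_checked.
rewrite -invol_size; apply: card_represented => //.
  apply/List.Forall_forall => t /(In_nth tree_1) [j]; rewrite invol_size => j_lt <-.
  exact: invol_represented.
move=> g /invol_complete [j j_lt ->]; apply/memtP/nth_In; by rewrite invol_size.
Qed.

(** * A Sylow 2-subgroup, its centre and the central involutions *)

Definition sylow2 : {group {perm 'I_100}} := <<permutations_of P_generators>>%G.

Lemma P_generators_J2 : all_represented J2 P_generators.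
Proof.
rewrite /P_generators; elim: (X in map _ X) => [|w l IH]; constructor => //.
exact: represents_word.
Qed.

Lemma permutations_of_sub (A : {set {perm 'I_100}}) S :
  all_represented A S -> permutations_of S \subset A.
Proof.
move=> /List.Forall_forall AS; apply/subsetP => g /permutations_ofP [s /AS [v vA ->]].
by move/perm_tree_inj ->.
Qed.

Lemma sylow2_sub_J2 : sylow2 \subset J2.
Proof. by rewrite gen_subG; exact: permutations_of_sub P_generators_J2. Qed.

Lemma P_elements_represented :
  List.Forall (fun t => exists2 g, g \in sylow2 & perm_tree g = t) P_elements.
Proof.
have base : List.Forall (fun t => exists2 g, g \in sylow2 & perm_tree g = t) [:: tree_1].
  by constructor; [exists 1; rewrite ?group1 ?perm_tree1 | constructor].
rewrite P_elementsE /P_list; apply: explore_ind => // t [g gP gt].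
have : all_represented sylow2 P_generators := all_represented_gen P_generators_J2.
move: (sylow2 : {group _}) gP => Q gQ.
elim: P_generators => [|s S IH] PS; first by constructor.
inversion PS as [|? ? [v vQ Ev] PS']; subst; constructor; last exact: IH.
by exists (g * v); [exact: groupM | rewrite perm_treeM].
Qed.

Lemma P_elements_complete x : x \in sylow2 -> memt eqt (perm_tree x) P_elements.
Proof.
have /andP [/and5P [_ _ closed one _] _] := sylow_checked.
pose X := [set x | memt eqt (perm_tree x) P_elements].
suff /subsetP sub : sylow2 \subset X by move=> /sub; rewrite inE.
apply: right_closed; first by rewrite inE perm_tree1.
move=> y s; rewrite !inE => /memtP yX /has_In [u uP /eqtE E].
by rewrite perm_treeM E; exact: all_In (all_In closed yX) uP.
Qed.

Lemma card_P : #|sylow2| = 128%N.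
Proof.
have /andP [/and5P [/eqP <- uP _ _ _] _] := sylow_checked.
by apply: card_represented => //; [exact: P_elements_represented | exact: P_elements_complete].
Qed.

Lemma z2A_P : z2A \in sylow2.
Proof.
have /andP [/and5P [_ _ _ _ /memtP zP] _] := sylow_checked.
have /List.Forall_forall := P_elements_represented; move=> /(_ _ zP) [g gP].
by rewrite -z2A_tree => /perm_tree_inj <-.
Qed.

Lemma z2A_center : z2A \in 'Z(sylow2).
Proof.
have /andP [_ /andP [comm _]] := sylow_checked.
rewrite inE z2A_P -sub_cent1 gen_subG; apply/subsetP => g /permutations_ofP [u uP Eu].
apply/cent1P; apply: perm_tree_inj; rewrite !perm_treeM Eu z2A_tree.
by have /eqtE := all_In comm uP.
Qed.

Lemma center_P x : x \in 'Z(sylow2) -> x != 1 -> x = z2A.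
Proof.
have /andP [_ /andP [_ only]] := sylow_checked.
case/setIP => xP xC x1; have /memtP xE := P_elements_complete xP.
have := all_In only xE; case: ifP => [/eqtE|_].
  by rewrite -perm_tree1 => /perm_tree_inj E; rewrite E eqxx in x1.
case: ifP => [/eqtE|_ /negP []]; first by rewrite -z2A_tree => /perm_tree_inj.
have : List.Forall (represents sylow2) P_generators := all_represented_gen P_generators_J2.
elim: P_generators => //= s S IH PS; inversion PS as [|? ? [v vP ->] PS']; subst.
rewrite IH // andbT; apply: tree_commute_perm.
exact: (centP xC).
Qed.

Lemma z2A_order : #[z2A] = 2%N.
Proof.
have /andP [/and4P [_ _ _ /eqtE z1] /andP [nz _]] := centralizer_checked.
apply: nt_prime_order; first by [].
  by apply: perm_tree_inj; rewrite expgS expg1 perm_treeM perm_tree1 z2A_tree.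
by apply/eqP => E; rewrite -z2A_tree E perm_tree1 eqt_refl in nz.
Qed.

Lemma centralizer3 : 3 %| #|'C_J2[z2A]|.
Proof.
have /andP [/and4P [/eqtE cz /eqtE c3 c1 _] _] := centralizer_checked.
have [c cJ Ec] := J2_word [:: 1; 2; 1; 2; 1; 2; 1; 2]%N; rewrite -/word3 in Ec.
have oc : #[c] = 3%N.
  apply: nt_prime_order; first by [].
    by apply: perm_tree_inj; rewrite !expgS expg0 mulg1 !perm_treeM perm_tree1 Ec.
  by apply/eqP => E; rewrite -Ec E perm_tree1 eqt_refl in c1.
suff /order_dvdG : c \in 'C_J2[z2A] by rewrite oc.
rewrite inE cJ; apply/cent1P; apply: perm_tree_inj.
by rewrite !perm_treeM Ec z2A_tree.
Qed.

Lemma centralizer5 : 5 %| #|'C_J2[z2A]|.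
Proof.
have /andP [_ /and4P [_ /eqtE cz /eqtE c5 c1]] := centralizer_checked.
have [c cJ Ec] := J2_word [:: 1; 1; 2; 1; 1; 2; 1; 2; 1; 1; 2; 2]%N; rewrite -/word5 in Ec.
have oc : #[c] = 5%N.
  apply: nt_prime_order; first by [].
    by apply: perm_tree_inj; rewrite !expgS expg0 mulg1 !perm_treeM perm_tree1 Ec.
  by apply/eqP => E; rewrite -Ec E perm_tree1 eqt_refl in c1.
suff /order_dvdG : c \in 'C_J2[z2A] by rewrite oc.
rewrite inE cJ; apply/cent1P; apply: perm_tree_inj.
by rewrite !perm_treeM Ec z2A_tree.
Qed.

Lemma sylow2_sub_centralizer : sylow2 \subset 'C_J2[z2A].
Proof. by rewrite subsetI sylow2_sub_J2 sub_cent1; have /setIP [] := z2A_center. Qed.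

Lemma J2_Lagrange : (#|'C_J2[z2A]| * 315 = #|J2|)%N.
Proof. by rewrite -card_class_z2A -index_cent1 Lagrange // subsetIl. Qed.

(** The order is divisible by 128, 3 and 5, hence by 1920; the bound 604800 = 315 * 1920 on the
    order of [J2] excludes larger multiples. *)
Lemma card_centralizer : #|'C_J2[z2A]| = (128 * 15)%N.
Proof.
have d128 := cardSg sylow2_sub_centralizer; rewrite card_P in d128.
have := card_J2_le; rewrite -J2_Lagrange.
move: d128 centralizer3 centralizer5 (cardG_gt0 'C_J2[z2A]); move: #|'C_J2[z2A]| => n.
move=> d128 d3 d5 n_gt le.
have d15 : 3 * 5 %| n by rewrite Gauss_dvd // d3 d5.
have : 128 * 15 %| n by rewrite Gauss_dvd // d128 d15.
case/dvdnP => k nk; move: le n_gt; rewrite nk.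
case: k {nk} => [|[|k]]; [by [] | by rewrite mul1n | lia].
Qed.

(** The index is 315 * 15, which is odd. *)
Lemma sylow2_Sylow : 2.-Sylow(J2) sylow2.
Proof.
rewrite /pHall sylow2_sub_J2 /pgroup card_P (_ : 128%N = (2 ^ 7)%N) // pnatX /=.
rewrite -(Lagrange_index (subsetIl _ _) sylow2_sub_centralizer) index_cent1 card_class_z2A.
have -> : #|'C_J2[z2A] : sylow2| = 15%N.
  apply/eqP; rewrite -(@eqn_pmul2l 128) //; apply/eqP.
  by rewrite -card_centralizer -{1}card_P Lagrange // sylow2_sub_centralizer.
by rewrite p'natE // dvdn2 oddM.
Qed.

Lemma centerJ (A : {set {perm 'I_100}}) g : 'Z(A :^ g) = 'Z(A) :^ g.
Proof. by rewrite /center centJ conjIg. Qed.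

(** Sylow subgroups are conjugate, and [z2A] is the only nontrivial element of the centre of
    [sylow2]. *)
Lemma central_involutionE x : central_involution J2 x <-> x \in z2A ^: J2.
Proof.
split=> [/andP [/eqP ox /existsP [Q /andP [Q_syl xZ]]]|/imsetP [g gJ ->]].
  rewrite inE in Q_syl; have [g gJ EQ] := Sylow_trans sylow2_Sylow Q_syl.
  move: xZ; rewrite EQ centerJ mem_conjg => xZ.
  apply/imsetP; exists g => //; rewrite -(center_P xZ) ?conjgKV //.
  by rewrite -order_gt1 orderJ ox.
rewrite /central_involution orderJ z2A_order eqxx; apply/existsP; exists (sylow2 :^ g)%G.
rewrite inE pHallJ // sylow2_Sylow /= centerJ memJ_conjg; exact: z2A_center.
Qed.

(** The default 1 is never taken for [j < 315]. *)
Definition involution (j : nat) : {perm 'I_100} :=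
  odflt 1 [pick x in z2A ^: J2 | eqt (perm_tree x) (nth tree_1 invol j)].

Lemma involutionP j : j < 315 ->
  central_involution J2 (involution j) /\ perm_tree (involution j) = nth tree_1 invol j.
Proof.
move=> j_lt; rewrite /involution; case: pickP => [x /andP [xC /eqtE E]|none] /=.
  by split=> //; apply/central_involutionE.
have [x xC E] := invol_represented j_lt.
by have := none x; rewrite xC E eqt_refl.
Qed.

Lemma involution_inj i j : i < 315 -> j < 315 -> involution i = involution j -> i = j.
Proof.
move=> i_lt j_lt /(congr1 perm_tree).
have [_ ->] := involutionP i_lt; have [_ ->] := involutionP j_lt => E.
have /and4P [_ ui _ _] := class_checked.
have [lt|lt|//] := ltngtP i j.
  by case: (uniq_trees_nth (i := i) (j := j) ui); rewrite ?lt ?invol_size.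
by case: (uniq_trees_nth (i := j) (j := i) ui); rewrite ?lt ?invol_size.
Qed.

Lemma involution_surj x : central_involution J2 x -> exists2 j, j < 315 & involution j = x.
Proof.
move=> /central_involutionE /invol_complete [j j_lt E]; exists j => //.
by apply: perm_tree_inj; rewrite E; have [] := involutionP j_lt.
Qed.

Lemma nth_zip_invol j : j < 315 ->
  nth (0%N, tree_1) numbered_invol j = (j, nth tree_1 invol j).
Proof. by move=> j_lt; rewrite nth_zip ?size_iota ?invol_size // nth_iota. Qed.

Lemma involution_commute j k : j < k -> k < 315 ->
  commute (involution j) (involution k) -> k \in nb j.
Proof.
move=> jk k_lt /tree_commute_perm; have j_lt := ltn_trans jk k_lt.
have [_ ->] := involutionP j_lt; have [_ ->] := involutionP k_lt => c.
have /(all_nthP (0%N, tree_1)) A := commutation_checked.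
have sz : size numbered_invol = 315%N by rewrite size_zip size_iota invol_size.
move/(_ j): A; rewrite sz => /(_ j_lt); rewrite nth_zip_invol //.
move=> /(all_nthP (0%N, tree_1)) /(_ (k - j.+1)%N).
rewrite size_drop sz nth_drop subnKC // nth_zip_invol //= c; apply.
by rewrite ltn_sub2r // (leq_ltn_trans jk).
Qed.

Lemma involution_mul j k l : j < k -> k < l -> l < 315 -> (k, l) \in pairs j ->
  involution j * involution k = involution l.
Proof.
move=> jk kl l_lt klj; have k_lt := ltn_trans kl l_lt; have j_lt := ltn_trans jk k_lt.
have /(all_nthP (0%N, tree_1)) A := product_checked.
have sz : size numbered_invol = 315%N by rewrite size_zip size_iota invol_size.
move/(_ j): A; rewrite sz => /(_ j_lt); rewrite nth_zip_invol //.
move=> /allP /(_ _ klj); rewrite [(j, _).1]/= [(k, l).1]/= [(k, l).2]/= jk kl => /eqtE E.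
apply: perm_tree_inj; rewrite perm_treeM.
by have [_ ->] := involutionP j_lt; have [_ ->] := involutionP k_lt;
  have [_ ->] := involutionP l_lt.
Qed.

End HallJankoGroup.

(** * The isomorphism *)

Lemma involutions_triangle (gT : finGroupType) (a b c : gT) :
  (a * a = 1 -> b * b = 1 -> c * c = 1 -> a * b = c ->
   [/\ b * a = c, a * c = b, c * a = b, b * c = a & c * b = a])%g.
Proof.
move=> aa bb cc abc; have ba : (b * a = c)%g.
  have inv (x : gT) : (x * x = 1 -> x^-1 = x)%g by move=> xx; apply/eqP; rewrite eq_invg_mul xx.
  by rewrite -(inv c cc) -abc invMg (inv a aa) (inv b bb).
split=> //.
- by rewrite -abc mulgA aa mul1g.
- by rewrite -ba -mulgA aa mulg1.
- by rewrite -ba mulgA bb mul1g.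
- by rewrite -abc -mulgA bb mulg1.
Qed.

Lemma central_involution_square x : central_involution J2 x -> (x * x = 1)%g.
Proof. by case/andP => /eqP ox _; rewrite -(expg_order x) ox expgS expg1. Qed.

Lemma bijective_of_surj (S T : Type) (s0 : S) (f : S -> T) :
  injective f -> (forall t, exists s, f s = t) -> bijective f.
Proof.
move=> f_inj f_surj.
have fK t : f (epsilon (inhabits s0) (fun s => f s = t)) = t.
  exact: (epsilon_spec _ (fun s => f s = t) (f_surj t)).
by exists (fun t => epsilon (inhabits s0) (fun s => f s = t)) => [s|t] //; apply: f_inj.
Qed.

Lemma labelling_isomorphic (N : geometry) (N_near : near_polygon 4 N) (N_order : has_order 2 4 N)
    (phi : point N -> nat) :
  (forall x, phi x < 315) -> injective phi -> (forall j, j < 315 -> exists x, phi x = j) ->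
  (forall L x y z, line3 L x y z -> (phi y, phi z) \in pairs (phi x)) ->
  (forall x y, phi y \in nb (phi x) -> collinear x y) -> isomorphic N HJ.
Proof.
move=> phi_lt phi_inj phi_surj phi_line phi_nb.
pose inv x := involution (phi x).
have inv_central x : central_involution J2 (inv x) by have [] := involutionP (phi_lt x).
have inv_inj : injective inv by move=> x y /(involution_inj (phi_lt x) (phi_lt y)) /phi_inj.
have inv_sq x := central_involution_square (inv_central x).
have inv_mul L x y z : line3 L x y z -> (inv x * inv y = inv z)%g.
  (* Products are tabulated for increasing labels only; [involutions_triangle] supplies the other
     orders. *)
  have sorted L' u v w : line3 L' u v w -> phi u < phi v -> phi v < phi w ->
      (inv u * inv v = inv w)%g.
    by move=> l3 uv vw; apply: involution_mul (phi_line _ _ _ _ l3).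
  have tri u v w := involutions_triangle (inv_sq u) (inv_sq v) (inv_sq w).
  move=> l3; have [_ _ _ [xy xz yz _]] := l3.
  have l231 := line3_rot l3; have l312 := line3_rot l231.
  have l213 := line3_perm l3; have l321 := line3_perm l231; have l132 := line3_perm l312.
  have [lxy|lyx|/phi_inj //] := ltngtP (phi x) (phi y);
  have [lyz|lzy|/phi_inj //] := ltngtP (phi y) (phi z);
  have [lxz|lzx|/phi_inj //] := ltngtP (phi x) (phi z).
  - exact: sorted l3 lxy lyz.
  - by have := ltn_trans (ltn_trans lxy lyz) lzx; rewrite ltnn.
  - by have [] := tri _ _ _ (sorted _ _ _ _ l132 lxz lzy).
  - by have [] := tri _ _ _ (sorted _ _ _ _ l312 lzx lxy).
  - by have [] := tri _ _ _ (sorted _ _ _ _ l213 lyx lxz).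
  - by have [] := tri _ _ _ (sorted _ _ _ _ l231 lyz lzx).
  - by have := ltn_trans (ltn_trans lxz lzy) lyx; rewrite ltnn.
  - by have [] := tri _ _ _ (sorted _ _ _ _ l321 lzy lyx).
(* A line goes to the set of involutions of its points; excluded middle makes membership boolean. *)
pose image L : {set {perm 'I_100}} :=
  [set p | if excluded_middle_informative (exists2 x, inc x L & inv x = p) then true else false].
have imageP L p : reflect (exists2 x, inc x L & inv x = p) (p \in image L).
  by rewrite inE; case: excluded_middle_informative => E; constructor.
have mem_image L x : inc x L <-> inv x \in image L.
  by split=> [xL|/imageP [y yL /inv_inj <-] //]; apply/imageP; exists x.
have image3 L x y z : line3 L x y z -> image L = [set inv x; inv y; inv x * inv y]%g.
  move=> l3; rewrite (inv_mul _ _ _ _ l3); have [xL yL zL [_ _ _ all]] := l3.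
  apply/setP => p; rewrite !in_setU !in_set1; apply/imageP/idP.
    by case=> u /all [] -> <-; rewrite eqxx ?orbT.
  by case/orP => [/orP []|] /eqP ->; [exists x | exists y | exists z].
have line_points (L : line N) : exists x y z, line3 L x y z.
  have [[_ /(_ L) [x [y [xy xL yL]]]] _ _ _] := N_near.
  by have [z l3] := third_point N_order xL yL xy; exists x, y, z.
have image_line (L : line N) : involution_line J2 (image L).
  have [x [y [z l3]]] := line_points L; have [_ _ _ [xy _ _ _]] := l3.
  apply/existsP; exists (inv x); apply/existsP; exists (inv y).
  rewrite !inv_central (image3 _ _ _ _ l3) eqxx andbT /=; apply/andP; split.
    by apply: contra_not_neq xy => /inv_inj.
  have [-> _ _ _ _] := involutions_triangle (inv_sq x) (inv_sq y) (inv_sq z) (inv_mul _ _ _ _ l3).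
  by rewrite (inv_mul _ _ _ _ l3).
have [x0 _] := phi_surj 0 isT.
have [_ /(_ x0) [lx0 _]] := N_order; pose L0 := lx0 ord0.
exists (fun x => exist _ (inv x) (inv_central x)), (fun L => exist _ (image L) (image_line L)).
split=> [||x L]; last exact: mem_image.
  apply: (bijective_of_surj x0) => [x y [/inv_inj]//|[p pC]].
  have [j j_lt E] := involution_surj pC; have [x Ex] := phi_surj j j_lt.
  by exists x; apply: val_inj; rewrite /= /inv Ex.
apply: (bijective_of_surj L0) => [L M /(congr1 val) /= E|[B BL]].
  have [x [y [z [xL yL _ [xy _ _ _]]]]] := line_points L.
  by apply: (pls_line N_near xy) => //; apply/mem_image; rewrite -E; apply/mem_image.
have /existsP [p /existsP [q /and5P [pC qC pq /eqP comm /eqP EB]]] := BL.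
have [j j_lt Ep] := involution_surj pC; have [x Ex] := phi_surj j j_lt.
have [k k_lt Eq] := involution_surj qC; have [y Ey] := phi_surj k k_lt.
(* Commuting involutions have adjacent labels, which belong to collinear points; the third point of
   their line then carries the product, so this line has image [B]. *)
have xy : collinear x y.
  have [lt|lt|E] := ltngtP j k.
  - by apply: phi_nb; rewrite Ex Ey; apply: involution_commute => //; rewrite Ep Eq.
  - apply/collinear_sym/phi_nb; rewrite Ex Ey; apply: involution_commute => //.
    by rewrite Ep Eq; apply: esym.
  - by move: pq; rewrite -Ep -Eq E eqxx.
have [L [z l3]] := third_collinear N_order xy.
exists L; apply: val_inj; rewrite /= EB (image3 _ _ _ _ l3) /inv Ex Ey Ep Eq.
by [].
Qed.

Theorem theorem1p2 (N : geometry)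
    (N_near_octagon : near_octagon N)
    (N_order : has_order 2 4 N)
    (A : point N -> Prop) (B : line N -> Prop)
    (AB_H2D : isomorphic (subgeometry A B) H2D)
    (AB_isometric : isometrically_embedded A B) :
  isomorphic N HJ.
Proof.
have [h hE] := embedding_exists N_near_octagon AB_H2D AB_isometric.
have outer := outer_state_exists N_near_octagon N_order hE.
have [phi [? ? ? ? ?]] := near_octagon_labelling N_near_octagon N_order hE outer.
exact: (labelling_isomorphic N_near_octagon N_order).
Qed.
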